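(* Let $n\geq 1$, let $S_0=\{i\in\mathbb{Z}^n:i_1,\ldots,i_n\geq 0\}$, and let $(a_i)_{i\in S_0}$ be an indexed collection of nonnegative real numbers such that $a_0=1$ and $a_{i+j}\leq a_ia_j$ for all $i,j\in S_0$. Let $C_i\in[0,\infty]$ ($i\in\mathbb{Z}^n$) and $M\subset\mathbb{Z}^n$ be defined from $(a_i)_{i\in S_0}$ as in the context, and let $$K=\{s\in\mathbb{C}^n:|s_1^{i_1}\cdots s_n^{i_n}|\leq C_i\text{ for all }i\in M\}.$$ Then: (i) $K$ is a rationally convex connected circled set; and (ii) whenever $x_1,\ldots,x_n$ are elements of a commutative Banach algebra with $\lVert x_1^{i_1}\cdots x_n^{i_n}\rVert=a_i$ for all $i\in S_0$, the smallest rationally convex connected circled subset of $\mathbb{C}^n$ containing $\sigma(x_1,\ldots,x_n)$ contains $K$. Furthermore, $K$ is the largest subset of $\mathbb{C}^n$ for which (ii) holds; that is, if (ii) holds with $K$ replaced by a set $K'\subset\mathbb{C}^n$, then $K'\subset K$.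
   Context: Banach algebras are complex and unital, with submultiplicative norm and $\lVert 1\rVert=1$. For elements $x_1,\ldots,x_n$ of a commutative Banach algebra $A$, the joint spectrum is $\sigma(x_1,\ldots,x_n)=\{(\phi(x_1),\ldots,\phi(x_n)):\phi\in\mathcal{M}_A\}\subset\mathbb{C}^n$, where $\mathcal{M}_A$ is the set of nonzero multiplicative linear functionals $A\to\mathbb{C}$. Definition of $C_i$ and $M$: for $i\in\mathbb{Z}^n$ let $A_i=\{m\in S_0:m+i\in S_0\text{ and }a_m,a_{m+i}\text{ are not both }0\}$, and let $C_i=\sup_{m\in A_i}\frac{a_{m+i}}{a_m}$ if $A_i\neq\emptyset$ and $C_i=\infty$ otherwise, where a quotient with $a_m=0$ and $a_{m+i}>0$ is $\infty$. Let $\epsilon_k\in\mathbb{Z}^n$ have $k$-th coordinate $1$ and other coordinates $0$. Let $S=\{k:1\leq k\leq n,\ C_{-\epsilon_k}\text{ is finite}\}$ and $M=\{i\in\mathbb{Z}^n:i_k\geq 0\text{ for all }k\in\{1,\ldots,n\}\setminus S\}$. A compact set $K\subset\mathbb{C}^n$ is rationally convex if it equals its rational hull $\{s\in\mathbb{C}^n:|f(s)|\leq\sup_K|f|\text{ for every rational function }f\text{ analytic on }K\}$, where a rational function $f$ is analytic on $K$ if $f=p/q$ with $p,q$ polynomials in the complex coordinates and $q$ without zeros on $K$. A set $K\subset\mathbb{C}^n$ is circled if $(\alpha_1s_1,\ldots,\alpha_ns_n)\in K$ whenever $s\in K$ and $|\alpha_1|=\cdots=|\alpha_n|=1$. The smallest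 rationally convex connected circled set containing a given compact set exists; it is the one contained in all others. Conventions: $0^0=1$; an inequality $|s_1^{i_1}\cdots s_n^{i_n}|\leq c$ with some $i_k<0$ is understood to require $s_k\neq 0$. *)

(* Defs.v *)
From HB Require Import structures.
From mathcomp Require Import all_boot all_order all_algebra.
From mathcomp Require Import complex.
From mathcomp Require Import all_classical all_reals all_analysis.
From mathcomp Require mpoly.

Set Implicit Arguments.
Unset Strict Implicit.
Unset Printing Implicit Defensive.

Import Order.TTheory GRing.Theory Num.Theory.
Import numFieldNormedType.Exports.

Local Open Scope classical_set_scope.
Local Open Scope ring_scope.
Local Open Scope complex_scope.

(* The topology of the complex plane, so that row vectors over R[i] carry the
   product topology. *)
HB.instance Definition _ (R : rcfType) :=
  PseudoPointedMetric.copy R[i] (R[i]^o).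

Definition cabs (R : rcfType) (z : R[i]) : R := complex.Re `|z|.

(* A norm N making A a complex commutative unital Banach algebra.  N is kept
   apart from the canonical norm operator because Hierarchy Builder does not
   admit a join of GRing.ComAlgebra and CompleteNormedModule. *)
Record banach_norm (R : realType) (A : comAlgType R[i]) (N : A -> R) : Prop := {
  banach_normD : forall x y, N (x + y) <= N x + N y ;
  banach_normZ : forall (c : R[i]) x, N (c *: x) = cabs c * N x ;
  banach_norm0_eq0 : forall x, N x = 0 -> x = 0 ;
  banach_normM : forall x y, N (x * y) <= N x * N y ;
  banach_norm1 : N 1 = 1 ;
  banach_complete : forall u : nat -> A,
    (forall e, 0 < e -> exists p, forall k l,
      (p <= k)%N -> (p <= l)%N -> N (u k - u l) < e) ->
    exists v, N (u k - v) @[k --> \oo] --> 0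
}.

Section JointSpectrum.
Variables (R : realType) (n : nat).

Definition joint_spectrum (A : comAlgType R[i]) (x : 'I_n -> A) :
    set 'rV[R[i]]_n :=
  [set s | exists phi : {linear A -> R[i]^o},
    [/\ forall y z : A, phi (y * z) = phi y * phi z,
        exists y : A, phi y != 0 &
        s = \row_k phi (x k)]].

End JointSpectrum.

Section RationalConvexity.
Variables (R : realType) (n : nat).
Implicit Types (K H L X : set 'rV[R[i]]_n) (s z : 'rV[R[i]]_n).

Definition peval (p : mpoly.mpoly n R[i]) s : R[i] :=
  mpoly.meval (fun k => s 0 k) p.

(* A rational function analytic on K is given by p and q with q zero-free on K.
   The bound on its value at s includes that q does not vanish at s, as division
   by 0 is total here; if K is compact and q vanishes at s, then 1 / (q - d)
   with small d != 0 separates s from K anyway.  The supremum over the empty set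
   is -oo, so the rational hull of set0 is set0. *)
Definition rational_hull K : set 'rV[R[i]]_n :=
  [set s | forall p q : mpoly.mpoly n R[i],
    (forall z, K z -> peval q z != 0) ->
    peval q s != 0 /\
    ((cabs (peval p s / peval q s))%:E <=
      ereal_sup [set (cabs (peval p z / peval q z))%:E | z in K])%E].

Definition rationally_convex K := compact K /\ K = rational_hull K.

Definition circled K :=
  forall (c s : 'rV[R[i]]_n), (forall k, `|c 0 k| = 1) -> K s ->
    K (\row_k (c 0 k * s 0 k)).

Definition rat_convex_connected_circled K :=
  [/\ rationally_convex K, connected K & circled K].

Definition smallest_rat_convex_connected_circled X H :=
  [/\ rat_convex_connected_circled H, X `<=` H &
      forall L, rat_convex_connected_circled L -> X `<=` L -> H `<=` L].

End RationalConvexity.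

Section MonomialNorms.
Variables (R : realType) (n : nat).
(* Only the values of a on S0 matter. *)
Implicit Types (a : 'rV[int]_n -> R) (i m : 'rV[int]_n).

Definition S0 : set 'rV[int]_n := [set i | forall k, 0 <= i 0 k].

Definition Aset a i : set 'rV[int]_n :=
  [set m | [/\ S0 m, S0 (m + i) & ~ (a m = 0 /\ a (m + i) = 0)]].

(* The case b = c = 0 does not occur on Aset. *)
Definition equot (b c : R) : \bar R := if c == 0 then +oo%E else (b / c)%:E.

Definition Csup a i : \bar R :=
  if `[< Aset a i !=set0 >]
  then ereal_sup [set equot (a (m + i)) (a m) | m in Aset a i]
  else +oo%E.

Definition eps (k : 'I_n) : 'rV[int]_n := delta_mx 0 k.

Definition Sset a : set 'I_n := [set k | Csup a (- eps k) \is a fin_num].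

Definition Mset a : set 'rV[int]_n :=
  [set i | forall k, ~ Sset a k -> 0 <= i 0 k].

Definition monomial_le (s : 'rV[R[i]]_n) i (c : \bar R) :=
  (forall k, i 0 k < 0 -> s 0 k != 0) /\
  ((cabs (\prod_k s 0 k ^ i 0 k))%:E <= c)%E.

Definition Kset a : set 'rV[R[i]]_n :=
  [set s | forall i, Mset a i -> monomial_le s i (Csup a i)].

Definition contained_in_hulls a (K : set 'rV[R[i]]_n) :=
  forall (A : comAlgType R[i]) (N : A -> R) (x : 'I_n -> A),
    banach_norm N ->
    (forall i, S0 i -> N (\prod_k x k ^+ (absz (i 0 k))) = a i) ->
    exists2 H, smallest_rat_convex_connected_circled (joint_spectrum x) H &
               K `<=` H.

End MonomialNorms.

(* Main.v *)
Require Import Defs.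
From HB Require Import structures.
From mathcomp Require Import all_boot all_order all_algebra.
From mathcomp Require Import complex.
From mathcomp Require Import all_classical all_reals all_analysis.
From mathcomp Require Import (canonicals) mpoly.
From mathcomp Require Import cyclic separable cyclotomic.
From mathcomp Require Import ring lra.
Set Implicit Arguments.
Unset Strict Implicit.
Unset Printing Implicit Defensive.
Import Order.TTheory GRing.Theory Num.Theory.
Import numFieldNormedType.Exports.
Local Open Scope classical_set_scope.
Local Open Scope ring_scope.

(** The sets in the theorem are described by Laurent monomials.  Let S be a set
of indices and consider the points s with |s^j| <= c_j for a family of exponents
j that are negative only in coordinates of S, where the family bounds every
|s_k|, and |1/s_k| for k in S.  Such a set is rationally convex, since each
z^j is a rational function analytic on it, and it is connected: shrinking the
coordinates outside S to 0 stays inside the set, and what is left is convex in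
the logarithms of the moduli (mono_set_rcc).  Kset a is one of these sets.

Conversely, every rationally convex connected circled set L is equal to the set
cut out by the suprema over L of the Laurent monomials analytic on L
(monomial_hull_sub).  Looking at p - c q instead of p / q, it is enough that a
polynomial q without zeros on L has no zeros on this monomial hull
(monomial_hull_peval).  Near a point z of L, q is invertible in the algebra of
Laurent series that converge absolutely on a thin polyannulus around the torus
of z, because the characters of that algebra are the points of the polyannulus.
Two overlapping polyannuli share a torus, and inverses are unique in the algebra
of that torus, so both series have the same coefficients.  As L is connected,
there is one series for all of L; by compactness its truncations f make q f - 1
small in the sum of finitely many polyannulus norms, which dominates |q f - 1|
at every point of the monomial hull.  Hence q cannot vanish there.

This gives the smallest rationally convex connected circled set containing a
joint spectrum: it is the monomial hull of the spectrum.  Let j be an exponent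
analytic on the spectrum.  Then x^j makes sense in the Banach algebra, and
C_j <= N(x^j) because a_(m+j) = N(x^j x^m) <= N(x^j) a_m.  For s in Kset a this
yields |s^j|^t <= C_(tj) <= N((x^j)^t) for all t, so |s^j| is at most the spectral
radius of x^j, which is the supremum of |z^j| over the spectrum
(Kset_sub_hull).

For maximality, let s violate the inequality of some exponent i in Mset a.
Adjoin to the monomials x^m of norm a_m the inverses of the x_k with C_(-eps k)
finite, and the monomial x^i with norm C_i (or nothing, if C_i is infinite and
only the condition s_k <> 0 is violated): the weight of x^j is the cheapest way
to write it as a product of these.  The old norms survive (weight_S0), since the
steps of such a product can be ordered, first those along i and then those along
the -eps k, so that the path of exponents never leaves S0.  In the algebra
obtained the spectrum lies in a set of the kind above that misses s
(contained_in_Kset).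

The Banach algebras are completions of polynomial rings in variables x_k, y_k,
where y_k stands for 1/x_k, under l^1 seminorms of the Laurent coefficients.  All of
Gelfand theory that is needed rests on one estimate, spectral_radius_bound, in
which averages of the resolvent over roots of unity replace Cauchy integrals. *)

(** * The modulus and the topology of complex space *)

Section Cabs.
Variable R : rcfType.
Implicit Types z w : R[i].

Lemma cabsE z : (cabs z)%:C%C = `|z|.
Proof. by rewrite /cabs; apply/RRe_real/normr_real. Qed.

Lemma cabs_ge0 z : 0 <= cabs z.
Proof. by rewrite -lecR cabsE normr_ge0. Qed.

Lemma cabsM z w : cabs (z * w) = cabs z * cabs w.
Proof. by apply: complexI; rewrite rmorphM /= !cabsE normrM. Qed.

Lemma cabsD z w : cabs (z + w) <= cabs z + cabs w.
Proof. by rewrite -lecR rmorphD /= !cabsE ler_normD. Qed.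

Lemma cabsN z : cabs (- z) = cabs z.
Proof. by rewrite /cabs normrN. Qed.

Lemma cabs0 : cabs (0 : R[i]) = 0.
Proof. by rewrite /cabs normr0. Qed.

Lemma cabs1 : cabs (1 : R[i]) = 1.
Proof. by rewrite /cabs normr1. Qed.

Lemma cabs_eq0 z : (cabs z == 0) = (z == 0).
Proof. by rewrite -(inj_eq (@complexI R)) cabsE normr_eq0. Qed.

Lemma cabs_gt0 z : (0 < cabs z) = (z != 0).
Proof. by rewrite lt_def cabs_eq0 cabs_ge0 andbT. Qed.

Lemma cabsV z : cabs z^-1 = (cabs z)^-1.
Proof. by apply: complexI; rewrite fmorphV /= !cabsE normfV. Qed.

Lemma cabsX z n : cabs (z ^+ n) = cabs z ^+ n.
Proof. by elim: n => [|n IH]; rewrite ?cabs1 // !exprS cabsM IH. Qed.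

Lemma cabs_exprz z (n : int) : cabs (z ^ n) = cabs z ^ n.
Proof. by case: n => n; rewrite /= ?NegzE -?exprnN -?exprnP ?cabsV cabsX. Qed.

Lemma cabs_prod (I : Type) (r : seq I) (P : pred I) (F : I -> R[i]) :
  cabs (\prod_(i <- r | P i) F i) = \prod_(i <- r | P i) cabs (F i).
Proof. by elim/big_rec2: _ => [|i x y _ <-]; rewrite ?cabs1 ?cabsM. Qed.

Lemma cabs_sum (I : Type) (r : seq I) (P : pred I) (F : I -> R[i]) :
  cabs (\sum_(i <- r | P i) F i) <= \sum_(i <- r | P i) cabs (F i).
Proof.
elim/big_rec2: _ => [|i x y _ IH]; rewrite ?cabs0 //.
by apply: le_trans (cabsD _ _) _; rewrite lerD2l.
Qed.

Lemma cabs_real (x : R) : cabs (x%:C)%C = `|x|.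
Proof. by apply: complexI; rewrite cabsE normc_def /= expr0n /= addr0 sqrtr_sqr. Qed.

Lemma cabs_nat n : cabs (n%:R : R[i]) = n%:R.
Proof. by rewrite /cabs normr_nat -(rmorph_nat (real_complex R)). Qed.

Lemma cabsB z w : cabs (z - w) = cabs (w - z).
Proof. by rewrite -cabsN opprB. Qed.

Lemma cabs_distD (a b c : R[i]) : cabs (a - c) <= cabs (a - b) + cabs (b - c).
Proof. by apply: le_trans (cabsD _ _); rewrite addrA subrK. Qed.

Lemma ler_cabs_dist z w : `|cabs z - cabs w| <= cabs (z - w).
Proof.
rewrite ler_norml; apply/andP; split.
  have := cabsD z (w - z); rewrite addrC subrK (cabsB z) => h; lra.
have := cabsD w (z - w); rewrite addrC subrK => h; lra.
Qed.

Lemma cabs_Re z : `|complex.Re z| <= cabs z.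
Proof.
rewrite -lecR cabsE normc_def lecR /= -sqrtr_sqr ler_sqrt; last first.
  by rewrite addr_ge0 ?sqr_ge0.
by rewrite lerDl sqr_ge0.
Qed.

Lemma cabs_Im z : `|complex.Im z| <= cabs z.
Proof.
rewrite -lecR cabsE normc_def lecR /= -sqrtr_sqr ler_sqrt; last first.
  by rewrite addr_ge0 ?sqr_ge0.
by rewrite lerDr sqr_ge0.
Qed.

Lemma cabs_norm1 z : (`|z| = 1) <-> cabs z = 1.
Proof. by rewrite -cabsE; split=> [/(@complexI R _ 1)|->]. Qed.

End Cabs.

Section ComplexTopology.
Variable R : realType.

Lemma ball_cabs (z w : R[i]) (e : R) : ball z (e%:C)%C w = (cabs (z - w) < e) :> Prop.
Proof. by rewrite /ball /= -cabsE ltcR. Qed.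

(** The balls of the topology have radii in R[i]; this restores real radii. *)
Lemma near_cabs (z : R[i]) (P : set R[i]) :
  (\forall w \near z, P w) <-> exists2 e : R, 0 < e & forall w, cabs (z - w) < e -> P w.
Proof.
split.
  move=> /nbhs_ballP[e /= e0 eP].
  have eE : e = ((complex.Re e)%:C)%C by rewrite RRe_real // ger0_real // ltW.
  exists (complex.Re e); first by rewrite -ltcR -eE.
  by move=> w hw; apply: eP; rewrite eE ball_cabs.
move=> [e e0 eP]; apply/nbhs_ballP; exists (e%:C)%C; first by rewrite /= ltcR.
by move=> w; rewrite ball_cabs; exact: eP.
Qed.

Lemma near_rV n (z : 'rV[R[i]]_n) (P : set 'rV[R[i]]_n) :
  (\forall w \near z, P w) <->
  exists2 e : R, 0 < e &
    forall w : 'rV[R[i]]_n, (forall k, cabs (z 0 k - w 0 k) < e) -> P w.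
Proof.
split.
  move=> /nbhs_ballP[e /= e0 eP].
  have eE : e = ((complex.Re e)%:C)%C by rewrite RRe_real // ger0_real // ltW.
  have e0' : 0 < complex.Re e by rewrite -ltcR -eE.
  exists (complex.Re e) => // w hw; apply: eP; rewrite eE; split; first by rewrite -eE.
  by move=> i k; rewrite ball_cabs ord1.
move=> [e e0 eP]; apply/nbhs_ballP; exists (e%:C)%C; first by rewrite /= ltcR.
move=> w [_ hw]; apply: eP => k; have := hw 0 k.
by rewrite ball_cabs.
Qed.

Lemma compact_square (T : R) :
  compact [set z : R[i] | `|complex.Re z| <= T /\ `|complex.Im z| <= T].
Proof.
pose f (x : R * R) : R[i] := (x.1 +i* x.2)%C.
have -> : [set z : R[i] | `|complex.Re z| <= T /\ `|complex.Im z| <= T] =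
   f @` (`[- T, T] `*` `[- T, T]).
  apply/seteqP; split => [[x y] [/= hx hy]|_ [[x y] [/= hx hy]] <- /=].
    exists (x, y) => //=; split; by rewrite /= in_itv /= -ler_norml.
  by move: hx hy; rewrite !in_itv /= -!ler_norml.
apply: continuous_compact; last first.
  by apply: compact_setX; apply: segment_compact.
apply: continuous_subspaceT => -[x y].
apply/cvg_ballP => e e0.
have /near_cabs[d d0 dP] : \forall w \near f (x, y), ball (f (x, y)) e w by exact: nbhsx_ballx.
have d20 : 0 < d / 2 by lra.
have h1 : \forall p \near (x, y), `|x - p.1| < d / 2.
  apply: (@cvg_fst _ _ (nbhs x) (nbhs y) _ [set a | `|x - a| < d / 2]).
  exact: (nbhsx_ballx x (d / 2)).
have h2 : \forall p \near (x, y), `|y - p.2| < d / 2.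
  apply: (@cvg_snd _ _ (nbhs x) (nbhs y) _ [set a | `|y - a| < d / 2]).
  exact: (nbhsx_ballx y (d / 2)).
near=> p => /=; apply: dP.
rewrite /f /=.
have -> : (x +i* y)%C - (p.1 +i* p.2)%C = (x - p.1)%:C%C + (0 +i* 1)%C * (y - p.2)%:C%C.
  by apply/eqP; rewrite eq_complex /=; apply/andP; split; apply/eqP; ring.
apply: le_lt_trans (cabsD _ _) _; rewrite cabsM !cabs_real.
have -> : cabs (0 +i* 1 : R[i])%C = 1.
  by rewrite /cabs normc_def /= expr0n add0r expr1n sqrtr1.
rewrite mul1r [ltRHS]splitr; apply: ltrD; [near: p; exact: h1 | near: p; exact: h2].
Unshelve. all: try by end_near.
Qed.

End ComplexTopology.

Section Continuity.
Variable R : realType.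

Lemma compact_disc (T : R) : compact [set z : R[i] | cabs z <= T].
Proof.
apply: (@subclosed_compact _ _ _ _ (@compact_square R T)) => [|z /= hz].
  rewrite -openC openE => z /= /negP; rewrite -ltNge => hz.
  apply/near_cabs; exists (cabs z - T); rewrite ?subr_gt0 // => w hw /=.
  apply/negP; rewrite -ltNge.
  have := cabsD w (z - w); rewrite addrC subrK; lra.
by split; [apply: le_trans (cabs_Re z) hz | apply: le_trans (cabs_Im z) hz].
Qed.

(** f will be the seminorm of an arbitrarily chosen inverse, for which only a local
bound at every point is available. *)
Lemma compact_bounded (X : topologicalType) (K : set X) (f : X -> R) : compact K ->
  (forall z, K z -> exists M, \forall w \near z, K w -> f w <= M) ->
  exists M, forall z, K z -> f z <= M.
Proof.
move=> /compact_near_coveringP cK floc.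
have : \forall M \near +oo, K `<=` [set z | K z -> f z <= M].
  apply: cK => z Kz; have [M hM] := floc z Kz.
  exists ([set w | K w -> f w <= M], [set x | M < x]) => /=.
    by split => //; exists M; split => //; exact: num_real.
  by move=> [w x] /= [h1 h2] Kw; rewrite (le_trans (h1 Kw)) // ltW.
move=> /filter_ex [M hM]; exists M => z Kz; exact: hM.
Qed.

(** Pointwise continuity on row vectors, stated with the modulus so that sums and
products of coordinate functions are treated without the norm on R[i]. *)
Definition rvcont n (f : 'rV[R[i]]_n -> R[i]) := forall z (e : R), 0 < e ->
  \forall w \near z, cabs (f z - f w) < e.

Lemma rvcont_cst n c : rvcont (fun _ : 'rV[R[i]]_n => c).
Proof. by move=> z e e0; apply/near_rV; exists 1 => // w _; rewrite subrr cabs0. Qed.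

Lemma rvcont_coord n k : rvcont (fun s : 'rV[R[i]]_n => s 0 k).
Proof. by move=> z e e0; apply/near_rV; exists e. Qed.

Lemma rvcontD n (f g : 'rV[R[i]]_n -> R[i]) : rvcont f -> rvcont g ->
  rvcont (fun s => f s + g s).
Proof.
move=> hf hg z e e0; have e2 : 0 < e / 2 by lra.
near=> w; rewrite [ltRHS]splitr.
have -> : f z + g z - (f w + g w) = (f z - f w) + (g z - g w) by ring.
apply: le_lt_trans (cabsD _ _) _; apply: ltrD; near: w; [exact: hf|exact: hg].
Unshelve. all: by end_near. Qed.

Lemma rvcontM n (f g : 'rV[R[i]]_n -> R[i]) : rvcont f -> rvcont g ->
  rvcont (fun s => f s * g s).
Proof.
move=> hf hg z e e0.
pose B := cabs (f z) + cabs (g z) + 1.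
have B0 : 0 < B by have := cabs_ge0 (f z); have := cabs_ge0 (g z); rewrite /B; lra.
pose d := Num.min 1 (e / (2 * B)).
have d0 : 0 < d by rewrite /d lt_min ltr01 divr_gt0 // mulr_gt0 // ltr0n.
near=> w.
have hfw : cabs (f z - f w) < d by near: w; exact: hf.
have hgw : cabs (g z - g w) < d by near: w; exact: hg.
have -> : f z * g z - f w * g w = (f z - f w) * g z + f w * (g z - g w) by ring.
apply: le_lt_trans (cabsD _ _) _; rewrite !cabsM.
have d1 : d <= 1 by rewrite /d ge_min lexx.
have dB : d * B <= e / 2.
  have : d * (2 * B) <= e.
    by rewrite -ler_pdivlMr ?mulr_gt0 ?ltr0n // /d ge_min lexx orbT.
  lra.
have fwB : cabs (f w) <= B.
  have := cabsD (f z) (f w - f z); rewrite addrC subrK (cabsB (f w)).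
  have := cabs_ge0 (g z); rewrite /B; lra.
have gB : cabs (g z) < B by have := cabs_ge0 (f z); rewrite /B; lra.
have h1 : cabs (f z - f w) * cabs (g z) <= d * cabs (g z).
  by rewrite ler_wpM2r ?cabs_ge0 // ltW.
have h2 : cabs (f w) * cabs (g z - g w) <= B * d.
  by apply: ler_pM; rewrite ?cabs_ge0 // ltW.
have h3 : d * cabs (g z) < d * B by rewrite ltr_pM2l.
rewrite [B * d]mulrC in h2; lra.
Unshelve. all: by end_near. Qed.

Lemma rvcont_sum n (I : Type) (r : seq I) (F : I -> 'rV[R[i]]_n -> R[i]) :
  (forall i, rvcont (F i)) -> rvcont (fun s => \sum_(i <- r) F i s).
Proof.
move=> hF; elim: r => [|i r IH].
  have -> : (fun s => \sum_(i <- [::]) F i s) = fun=> 0 by apply/funext => s; rewrite big_nil.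
  exact: rvcont_cst.
have -> : (fun s => \sum_(j <- i :: r) F j s) = fun s => F i s + \sum_(j <- r) F j s.
  by apply/funext => s; rewrite big_cons.
exact: rvcontD.
Qed.

Lemma rvcont_prod n (I : Type) (r : seq I) (F : I -> 'rV[R[i]]_n -> R[i]) :
  (forall i, rvcont (F i)) -> rvcont (fun s => \prod_(i <- r) F i s).
Proof.
move=> hF; elim: r => [|i r IH].
  have -> : (fun s => \prod_(i <- [::]) F i s) = fun=> 1 by apply/funext => s; rewrite big_nil.
  exact: rvcont_cst.
have -> : (fun s => \prod_(j <- i :: r) F j s) = fun s => F i s * \prod_(j <- r) F j s.
  by apply/funext => s; rewrite big_cons.
exact: rvcontM.
Qed.

Lemma rvcontX n (f : 'rV[R[i]]_n -> R[i]) m : rvcont f -> rvcont (fun s => f s ^+ m).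
Proof.
move=> hf; elim: m => [|m IH]; first exact: rvcont_cst.
have -> : (fun s => f s ^+ m.+1) = fun s => f s * f s ^+ m.
  by apply/funext => s; rewrite exprS.
exact: rvcontM.
Qed.

(** The form f <= c g avoids the quotient f / g, which is not continuous where g
vanishes. *)
Lemma rvcont_closed_le n (f g : 'rV[R[i]]_n -> R[i]) (c : R) : rvcont f -> rvcont g ->
  closed [set s | cabs (f s) <= c * cabs (g s)].
Proof.
move=> hf hg; rewrite -openC openE => z /= /negP; rewrite -ltNge => hz.
have hG : rvcont (fun s => (c%:C)%C * g s) by exact: rvcontM (rvcont_cst _) hg.
pose e := (cabs (f z) - c * cabs (g z)) / 2.
have e0 : 0 < e by rewrite /e; lra.
pose c1 := `|c| + 1.
have c10 : 0 < c1 by rewrite /c1; have := normr_ge0 c; lra.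
have ec : 0 < e / c1 by rewrite divr_gt0.
near=> w => /=; apply/negP; rewrite -ltNge.
have h1 : cabs (f z - f w) < e by near: w; exact: hf.
have h2 : cabs (g z - g w) < e / c1 by near: w; exact: hg.
have h3 := ler_cabs_dist (g z) (g w).
have h4 : `|c * cabs (g z) - c * cabs (g w)| < e.
  rewrite -mulrBr normrM.
  have : c1 * cabs (g z - g w) < e by rewrite mulrC -ltr_pdivlMr.
  have := cabs_ge0 (g z - g w); have := normr_ge0 c; rewrite /c1 => a1 a2 a3.
  have : `|c| * `|cabs (g z) - cabs (g w)| <= `|c| * cabs (g z - g w) by rewrite ler_wpM2l.
  lra.
have h5 := ler_cabs_dist (f z) (f w).
move: h4 h5; rewrite ltr_norml ler_norml => /andP[h4 h4'] /andP[h5 h5'].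
rewrite /e in h1 h4 h4'; lra.
Unshelve. all: by end_near. Qed.

Lemma peval_rvcont n (q : mpoly.mpoly n R[i]) : rvcont (peval q).
Proof.
have -> : peval q = fun s => \sum_(m <- mpoly.msupp q)
    mpoly.mcoeff m q * \prod_(k < n) s 0 k ^+ mpoly.fun_of_multinom m k.
  by apply/funext => s; rewrite /peval mpoly.mevalE.
apply: rvcont_sum => m; apply: rvcontM; first exact: rvcont_cst.
by apply: rvcont_prod => k; apply/rvcontX/rvcont_coord.
Qed.

End Continuity.

(** * The spectral radius by averages over roots of unity *)

(** In characteristic 0 the polynomial X^n - 1 is separable, so it has n distinct
roots. *)
Lemma primitive_root_exists (F : numClosedFieldType) n : (0 < n)%N -> {z : F | n.-primitive_root z}.
Proof.
move=> n0; have [rs Ers] := closed_field_poly_normal ('X^n - 1 : {poly F}).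
have {}Ers : 'X^n - 1 = \prod_(w <- rs) ('X - w%:P).
  by rewrite Ers (monicP (monicXnsubC (1 : F) n0)) scale1r.
have nF : (n%:R : F) != 0 by rewrite pnatr_eq0 -lt0n.
have urs : uniq rs by rewrite -separable_prod_XsubC -Ers separable_Xn_sub_1.
have size_rs : (n <= size rs)%N.
  by rewrite -ltnS -(size_XnsubC (1 : F) n0) Ers size_prod_XsubC.
have unity_rs : all n.-unity_root rs.
  by apply/allP => w wrs; rewrite /root_of_unity Ers root_prod_XsubC.
by apply/sigW; have /hasP[w _ hw] := has_prim_root n0 unity_rs urs size_rs; exists w.
Qed.

Lemma primitive_root_power_sum (F : fieldType) n (z : F) k : n.-primitive_root z ->
  (0 < k < n)%N -> \sum_(i < n) (z ^+ i) ^+ k = 0.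
Proof.
move=> hz /andP[k0 kn].
have zk1 : z ^+ k != 1 by rewrite -(prim_order_dvd hz) gtnNdvd.
have h : (z ^+ k - 1) * \sum_(i < n) (z ^+ i) ^+ k = 0.
  rewrite (eq_bigr (fun i : 'I_n => (z ^+ k) ^+ i)); last first.
    by move=> i _; rewrite -!exprM mulnC.
  by rewrite -subrX1 exprAC (prim_expr_order hz) expr1n subrr.
by move/eqP: h; rewrite mulf_eq0 subr_eq0 (negPf zk1) => /eqP.
Qed.

Section Seminorm.
Variables (R : realType) (A : comAlgType R[i]).

(** Possibly indefinite and with p 1 arbitrary, so that norms of quotients by ideals
are covered. *)
Record alg_seminorm (p : A -> R) : Prop := {
  sn_D : forall x y, p (x + y) <= p x + p y;
  sn_Z : forall (c : R[i]) x, p (c *: x) = cabs c * p x;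
  sn_M : forall x y, p (x * y) <= p x * p y }.

Variables (p : A -> R) (hp : alg_seminorm p).

Lemma sn0 : p 0 = 0.
Proof. by rewrite -(scale0r 0) (sn_Z hp) cabs0 mul0r. Qed.

Lemma snN x : p (- x) = p x.
Proof. by rewrite -scaleN1r (sn_Z hp) cabsN cabs1 mul1r. Qed.

Lemma sn_ge0 x : 0 <= p x.
Proof. by have := sn_D hp x (- x); rewrite subrr sn0 snN; lra. Qed.

Lemma snB x y : p (x - y) <= p x + p y.
Proof. by rewrite -(snN y); apply: (sn_D hp). Qed.

Lemma sn_distC x y : p (x - y) = p (y - x).
Proof. by rewrite -snN opprB. Qed.

Lemma sn_sum (I : Type) (r : seq I) (F : I -> A) :
  p (\sum_(i <- r) F i) <= \sum_(i <- r) p (F i).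
Proof.
elim/big_rec2: _ => [|i y x _ h]; first by rewrite sn0.
by apply: le_trans (sn_D hp _ _) _; rewrite lerD2l.
Qed.

Lemma sn_lt3 x y z e : p x < e / 3 -> p y <= e / 3 -> p z <= e / 3 -> p (x + (y - z)) < e.
Proof.
move=> h1 h2 h3; have := sn_D hp x (y - z); have := snB y z; lra.
Qed.

Lemma snX x n : p (x ^+ n.+1) <= p x ^+ n.+1.
Proof.
elim: n => [|n IH]; first by rewrite !expr1.
rewrite exprS [leRHS]exprS; apply: le_trans (sn_M hp _ _) _.
by rewrite ler_wpM2l // sn_ge0.
Qed.

(** Equality in the quotient by the kernel of p, which is an ideal. *)
Definition eqk x y := p (x - y) = 0.

Lemma eqk_le x y : p (x - y) <= 0 -> eqk x y.
Proof. by move=> h; apply/eqP; rewrite eq_le h sn_ge0. Qed.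

Lemma eqk_refl x : eqk x x. Proof. by rewrite /eqk subrr sn0. Qed.

Lemma eqk_sym x y : eqk x y -> eqk y x.
Proof. by rewrite /eqk sn_distC. Qed.

Lemma eqk_trans y x z : eqk x y -> eqk y z -> eqk x z.
Proof.
move=> h1 h2; apply: eqk_le; have := sn_D hp (x - y) (y - z).
by rewrite h1 h2 addr0 addrA subrK.
Qed.

Lemma eqkD x y z t : eqk x y -> eqk z t -> eqk (x + z) (y + t).
Proof.
move=> h1 h2; apply: eqk_le; have := sn_D hp (x - y) (z - t).
by rewrite h1 h2 addr0 addrACA opprD.
Qed.

Lemma eqkMl z x y : eqk x y -> eqk (z * x) (z * y).
Proof.
by move=> h; apply: eqk_le; rewrite -mulrBr (le_trans (sn_M hp _ _)) // h mulr0.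
Qed.

Lemma eqkMr z x y : eqk x y -> eqk (x * z) (y * z).
Proof. by rewrite ![_ * z]mulrC; apply: eqkMl. Qed.

Lemma eqkM x y z t : eqk x y -> eqk z t -> eqk (x * z) (y * t).
Proof. by move=> h1 h2; apply: (@eqk_trans (y * z)); [apply: eqkMr|apply: eqkMl]. Qed.

Lemma eqkZ (c : R[i]) x y : eqk x y -> eqk (c *: x) (c *: y).
Proof. by rewrite /eqk -scalerBr (sn_Z hp) => ->; rewrite mulr0. Qed.

Lemma eqk_sum (I : Type) (r : seq I) (F G : I -> A) :
  (forall i, eqk (F i) (G i)) -> eqk (\sum_(i <- r) F i) (\sum_(i <- r) G i).
Proof.
move=> h; elim/big_rec2: _ => [|i x y _ IH]; first exact: eqk_refl.
exact: eqkD.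
Qed.

Lemma eqk_sn x y : eqk x y -> p x = p y.
Proof.
move=> h; apply/eqP; rewrite eq_le; apply/andP; split.
  by have := sn_D hp y (x - y); rewrite addrC subrK h addr0.
by have := sn_D hp x (y - x); rewrite addrC subrK (eqk_sym h) addr0.
Qed.

Section Resolvent.
Variables (y : A) (T : R) (G : R[i] -> A).
Hypothesis T0 : 0 <= T.
Hypothesis hG : forall mu, cabs mu <= T -> eqk ((1 - mu *: y) * G mu) 1.

(** The resolvent identity: multiply the difference by the two factors
1 - mu y and 1 - nu y. *)
Lemma resolvent_eq mu nu : cabs mu <= T -> cabs nu <= T ->
  eqk (G nu - G mu) ((nu - mu) *: (y * G mu * G nu)).
Proof.
move=> hm hn.
have h1 : eqk (G nu * ((1 - mu *: y) * G mu)) (G nu).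
  by have := eqkMl (G nu) (hG hm); rewrite mulr1.
have h2 : eqk (G mu * ((1 - nu *: y) * G nu)) (G mu).
  by have := eqkMl (G mu) (hG hn); rewrite mulr1.
have h3 : eqk (- (G mu * ((1 - nu *: y) * G nu))) (- G mu).
  by rewrite /eqk -opprD snN.
apply: eqk_sym; move: (eqkD h1 h3); congr eqk.
by rewrite -!(mulr_algl _ y) -(mulr_algl (nu - mu)) scalerBl; ring.
Qed.

Lemma resolvent_lip mu nu : cabs mu <= T -> cabs nu <= T ->
  p (G nu - G mu) <= cabs (nu - mu) * (p y * p (G mu) * p (G nu)).
Proof.
move=> hm hn; rewrite (eqk_sn (resolvent_eq hm hn)) (sn_Z hp).
rewrite ler_wpM2l ?cabs_ge0 //; apply: le_trans (sn_M hp _ _) _.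
by rewrite ler_wpM2r ?sn_ge0 // (sn_M hp).
Qed.

(** Near mu, the resolvent identity gives |G nu| <= |G mu| + |G nu| / 2, hence
|G nu| <= 2 |G mu|; the disc is compact. *)
Lemma resolvent_bounded : exists B, forall mu, cabs mu <= T -> p (G mu) <= B.
Proof.
have [] := @compact_bounded R R[i] [set z | cabs z <= T] (fun z => p (G z))
   (@compact_disc R T); last by move=> B hB; exists B.
move=> mu /= hm.
exists (2 * p (G mu)).
pose c := 2 * (p y * p (G mu)) + 1.
have c0 : 0 < c.
  by have := mulr_ge0 (sn_ge0 y) (sn_ge0 (G mu)); rewrite /c; lra.
apply/near_cabs; exists c^-1; first by rewrite invr_gt0.
move=> nu hnu hn.
have h1 := resolvent_lip hm hn.
have h2 : p (G nu) <= p (G mu) + p (G nu - G mu).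
  by have := sn_D hp (G mu) (G nu - G mu); rewrite addrC subrK.
have h3 : cabs (nu - mu) * (p y * p (G mu)) <= 1 / 2.
  have : cabs (nu - mu) * c <= 1.
    by rewrite cabsB -ler_pdivlMr // div1r ltW.
  have := cabs_ge0 (nu - mu); rewrite /c; lra.
have h4 : cabs (nu - mu) * (p y * p (G mu)) * p (G nu) <= 1 / 2 * p (G nu).
  by rewrite ler_wpM2r ?sn_ge0.
rewrite mulrA in h1; lra.
Qed.

(** With G mu an inverse of 1 - mu y, this is a discrete substitute for the Cauchy
integral of the resolvent over the circle of radius t. *)
Definition root_average n (z : R[i]) (t : R) : A :=
  (n%:R^-1) *: \sum_(k < n) G (z ^+ k * (t%:C)%C).

Lemma cabs_unity n (z : R[i]) : n.-primitive_root z -> cabs z = 1.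
Proof.
move=> hz; have n0 := prim_order_gt0 hz.
have : cabs z ^+ n = 1 by rewrite -cabsX (prim_expr_order hz) cabs1.
by move/eqP; rewrite pexpr_eq1 ?cabs_ge0 // => /eqP.
Qed.

Lemma cabs_root_pt n (z : R[i]) k (t : R) : n.-primitive_root z -> 0 <= t ->
  cabs (z ^+ k * (t%:C)%C) = t.
Proof.
by move=> hz t0; rewrite cabsM cabsX (cabs_unity hz) expr1n mul1r cabs_real ger0_norm.
Qed.

(** Averaging the geometric sums that invert 1 - (w t y) modulo 1 - (t y)^n over the
n-th roots of unity w kills all powers of y between 0 and n. *)
Lemma root_average_inv n (z : R[i]) (t : R) : n.-primitive_root z -> 0 <= t <= T ->
  eqk ((1 - (t%:C)%C ^+ n *: y ^+ n) * root_average n z t) 1.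
Proof.
move=> hz /andP[t0 tT]; have n0 := prim_order_gt0 hz.
have n0' : (n%:R : R[i]) != 0 by rewrite pnatr_eq0 -lt0n.
set u := 1 - _.
have hk (k : 'I_n) : eqk (u * G (z ^+ k * (t%:C)%C))
      (\sum_(j < n) ((z ^+ k * (t%:C)%C) *: y) ^+ j).
  have -> : u = (\sum_(j < n) ((z ^+ k * (t%:C)%C) *: y) ^+ j) * (1 - (z ^+ k * (t%:C)%C) *: y).
    rewrite mulrC -opprB mulNr -subrX1 opprB /u exprZn exprMn exprAC.
    by rewrite (prim_expr_order hz) expr1n mul1r.
  rewrite -mulrA -[X in eqk _ X]mulr1; apply: eqkMl; apply: hG.
  by rewrite (cabs_root_pt _ hz).
rewrite /root_average -scalerAr mulr_sumr.
have -> : (1 : A) = n%:R^-1 *: \sum_(k < n) \sum_(j < n) ((z ^+ k * (t%:C)%C) *: y) ^+ j.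
  rewrite exchange_big /=.
  have -> : \sum_(j < n) \sum_(k < n) ((z ^+ k * (t%:C)%C) *: y) ^+ j = n%:R%:A.
    case: n n0 z hz n0' u hk => // n _ z hz _ _ _.
    rewrite big_ord_recl /= [X in X + _](eq_bigr (fun=> 1)); last by move=> i _; rewrite expr0.
    rewrite sumr_const card_ord big1 ?addr0 ?scaler_nat // => j _.
    under eq_bigr do rewrite exprZn exprMn -scalerA.
    by rewrite -scaler_suml (primitive_root_power_sum hz) ?scale0r //= /bump add1n ltnS ltn_ord.
  by rewrite scalerA mulVf // scale1r.
by apply/eqkZ/eqk_sum.
Qed.

Lemma root_average_lip n (z : R[i]) (t s B : R) : n.-primitive_root z ->
  (forall mu, cabs mu <= T -> p (G mu) <= B) ->
  0 <= t <= T -> 0 <= s <= T ->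
  p (root_average n z t - root_average n z s) <= `|t - s| * (p y * B * B).
Proof.
move=> hz hB /andP[t0 tT] /andP[s0 sT]; have n0 := prim_order_gt0 hz.
rewrite /root_average -scalerBr (sn_Z hp) cabsV cabs_nat -sumrB ler_pdivrMl ?ltr0n //.
apply: le_trans (sn_sum _ _) _.
apply: le_trans (ler_sum _ (G := fun=> `|t - s| * (p y * B * B)) _) _ => /=; last first.
  by rewrite sumr_const card_ord mulr_natl.
move=> k _.
have hs : cabs (z ^+ k * (s%:C)%C) <= T by rewrite (cabs_root_pt _ hz).
have ht : cabs (z ^+ k * (t%:C)%C) <= T by rewrite (cabs_root_pt _ hz).
apply: le_trans (resolvent_lip hs ht) _.
rewrite -mulrBr -rmorphB /= cabsM cabsX (cabs_unity hz) expr1n mul1r cabs_real.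
rewrite ler_wpM2l // ler_pM ?mulr_ge0 ?sn_ge0 // ?hB //.
by rewrite ler_wpM2l ?sn_ge0 // hB.
Qed.

Lemma root_average_bound n (z : R[i]) (t B : R) : n.-primitive_root z ->
  (forall mu, cabs mu <= T -> p (G mu) <= B) -> 0 <= t <= T -> p (root_average n z t) <= B.
Proof.
move=> hz hB /andP[t0 tT]; have n0 := prim_order_gt0 hz.
rewrite /root_average (sn_Z hp) cabsV cabs_nat ler_pdivrMl ?ltr0n //.
apply: le_trans (sn_sum _ _) _.
apply: le_trans (ler_sum _ (G := fun=> B) _) _ => /=; last by rewrite sumr_const card_ord mulr_natl.
by move=> k _; apply: hB; rewrite (cabs_root_pt _ hz).
Qed.

Definition geom_bounded (t : R) := exists M, forall n, p (y ^+ n) * t ^+ n <= M.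

(** If p (y^n) t^n stays bounded and r < t, then p (y^n) r^n tends to 0 and the root
average at r tends to 1 as n grows.  The averages are Lipschitz in the radius
uniformly in n, so at a slightly larger radius s the average is still within 1/2
of 1; hence its inverse 1 - s^n y^n is bounded.  The gain s - t does not depend
on t. *)
Lemma geom_bounded_step : exists2 d : R, 0 < d & forall t s, 0 <= t -> t <= s <= T -> s <= t + d ->
  geom_bounded t -> geom_bounded s.
Proof.
have [B' hB'] := resolvent_bounded.
pose B := `|B'| + 1.
have hB mu : cabs mu <= T -> p (G mu) <= B.
  by move=> /hB' h; rewrite /B; have := ler_norm B'; lra.
have B0 : 0 < B by rewrite /B; have := normr_ge0 B'; lra.
pose L := p y * B * B + 1.
have L0 : 0 < L by rewrite /L; have := mulr_ge0 (mulr_ge0 (sn_ge0 y) (ltW B0)) (ltW B0); lra.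
(* With s - r <= 2 d, the root averages at r and s differ by at most 1/4. *)
pose d := (8 * L)^-1.
have d0 : 0 < d by rewrite invr_gt0 mulr_gt0.
have dL : d * L = 1 / 8 by rewrite /d invfM -mulrA mulVf ?lt0r_neq0 // mulr1 div1r.
exists d => // t s t0 /andP[ts sT] sd [M hM].
have [ts'|] := ltP t s; last first.
  move=> st; have -> : s = t by apply/eqP; rewrite eq_le st ts.
  by exists M.
(* r < t unless t = 0, so the powers at radius r tend to 0; s - r <= 2 d. *)
pose r := Num.max 0 (t - d).
have r0 : 0 <= r by rewrite le_max lexx.
have rT : r <= T by rewrite ge_max T0 /=; lra.
have hrs : `|s - r| <= 2 * d.
  rewrite ler_norml; apply/andP; split; last first.
    have : t - d <= r by rewrite le_max lexx orbT.
    lra.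
  have : r <= t by rewrite ge_max t0 /=; lra.
  lra.
have [N hN] : exists N, forall n, (N <= n)%N -> p (y ^+ n) * r ^+ n * B <= 1 / 4.
  have [t00|t00] := eqVneq t 0.
    have -> : r = 0 by rewrite /r t00 sub0r max_l // oppr_le0 ltW.
    by exists 1%N => -[|n] // _; rewrite expr0n /= mulr0 mul0r.
  have tp : 0 < t by rewrite lt_def t00.
  pose q := r / t.
  have q1 : `|q| < 1.
    rewrite ger0_norm ?divr_ge0 // ltr_pdivrMr // mul1r gt_max tp /=; lra.
  have M0 : 0 <= M.
    by apply: le_trans (hM 0%N); rewrite mulr_ge0 ?sn_ge0 ?exprn_ge0.
  have e0 : 0 < 1 / 4 / ((M + 1) * B) by rewrite !divr_gt0 // mulr_gt0 //; lra.
  have /cvgrPdist_lt hq := cvg_expr q1.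
  have [N _ hN] := hq _ e0.
  exists N => n /hN /=; rewrite sub0r normrN ger0_norm ?exprn_ge0 ?divr_ge0 // => h.
  have -> : p (y ^+ n) * r ^+ n * B = (p (y ^+ n) * t ^+ n) * q ^+ n * B.
    have rq : r = q * t by rewrite /q divfK.
    by rewrite [in LHS]rq exprMn; ring.
  have h1 : p (y ^+ n) * t ^+ n <= M + 1 by have := hM n; lra.
  have h2 : q ^+ n * ((M + 1) * B) < 1 / 4.
    by rewrite -ltr_pdivlMr // mulr_gt0 //; lra.
  have h3 : p (y ^+ n) * t ^+ n * (q ^+ n * B) <= (M + 1) * (q ^+ n * B).
    by rewrite ler_wpM2r // mulr_ge0 ?exprn_ge0 ?divr_ge0 // ltW.
  lra.
have key n : (maxn 1 N <= n)%N -> p (y ^+ n) * s ^+ n <= 3 * p 1.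
  rewrite geq_max => /andP[n0 /hN h1].
  have [z hz] := primitive_root_exists R[i] n0.
  have s0 : 0 <= s by lra.
  have rr : 0 <= r <= T by rewrite r0.
  have ss : 0 <= s <= T by rewrite s0.
  have e1 := root_average_inv hz rr.
  have e2 := root_average_inv hz ss.
  set vr := root_average n z r in e1; set vs := root_average n z s in e2.
  have b1 : p vr <= B by exact: root_average_bound hz hB rr.
  have l1 := root_average_lip hz hB ss rr; rewrite -/vr -/vs in l1.
  have l2 : p (vs - vr) <= 1 / 4.
    apply: le_trans l1 _.
    have : `|s - r| * L <= 2 * d * L by rewrite ler_wpM2r // ltW.
    have := normr_ge0 (s - r); rewrite -mulrA dL /L; lra.
  have l3 : p (vr - 1) <= 1 / 4.
    have : eqk (vr - 1) ((r%:C)%C ^+ n *: y ^+ n * vr).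
      apply: eqk_sym; move: (eqk_sym e1); rewrite mulrBl mul1r /eqk => e.
      by rewrite -e; congr p; ring.
    move/eqk_sn ->; apply: le_trans h1; apply: le_trans (sn_M hp _ _) _.
    rewrite (sn_Z hp) cabsX cabs_real ger0_norm // [r ^+ n * _]mulrC.
    by rewrite ler_wpM2l ?mulr_ge0 ?sn_ge0 ?exprn_ge0.
  have l4 : p (1 - vs) <= 1 / 2.
    rewrite sn_distC; have := sn_D hp (vs - vr) (vr - 1).
    by rewrite addrA subrK; lra.
  set u := 1 - _ in e2.
  have hu : p u <= 2 * p 1.
    have : eqk u (1 + u * (1 - vs)).
      have hu2 : u = u * vs + u * (1 - vs) by ring.
      rewrite {1}hu2.
      by apply: eqkD => //; apply: eqk_refl.
    move/eqk_sn => E; have := sn_D hp 1 (u * (1 - vs)); rewrite -E.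
    have := sn_M hp u (1 - vs).
    have : p u * p (1 - vs) <= p u * (1 / 2) by rewrite ler_wpM2l ?sn_ge0.
    lra.
  have : p ((s%:C)%C ^+ n *: y ^+ n) <= p 1 + p u.
    have := snB 1 u; rewrite /u opprB addrCA subrr addr0; lra.
  rewrite (sn_Z hp) cabsX cabs_real ger0_norm // mulrC; lra.
exists (3 * p 1 + \sum_(n < maxn 1 N) p (y ^+ n) * s ^+ n) => n.
have s0 : 0 <= s by lra.
have sum0 (P : pred 'I_(maxn 1 N)) : 0 <= \sum_(n < maxn 1 N | P n) p (y ^+ n) * s ^+ n.
  by apply: sumr_ge0 => i _; rewrite mulr_ge0 ?sn_ge0 ?exprn_ge0.
have [hn|hn] := leqP (maxn 1 N) n.
  by have := key n hn; have := sum0 predT; lra.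
rewrite (bigD1 (Ordinal hn)) //=.
by have := sum0 (fun i => i != Ordinal hn); have := sn_ge0 1; lra.
Qed.

(** If 1 - mu y is invertible for |mu| <= T, then the powers of y grow at most like
T^(-n): start at radius 0 and advance by steps of constant length. *)
Lemma spectral_radius_bound : geom_bounded T.
Proof.
have [d d0 hd] := geom_bounded_step.
have h (m : nat) : geom_bounded (Num.min T (m%:R * d)).
  elim: m => [|m IH].
    rewrite mul0r min_r //; exists (p 1) => -[|n]; first by rewrite !expr0 mulr1.
    by rewrite expr0n mulr0 sn_ge0.
  have e : (m.+1%:R * d = m%:R * d + d) by rewrite -natr1 mulrDl mul1r.
  have md0 : 0 <= m%:R * d by rewrite mulr_ge0 // ltW.
  apply: hd IH; first by rewrite le_min T0.
    rewrite e; apply/andP; split; last by rewrite ge_min lexx.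
    rewrite le_min !ge_min lexx /=; apply/orP; right; lra.
  rewrite e; case: (leP T (m%:R * d)) => h1; case: (leP T (m%:R * d + d)) => h2; lra.
have := h (Num.bound (T / d)).
rewrite min_l //; have := archi_boundP (divr_ge0 T0 (ltW d0)).
by rewrite ltr_pdivrMr // => /ltW.
Qed.

End Resolvent.
End Seminorm.

(** * Gelfand theory *)

Section Gelfand.
Variables (R : realType) (A : comAlgType R[i]) (N : A -> R) (hN : banach_norm N).

Lemma banach_seminorm : alg_seminorm N.
Proof. by case: hN => *; split. Qed.
Let sN := banach_seminorm.

(** The partial sums of the geometric series of 1 - g form a Cauchy sequence. *)
Lemma neumann_inv (g : A) : N (1 - g) < 1 -> exists h, g * h = 1.
Proof.
move=> r1; pose x := 1 - g; pose r := N x.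
have r0 : 0 <= r by exact: (sn_ge0 sN).
pose S k := \sum_(i < k) x ^+ i.
have gS k : g * S k = 1 - x ^+ k.
  by rewrite -[1 - _]opprB subrX1 -mulNr opprB /x opprB addrC subrK.
have NX k : N (x ^+ k) <= r ^+ k.
  case: k => [|k]; first by rewrite !expr0 (banach_norm1 hN).
  exact: (snX sN).
have tail p m : (1 - r) * N (S (p + m)%N - S p) <= r ^+ p - r ^+ (p + m).
  elim: m => [|m IH]; first by rewrite addn0 !subrr (sn0 sN) mulr0.
  have -> : S (p + m.+1)%N - S p = (S (p + m)%N - S p) + x ^+ (p + m).
    by rewrite addnS /S big_ord_recr /= addrAC.
  have h : (1 - r) * N (S (p + m)%N - S p + x ^+ (p + m)) <=
      (1 - r) * (N (S (p + m)%N - S p) + r ^+ (p + m)).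
    rewrite ler_wpM2l //; first by rewrite subr_ge0 ltW.
    by apply: le_trans (sn_D sN _ _) _; rewrite lerD2l.
  rewrite addnS exprSr; lra.
have tail2 p k : (p <= k)%N -> N (S k - S p) <= r ^+ p / (1 - r).
  move=> pk; rewrite ler_pdivlMr ?subr_gt0 //; have := tail p (k - p)%N; rewrite subnKC //.
  by have := exprn_ge0 k r0; lra.
have small e : 0 < e -> exists p, r ^+ p < e.
  move=> e0; have q1 : `|r| < 1 by rewrite ger0_norm.
  have /cvgrPdist_lt/(_ e e0) [p _ hp] := cvg_expr q1.
  by exists p; have := hp p (leqnn p); rewrite /= sub0r normrN ger0_norm ?exprn_ge0.
have [v hv] : exists v, N (S k - v) @[k --> \oo] --> 0.
  apply: (banach_complete hN) => e e0.
  have [p hp] := small (e * (1 - r) / 2) ltac:(rewrite divr_gt0 ?mulr_gt0 ?subr_gt0 //).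
  exists p => k l pk pl.
  have := tail2 p k pk; have := tail2 p l pl; rewrite ![in X in X -> _]ler_pdivlMr ?subr_gt0 //.
  move=> h1 h2; have h3 := snB sN (S k - S p) (S l - S p).
  have -> : S k - S l = S k - S p - (S l - S p) by ring.
  apply: le_lt_trans h3 _.
  have q0 : 0 < 1 - r by rewrite subr_gt0.
  rewrite ler_pdivlMr // in h2.
  by rewrite -(ltr_pM2r q0) mulrDl; lra.
exists v; apply/eqP; rewrite -subr_eq0; apply/eqP/(banach_norm0_eq0 hN)/eqP.
rewrite eq_le (sn_ge0 sN) andbT; apply/ler_addgt0Pl => e e0; rewrite addr0.
have gp : 0 < N g + 1 by have := sn_ge0 sN g; lra.
have [p hp] := small (e / 2) ltac:(lra).
have e1 : 0 < e / 2 / (N g + 1) by rewrite divr_gt0 //; lra.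
move/cvgrPdist_lt/(_ _ e1): hv => [q _ hq].
pose k := maxn p q.
have h1 := hq k (leq_maxr _ _); rewrite /= sub0r normrN ger0_norm ?(sn_ge0 sN) // in h1.
have -> : g * v - 1 = - (g * (S k - v)) - x ^+ k by rewrite mulrBr gS; ring.
have h2 : r ^+ k <= r ^+ p by rewrite ler_wiXn2l ?leq_maxl // ltW.
have h3 := NX k.
have h4 := snB sN (- (g * (S k - v))) (x ^+ k); rewrite (snN sN) in h4.
have h5 := sn_M sN g (S k - v).
have h6 : N g * N (S k - v) <= (N g + 1) * N (S k - v) by rewrite ler_wpM2r ?(sn_ge0 sN) // lerDl.
have h7 : (N g + 1) * N (S k - v) < e / 2 by rewrite mulrC -ltr_pdivlMr.
lra.
Qed.

Definition ideal (J : set A) := [/\ J 0, forall x y, J x -> J y -> J (x + y) &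
  forall x y, J x -> J (y * x)].

(** The empty set is admitted in the family to which Zorn's lemma is applied, so
that the union of an empty chain is not an exception. *)
Lemma maximal_ideal_ex (y : A) : (forall h, y * h != 1) ->
  exists J, [/\ ideal J, J y, ~ J 1 &
    forall x, ~ J x -> exists h, J (x * h - 1)].
Proof.
move=> yn.
pose P (J : set A) := J = set0 \/ [/\ ideal J, J y & ~ J 1].
have [F sF totF|J [PJ Jmax]] := @Zorn_bigcup A P.
  have [[J0 [FJ0 J0n]]|F0] := pselect (exists J0, F J0 /\ J0 != set0); last first.
    left; rewrite -subset0 => x [J FJ Jx]; apply: F0; exists J; split => //.
    by apply/set0P; exists x.
  have good J : F J -> J != set0 -> [/\ ideal J, J y & ~ J 1].
    by move=> FJ Jn; case: (sF _ FJ) => // J00; rewrite J00 eqxx in Jn.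
  have good' J x : F J -> J x -> [/\ ideal J, J y & ~ J 1].
    by move=> FJ Jx; apply: good => //; apply/set0P; exists x.
  right; split; last by move=> [J FJ J1]; have [_ _] := good' _ _ FJ J1; apply.
    split.
    - by exists J0 => //; have [[]] := good _ FJ0 J0n.
    - move=> x z [J1 F1 x1] [J2 F2 x2].
      have [[_ D1 _] _ _] := good' _ _ F1 x1; have [[_ D2 _] _ _] := good' _ _ F2 x2.
      have [s|s] := totF _ _ F1 F2; [exists J2 | exists J1] => //.
        by apply: D2 => //; apply: s.
      by apply: D1 => //; apply: s.
    - move=> x z [J1 F1 x1]; have [[_ _ M1] _ _] := good' _ _ F1 x1.
      by exists J1 => //; apply: M1.
  by exists J0 => //; have [] := good _ FJ0 J0n.
have Pgen (I : set A) x : ideal I -> (I y \/ x = y) -> ~ (exists2 g, I g & exists h, g + x * h = 1) ->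
   P [set z | exists2 g, I g & exists h, z = g + x * h].
  move=> [I0 ID IM] Iy I1; right; split.
  - split.
    + by exists 0 => //; exists 0; rewrite mulr0 addr0.
    + move=> a b [g Ig [h ->]] [g' Ig' [h' ->]]; exists (g + g'); first exact: ID.
      by exists (h + h'); ring.
    + move=> a b [g Ig [h ->]]; exists (b * g); first exact: IM.
      by exists (b * h); ring.
  - case: Iy => [Iy|->]; first by exists y => //; exists 0; rewrite mulr0 addr0.
    by exists 0 => //; exists 1; rewrite mulr1 add0r.
  - by move=> [g Ig [h e]]; apply: I1; exists g => //; exists h.
have id0 : ideal [set 0 : A].
  by split => [//|x z /= -> ->|x z /= ->]; rewrite ?addr0 ?mulr0.
case: PJ => [J0|[idJ Jy J1]].
  exfalso; apply: (Jmax _ _ (Pgen [set 0] y id0 (or_intror erefl) _)).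
    rewrite J0; split => // s; apply: (s y); exists 0 => //.
    by exists 1; rewrite mulr1 add0r.
  move=> [g /= -> [h /eqP]]; rewrite add0r; exact/negP.
exists J; split => // x Jx.
have [[g Jg [h e]]|nex] := pselect (exists2 g, J g & exists h, g + x * h = 1).
  exists h; case: idJ => _ _ JM; rewrite -e opprD addrCA subrr addr0 -mulN1r; exact: JM.
exfalso; apply: (Jmax _ _ (Pgen J x idJ (or_introl Jy) nex)); split.
  by move=> z Jz; exists z => //; exists 0; rewrite mulr0 addr0.
move=> s; apply: Jx; apply: s; exists 0; first by case: idJ.
by exists 1; rewrite mulr1 add0r.
Qed.

Section Quotient.
Variables (J : set A) (idJ : ideal J).

Definition qnorm x := inf [set N (x - g) | g in J].

Let lbq x : has_lbound [set N (x - g) | g in J].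
Proof. by exists 0 => _ [g _ <-]; apply: sn_ge0 sN _. Qed.

Lemma qnorm_le x g : J g -> qnorm x <= N (x - g).
Proof. by move=> Jg; apply: ge_inf => //; exists g. Qed.

Lemma qnorm_geM x c d : 0 <= d -> (forall g, J g -> c <= N (x - g) * d) -> c <= qnorm x * d.
Proof.
move=> d0 h; case: idJ => J0 _ _; have [d00|dn] := eqVneq d 0.
  by have := h 0 J0; rewrite d00 !mulr0.
have dp : 0 < d by rewrite lt_def dn.
rewrite -ler_pdivrMr //; apply: lb_le_inf; first by exists (N (x - 0)), 0.
by move=> _ [g Jg <-]; rewrite ler_pdivrMr // h.
Qed.

Lemma qnorm_ge x c : (forall g, J g -> c <= N (x - g)) -> c <= qnorm x.
Proof.
by move=> h; rewrite -[qnorm x]mulr1; apply: qnorm_geM => // g Jg; rewrite mulr1 h.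
Qed.

Lemma qnorm_ge0 x : 0 <= qnorm x.
Proof. by apply: qnorm_ge => g _; apply: sn_ge0 sN _. Qed.

Lemma qnorm0 x : J x -> qnorm x = 0.
Proof.
move=> Jx; apply/eqP; rewrite eq_le qnorm_ge0 andbT.
by have := qnorm_le x Jx; rewrite subrr (sn0 sN).
Qed.

Lemma qnorm_seminorm : alg_seminorm qnorm.
Proof.
case: (idJ) => J0 JD JM.
have JZ c x : J x -> J (c *: x) by move=> /(JM _ (c%:A)); rewrite mulr_algl.
have leZ c x : qnorm (c *: x) <= cabs c * qnorm x.
  rewrite mulrC; apply: qnorm_geM; first exact: cabs_ge0.
  move=> g Jg; rewrite mulrC -(sn_Z sN) scalerBr; apply: qnorm_le; exact: JZ.
split.
- move=> x y.
  have h g g' : J g -> J g' -> qnorm (x + y) <= N (x - g) + N (y - g').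
    move=> Jg Jg'; apply: le_trans (sn_D sN _ _).
    have -> : x - g + (y - g') = x + y - (g + g') by ring.
    by apply: qnorm_le; apply: JD.
  suff : qnorm (x + y) - qnorm y <= qnorm x by lra.
  apply: qnorm_ge => g Jg; suff : qnorm (x + y) - N (x - g) <= qnorm y by lra.
  by apply: qnorm_ge => g' Jg'; have := h g g' Jg Jg'; lra.
- move=> c x; apply/eqP; rewrite eq_le leZ /=.
  have [->|c0] := eqVneq c 0; first by rewrite cabs0 mul0r qnorm_ge0.
  have := leZ c^-1 (c *: x); rewrite scalerA mulVf // scale1r cabsV.
  by rewrite ler_pdivlMl // cabs_gt0.
- move=> x y; apply: qnorm_geM; first exact: qnorm_ge0.
  move=> g Jg; rewrite [leRHS]mulrC; apply: qnorm_geM; first exact: sn_ge0 sN _.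
  move=> h Jh; rewrite [leRHS]mulrC; apply: le_trans (sn_M sN _ _).
  have -> : (x - g) * (y - h) = x * y - (y * g + (x * h + (- g) * h)) by ring.
  by apply: qnorm_le; apply: (JD); [exact: JM | apply: (JD); exact: JM].
Qed.

(** An element of a proper ideal is not invertible, so it has distance at least 1
from 1. *)
Lemma qnorm1 : ~ J 1 -> 1 <= qnorm 1.
Proof.
move=> J1; apply: qnorm_ge => g Jg; rewrite leNgt; apply/negP => /neumann_inv[h gh].
by apply: J1; rewrite -gh mulrC; case: idJ => _ _; apply.
Qed.

(** Suppose that no x - c lies in J.  Then 1 - mu x is invertible modulo J for all
mu, and so is 1 - mu h for the inverse h of x modulo J.  By the spectral radius
estimate the powers of x and of h are both O(2^(-n)), which contradicts
x^n h^n = 1 modulo J. *)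
Lemma gelfand_mazur : ~ J 1 -> (forall x, ~ J x -> exists h, J (x * h - 1)) ->
  forall x, exists c : R[i], J (x - c%:A).
Proof.
move=> J1 Jinv x; apply: contrapT => nex; case: (idJ) => J0 JD JM.
have [h hh] : {h : R[i] -> A & forall c, J ((x - c%:A) * h c - 1)}.
  apply: (@choice _ _ (fun c h => J ((x - c%:A) * h - 1))) => c.
  by apply: Jinv => Jx; apply: nex; exists c.
have sQ := qnorm_seminorm.
have eqJ a b : J (a - b) -> eqk qnorm a b by move=> /qnorm0.
have h0 : J (x * h 0 - 1) by have := hh 0; rewrite scale0r subr0.
(* For mu != 0, 1 - mu x = - mu (x - 1 / mu). *)
have [M1 b1] : geom_bounded qnorm x 2.
  apply: (@spectral_radius_bound _ _ _ sQ x 2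
    (fun mu => if mu == 0 then 1 else (- mu^-1) *: h mu^-1)) => // mu _.
  have [->|mu0] := eqVneq mu 0; first by rewrite scale0r subr0 mulr1; exact: eqk_refl.
  apply: eqJ; have -> : 1 - mu *: x = (- mu) *: (x - mu^-1%:A).
    by rewrite scalerBr scalerA mulNr mulfV // !scaleNr scale1r opprK addrC.
  by rewrite -scalerAl -scalerAr scalerA mulrNN mulfV // scale1r; exact: hh.
(* 1 - mu h0 = h0 (x - mu) modulo J. *)
have [M2 b2] : geom_bounded qnorm (h 0) 2.
  apply: (@spectral_radius_bound _ _ _ sQ (h 0) 2 (fun mu => x * h mu)) => // mu _.
  apply: eqJ.
  have -> : (1 - mu *: h 0) * (x * h mu) - 1 = (- mu *: h mu) * (x * h 0 - 1) + ((x - mu%:A) * h mu - 1).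
    by rewrite -(mulr_algl mu (h 0)) -(mulr_algl (- mu) (h mu)) scaleNr; ring.
  by apply: (JD); [apply: (JM); exact: h0 | exact: hh].
have q1 := qnorm1 J1.
have bnd n : 4 ^+ n <= M1 * M2.
  have e : qnorm 1 = qnorm (x ^+ n * h 0 ^+ n).
    have : eqk qnorm (x ^+ n * h 0 ^+ n) 1.
      rewrite -exprMn; elim: n => [|n IH]; first exact: eqk_refl.
      by rewrite exprS -[1]mulr1; apply: eqkM => //; apply: eqJ.
    by move=> /(eqk_sn sQ) ->.
  have h1 := sn_M sQ (x ^+ n) (h 0 ^+ n); rewrite -e in h1.
  have h2 : 1 <= qnorm (x ^+ n) * qnorm (h 0 ^+ n) by lra.
  have -> : (4 : R) = 2 * 2 by ring.
  rewrite exprMn; have h3 := b1 n; have h4 := b2 n.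
  have p0 : 0 <= 2 ^+ n * 2 ^+ n :> R by rewrite mulr_ge0.
  apply: le_trans (_ : qnorm (x ^+ n) * 2 ^+ n * (qnorm (h 0 ^+ n) * 2 ^+ n) <= _).
    by have := ler_wpM2r p0 h2; lra.
  by apply: ler_pM; rewrite ?mulr_ge0 ?qnorm_ge0.
have M0 : 0 <= M1 * M2 by have := bnd 0%N; rewrite expr0; lra.
have := archi_boundP M0; have := bnd (Num.bound (M1 * M2)).
move: (Num.bound _) => n h1 h2.
have h3 : n%:R <= 4 ^+ n :> R.
  by rewrite -natrX ler_nat; apply/ltnW/ltn_expl.
lra.
Qed.

End Quotient.

Definition character (phi : {linear A -> R[i]^o}) :=
  (forall y z : A, phi (y * z) = phi y * phi z) /\ exists y : A, phi y != 0.

Lemma character1 phi : character phi -> phi 1 = 1.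
Proof.
move=> [M [y y0]]; apply: (mulfI y0); by rewrite -M !mulr1.
Qed.

(** Otherwise 1 - x / phi x would be invertible, although phi maps it to 0. *)
Lemma character_le phi x : character phi -> cabs (phi x) <= N x.
Proof.
move=> hphi; rewrite leNgt; apply/negP => h.
have p0 : phi x != 0 by rewrite -cabs_gt0; apply: le_lt_trans h; apply: sn_ge0 sN _.
have [|g hg] := @neumann_inv (1 - (phi x)^-1 *: x).
  rewrite opprB addrC subrK (sn_Z sN) cabsV ltr_pdivrMl ?mulr1 // cabs_gt0 //.
have := congr1 phi hg; rewrite (character1 hphi) hphi.1 linearB linearZ /=.
rewrite (character1 hphi) [_ *: _](_ : _ = (phi x)^-1 * phi x) // mulVf // subrr mul0r.
by move/esym/eqP; rewrite oner_eq0.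
Qed.

(** Modulo a maximal ideal containing y, every element is a scalar. *)
Lemma character_ex (y : A) : (forall h, y * h != 1) ->
  exists2 phi, character phi & phi y = 0.
Proof.
move=> yn; have [J [idJ Jy J1 Jinv]] := maximal_ideal_ex yn.
have [phi hphi] := choice (gelfand_mazur idJ J1 Jinv).
case: (idJ) => J0 JD JM.
have JN x : J x -> J (- x) by move=> /(JM _ (-1)); rewrite mulN1r.
have JZ c x : J x -> J (c *: x) by move=> /(JM _ (c%:A)); rewrite mulr_algl.
have uniq x c : J (x - c%:A) -> phi x = c.
  move=> Jc; apply/eqP; rewrite -subr_eq0; apply/negP => /negP n0; apply: J1.
  have := JZ (phi x - c)^-1 _ (JD _ _ Jc (JN _ (hphi x))).
  have -> : x - c%:A - (x - (phi x)%:A) = (phi x - c)%:A by rewrite scalerBl; ring.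
  by rewrite scalerA mulVf // scale1r.
have lin : linear (phi : A -> R[i]^o).
  move=> c x z; apply: uniq; have := JD _ _ (JZ c _ (hphi x)) (hphi z).
  have -> : ((c *: (phi x : R[i]^o) + phi z) : R[i])%:A = (c * phi x)%:A + (phi z)%:A :> A.
    by rewrite -scalerDl.
  by congr J; rewrite scalerBr scalerA opprD addrACA.
pose phiL : {linear A -> R[i]^o} := HB.pack phi (GRing.isLinear.Build _ _ _ _ phi lin).
exists phiL; last by apply: uniq; rewrite scale0r subr0.
split.
  move=> x z; change (phi (x * z) = phi x * phi z); apply: uniq.
  have -> : (phi x * phi z)%:A = (phi x)%:A * (phi z)%:A :> A by rewrite mulr_algl scalerA.
  have := JD _ _ (JM _ z (hphi x)) (JM _ ((phi x)%:A) (hphi z)).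
  move: (phi x)%:A (phi z)%:A => a b.
  by have -> : z * (x - a) + a * (z - b) = x * z - a * b by ring.
exists 1; rewrite /= (uniq 1 1) ?oner_neq0 // scale1r subrr //.
Qed.

Lemma invertible_char (y : A) : (forall phi, character phi -> phi y != 0) -> exists h, y * h = 1.
Proof.
move=> h; apply: contrapT => nex.
have [|phi hphi /eqP] := @character_ex y; last by apply/negP; apply: h.
by move=> g; apply/eqP => e; apply: nex; exists g.
Qed.

(** Half of the spectral radius formula: 1 - mu y is invertible for |mu| <= 1 / rho,
as no character vanishes on it. *)
Lemma character_power_bound (y : A) (rho : R) : 0 < rho ->
  (forall phi, character phi -> cabs (phi y) < rho) ->
  exists M, forall n, N (y ^+ n) <= M * rho ^+ n.
Proof.
move=> r0 hrho.
have inv (mu : R[i]) : cabs mu <= rho^-1 -> exists h, (1 - mu *: y) * h = 1.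
  move=> hmu; apply: invertible_char => phi hphi.
  rewrite linearB linearZ /= (character1 hphi) subr_eq0; apply/eqP => e.
  have : cabs (mu * phi y) = 1 by rewrite -[mu * _]e cabs1.
  rewrite cabsM; have := hrho phi hphi; have := cabs_ge0 mu => h1 h2 h3.
  have : cabs mu * cabs (phi y) <= rho^-1 * cabs (phi y) by rewrite ler_wpM2r ?cabs_ge0.
  rewrite h3 ler_pdivlMl // mulr1; lra.
have [G hG] : {G : R[i] -> A & forall mu, cabs mu <= rho^-1 -> (1 - mu *: y) * G mu = 1}.
  apply: (@choice _ _ (fun mu h => cabs mu <= rho^-1 -> (1 - mu *: y) * h = 1)) => mu.
  have [hm|hm] := pselect (cabs mu <= rho^-1); last by exists 0.
  by have [h hh] := inv mu hm; exists h.
have [||M hM] := @spectral_radius_bound _ _ _ sN y rho^-1 G.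
- by rewrite invr_ge0 ltW.
- by move=> mu /hG ->; apply: eqk_refl sN _.
exists M => n; have := hM n; by rewrite exprVn ler_pdivrMr // exprn_gt0.
Qed.

End Gelfand.

(** * Completion of a seminormed algebra *)

Record unital_seminorm (R : realType) (L : comAlgType R[i]) := UnitalSeminorm {
  us_fun :> L -> R;
  us_seminorm : alg_seminorm us_fun;
  us_1 : us_fun 1 = 1 }.

Section Completion.
Variables (R : realType) (L : comAlgType R[i]) (p : unital_seminorm L).
Let hp := us_seminorm p.
Implicit Types u v : nat -> L.

Definition cauchy u := forall e, 0 < e -> exists K, forall k l,
  (K <= k)%N -> (K <= l)%N -> p (u k - u l) < e.

(** Sequences with the same limit in the completion. *)
Definition cofinal u v := forall e, 0 < e -> exists K, forall k,
  (K <= k)%N -> p (u k - v k) < e.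

Lemma cofinal_refl u : cofinal u u.
Proof. by move=> e e0; exists 0%N => k _; rewrite subrr (sn0 hp). Qed.

Lemma cofinal_sym u v : cofinal u v -> cofinal v u.
Proof. by move=> h e /h[K hK]; exists K => k /hK; rewrite (sn_distC hp). Qed.

Lemma cofinal_trans v u w : cofinal u v -> cofinal v w -> cofinal u w.
Proof.
move=> h1 h2 e e0; have e2 : 0 < e / 2 by lra.
have [K1 hK1] := h1 _ e2; have [K2 hK2] := h2 _ e2.
exists (maxn K1 K2) => k; rewrite geq_max => /andP[/hK1 a1 /hK2 a2].
by have := sn_D hp (u k - v k) (v k - w k); rewrite addrA subrK; lra.
Qed.

Lemma cauchy_cst x : cauchy (fun=> x).
Proof. by move=> e e0; exists 0%N => k l _ _; rewrite subrr (sn0 hp). Qed.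

Lemma cauchy_cofinal u v : cofinal u v -> cauchy u -> cauchy v.
Proof.
move=> h1 h2 e e0; have e3 : 0 < e / 3 by lra.
have [K1 hK1] := h1 _ e3; have [K2 hK2] := h2 _ e3.
exists (maxn K1 K2) => k l; rewrite !geq_max => /andP[/hK1 a1 b1] /andP[/hK1 a2 b2].
have b := hK2 _ _ b1 b2.
have -> : v k - v l = (u k - u l) - ((u k - v k) - (u l - v l)) by ring.
have := snB hp (u k - u l) ((u k - v k) - (u l - v l)).
have := snB hp (u k - v k) (u l - v l); lra.
Qed.

Lemma cauchy_bounded u : cauchy u -> exists2 M, 0 < M & exists K, forall k, (K <= k)%N -> p (u k) <= M.
Proof.
move=> /(_ _ ltr01)[K hK]; exists (p (u K) + 1); first by have := sn_ge0 hp (u K); lra.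
exists K => k kK; have := hK k K kK (leqnn _).
by have := sn_D hp (u K) (u k - u K); rewrite addrC subrK; lra.
Qed.

Lemma cauchyD u v : cauchy u -> cauchy v -> cauchy (fun k => u k + v k).
Proof.
move=> h1 h2 e e0; have e2 : 0 < e / 2 by lra.
have [K1 hK1] := h1 _ e2; have [K2 hK2] := h2 _ e2.
exists (maxn K1 K2) => k l; rewrite !geq_max => /andP[a1 b1] /andP[a2 b2].
have := hK1 _ _ a1 a2; have := hK2 _ _ b1 b2.
have := sn_D hp (u k - u l) (v k - v l); rewrite addrACA opprD; lra.
Qed.

Lemma cofinalD u u' v v' : cofinal u u' -> cofinal v v' ->
  cofinal (fun k => u k + v k) (fun k => u' k + v' k).
Proof.
move=> h1 h2 e e0; have e2 : 0 < e / 2 by lra.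
have [K1 hK1] := h1 _ e2; have [K2 hK2] := h2 _ e2.
exists (maxn K1 K2) => k; rewrite !geq_max => /andP[/hK1 a1 /hK2 b1].
have := sn_D hp (u k - u' k) (v k - v' k); rewrite addrACA opprD; lra.
Qed.

Lemma cauchyZ c u : cauchy u -> cauchy (fun k => c *: u k).
Proof.
move=> h e e0; have c0 : 0 < cabs c + 1 by have := cabs_ge0 c; lra.
have [K hK] := h _ (divr_gt0 e0 c0).
exists K => k l a b; rewrite -scalerBr (sn_Z hp).
have := hK k l a b; rewrite ltr_pdivlMr //.
have := sn_ge0 hp (u k - u l); have := cabs_ge0 c; lra.
Qed.

Lemma cofinalZ c u v : cofinal u v -> cofinal (fun k => c *: u k) (fun k => c *: v k).
Proof.
move=> h e e0; have c0 : 0 < cabs c + 1 by have := cabs_ge0 c; lra.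
have [K hK] := h _ (divr_gt0 e0 c0).
exists K => k a; rewrite -scalerBr (sn_Z hp).
have := hK k a; rewrite ltr_pdivlMr //.
have := sn_ge0 hp (u k - v k); have := cabs_ge0 c; lra.
Qed.

Lemma cauchyM u v : cauchy u -> cauchy v -> cauchy (fun k => u k * v k).
Proof.
move=> h1 h2 e e0.
have [M1 M10 [K1 hK1]] := cauchy_bounded h1; have [M2 M20 [K2 hK2]] := cauchy_bounded h2.
have e1 : 0 < e / 2 / M2 by rewrite !divr_gt0.
have e2 : 0 < e / 2 / M1 by rewrite !divr_gt0.
have [K3 hK3] := h1 _ e1; have [K4 hK4] := h2 _ e2.
exists (maxn (maxn K1 K2) (maxn K3 K4)) => k l; rewrite !geq_max.
move=> /andP[/andP[a1 a2] /andP[a3 a4]] /andP[/andP[b1 b2] /andP[b3 b4]].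
have -> : u k * v k - u l * v l = (u k - u l) * v k + (v k - v l) * u l by ring.
apply: le_lt_trans (sn_D hp _ _) _; rewrite [ltRHS]splitr; apply: ltr_leD.
  apply: le_lt_trans (sn_M hp _ _) _.
  have := hK3 _ _ a3 b3; rewrite ltr_pdivlMr //; apply: le_lt_trans.
  by rewrite ler_wpM2l ?(sn_ge0 hp) // hK2.
apply: le_trans (sn_M hp _ _) _.
have := hK4 _ _ a4 b4; rewrite ltr_pdivlMr // => /ltW; apply: le_trans.
by rewrite ler_wpM2l ?(sn_ge0 hp) // hK1.
Qed.

Lemma cofinalMl w u v : cauchy w -> cofinal u v -> cofinal (fun k => w k * u k) (fun k => w k * v k).
Proof.
move=> h1 h2 e e0; have [M M0 [K hK]] := cauchy_bounded h1.
have [K' hK'] := h2 _ (divr_gt0 e0 M0).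
exists (maxn K K') => k; rewrite geq_max => /andP[/hK a /hK' b].
rewrite -mulrBr; apply: le_lt_trans (sn_M hp _ _) _.
move: b; rewrite ltr_pdivlMr // mulrC; apply: le_lt_trans.
by rewrite ler_wpM2r ?(sn_ge0 hp).
Qed.

Lemma cofinalM u u' v v' : cauchy u -> cauchy v' -> cofinal u u' -> cofinal v v' ->
  cofinal (fun k => u k * v k) (fun k => u' k * v' k).
Proof.
move=> cu cv h1 h2; apply: (@cofinal_trans (fun k => u k * v' k)).
  exact: cofinalMl.
have -> : (fun k => u k * v' k) = (fun k => v' k * u k) by apply/funext => k; rewrite mulrC.
have -> : (fun k => u' k * v' k) = (fun k => v' k * u' k) by apply/funext => k; rewrite mulrC.
exact: cofinalMl.
Qed.

(** A canonical member of the class of u: it is chosen from the class as a set, so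
it depends on nothing else. *)
Definition representative u := xget (fun=> 0) [set v | cofinal u v].

Lemma representativeP u : cofinal u (representative u).
Proof. by rewrite /representative; case: xgetP => // /(_ u)/(_ (cofinal_refl u)). Qed.

Lemma representative_eq u v : cofinal u v -> representative u = representative v.
Proof.
move=> h; rewrite /representative.
have <- : [set w | cofinal u w] = [set w | cofinal v w].
  apply/seteqP; split => w /= hw; first exact: cofinal_trans (cofinal_sym h) hw.
  exact: cofinal_trans h hw.
by [].
Qed.

(** Cauchy sequences modulo null sequences, each class being given by its
representative; no quotient type is formed. *)
Definition completion : Type := {u | cauchy u /\ representative u = u}.

HB.instance Definition _ := gen_eqMixin completion.
HB.instance Definition _ := gen_choiceMixin completion.

Lemma representative_idem u : cauchy u ->
  cauchy (representative u) /\ representative (representative u) = representative u.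
Proof.
move=> cu; split; first exact: cauchy_cofinal (representativeP u) cu.
by apply/esym/representative_eq/representativeP.
Qed.

(** Total, with the class of 0 as value at sequences that are not Cauchy. *)
Definition cls u : completion :=
  match pselect (cauchy u) with
  | left cu => exist _ (representative u) (representative_idem cu)
  | right _ => exist _ _ (representative_idem (cauchy_cst 0))
  end.

Lemma cls_eq u v : cauchy u -> cofinal u v -> cls u = cls v.
Proof.
move=> cu uv; have cv := cauchy_cofinal uv cu; rewrite /cls.
case: pselect => // cu'; case: pselect => // cv'.
by apply: eq_exist => /=; exact: representative_eq.
Qed.

Lemma sval_cls u : cauchy u -> cofinal u (sval (cls u)).
Proof. by move=> cu; rewrite /cls; case: pselect => // cu' /=; exact: representativeP. Qed.

Lemma cls_ex (x : completion) : exists2 u, cauchy u & x = cls u.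
Proof.
case: x => u [cu ru]; exists u => //; rewrite /cls; case: pselect => // cu'.
by apply: eq_exist.
Qed.

Lemma cauchy_sval (x : completion) : cauchy (sval x).
Proof. by case: x => u []. Qed.

Definition cadd (x y : completion) := cls (fun k => sval x k + sval y k).
Definition cmul (x y : completion) := cls (fun k => sval x k * sval y k).
Definition cscale (c : R[i]) (x : completion) := cls (fun k => c *: sval x k).

Lemma cls_add u v : cauchy u -> cauchy v -> cadd (cls u) (cls v) = cls (fun k => u k + v k).
Proof.
move=> cu cv; apply/esym/cls_eq; first exact: cauchyD.
by apply: cofinalD; apply: sval_cls.
Qed.

Lemma cls_mul u v : cauchy u -> cauchy v -> cmul (cls u) (cls v) = cls (fun k => u k * v k).
Proof.
move=> cu cv; apply/esym/cls_eq; first exact: cauchyM.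
by apply: cofinalM => //; [exact: cauchy_sval|exact: sval_cls|exact: sval_cls].
Qed.

Lemma cls_scale c u : cauchy u -> cscale c (cls u) = cls (fun k => c *: u k).
Proof.
move=> cu; apply/esym/cls_eq; first exact: cauchyZ.
by apply: cofinalZ; apply: sval_cls.
Qed.

Let ccst := cauchy_cst.

Ltac cauchy_tac :=
  solve [repeat first [assumption | apply: cauchyD | apply: cauchyM | apply: cauchyZ
                      | apply: cauchy_cst]].
Ltac cls_tac := rewrite ?(cls_add, cls_mul, cls_scale); try cauchy_tac; congr cls; apply/funext => k.

Fact caddA : associative cadd.
Proof.
move=> x y z; have [u cu ->] := cls_ex x; have [v cv ->] := cls_ex y; have [w cw ->] := cls_ex z.
by cls_tac; rewrite addrA.
Qed.
Fact caddC : commutative cadd.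
Proof. by move=> x y; congr cls; apply/funext => k; rewrite addrC. Qed.
Fact cadd0 : left_id (cls (fun=> 0)) cadd.
Proof.
move=> x; have [u cu ->] := cls_ex x; by cls_tac; rewrite add0r.
Qed.
Fact caddN : left_inverse (cls (fun=> 0)) (cscale (-1)) cadd.
Proof.
move=> x; have [u cu ->] := cls_ex x; by cls_tac; rewrite scaleN1r addNr.
Qed.
HB.instance Definition _ := GRing.isZmodule.Build completion caddA caddC cadd0 caddN.

Fact cmulA : associative cmul.
Proof.
move=> x y z; have [u cu ->] := cls_ex x; have [v cv ->] := cls_ex y; have [w cw ->] := cls_ex z.
by cls_tac; rewrite mulrA.
Qed.
Fact cmulC : commutative cmul.
Proof. by move=> x y; congr cls; apply/funext => k; rewrite mulrC. Qed.
Fact cmul1 : left_id (cls (fun=> 1)) cmul.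
Proof.
move=> x; have [u cu ->] := cls_ex x; by cls_tac; rewrite mul1r.
Qed.
Fact cmulDl : left_distributive cmul cadd.
Proof.
move=> x y z; have [u cu ->] := cls_ex x; have [v cv ->] := cls_ex y; have [w cw ->] := cls_ex z.
by cls_tac; rewrite mulrDl.
Qed.
Fact c1_neq0 : cls (fun=> 1) != cls (fun=> 0).
Proof.
apply/eqP => e.
have h : cofinal (fun=> 1) (fun=> 0).
  apply: cofinal_trans (sval_cls (ccst 1)) _; rewrite e.
  exact: cofinal_sym (sval_cls (ccst 0)).
by have [K /(_ K (leqnn _))] := h _ ltr01; rewrite subr0 (us_1 p) ltxx.
Qed.
HB.instance Definition _ :=
  GRing.Zmodule_isComNzRing.Build completion cmulA cmulC cmul1 cmulDl c1_neq0.

Fact cscaleA a b x : cscale a (cscale b x) = cscale (a * b) x.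
Proof.
have [u cu ->] := cls_ex x; by cls_tac; rewrite scalerA.
Qed.
Fact cscale1 : left_id 1 cscale.
Proof.
move=> x; have [u cu ->] := cls_ex x; by cls_tac; rewrite scale1r.
Qed.
Fact cscaleDr : right_distributive cscale +%R.
Proof.
move=> a x y; have [u cu ->] := cls_ex x; have [v cv ->] := cls_ex y.
change (cscale a (cadd (cls u) (cls v)) = cadd (cscale a (cls u)) (cscale a (cls v))).
by cls_tac; rewrite scalerDr.
Qed.
Fact cscaleDl x : {morph cscale^~ x : a b / a + b}.
Proof.
move=> a b; have [u cu ->] := cls_ex x.
change (cscale (a + b) (cls u) = cadd (cscale a (cls u)) (cscale b (cls u))).
by cls_tac; rewrite scalerDl.
Qed.
HB.instance Definition _ :=
  GRing.Zmodule_isLmodule.Build R[i] completion cscaleA cscale1 cscaleDr cscaleDl.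
Fact cscaleAl (a : R[i]) (x y : completion) : a *: (x * y) = (a *: x) * y.
Proof.
have [u cu ->] := cls_ex x; have [v cv ->] := cls_ex y.
change (cscale a (cmul (cls u) (cls v)) = cmul (cscale a (cls u)) (cls v)).
by cls_tac; rewrite scalerAl.
Qed.
HB.instance Definition _ := GRing.Lmodule_isLalgebra.Build R[i] completion cscaleAl.
HB.instance Definition _ := GRing.Lalgebra_isComAlgebra.Build R[i] completion.

Lemma cauchy_norm_cvg u : cauchy u -> cvgn (fun k => p (u k)).
Proof.
move=> cu; apply/cauchy_cvgP/cauchy_exP => e e0.
have [K hK] := cu e e0; exists (p (u K)); exists K => // k /= kK.
have h := hK _ _ (leqnn K) kK.
have h1 := sn_D hp (u k) (u K - u k); rewrite addrC subrK in h1.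
have h2 := sn_D hp (u K) (u k - u K); rewrite addrC subrK (sn_distC hp (u k)) in h2.
by rewrite /ball /= ltr_norml; lra.
Qed.

Definition cnorm (x : completion) : R := limn (fun k => p (sval x k)).

Lemma cofinal_norm u v (l : R) : cofinal u v ->
  p (u k) @[k --> \oo] --> l -> p (v k) @[k --> \oo] --> l.
Proof.
move=> uv /cvgrPdist_lt h; apply/cvgrPdist_lt => e e0; have e2 : 0 < e / 2 by lra.
have [K hK] := uv _ e2; have [K' _ hK'] := h _ e2.
exists (maxn K K') => // k /=; rewrite geq_max => /andP[/hK a /hK' /= b].
have h1 := sn_D hp (u k) (v k - u k); rewrite addrC subrK (sn_distC hp (v k)) in h1.
have h2 := sn_D hp (v k) (u k - v k); rewrite addrC subrK in h2.
by move: b; rewrite !ltr_norml => /andP[b1 b2]; lra.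
Qed.

Lemma cvg_cnorm u : cauchy u -> p (u k) @[k --> \oo] --> cnorm (cls u).
Proof.
move=> cu; apply: (@cofinal_norm (sval (cls u))).
  exact: cofinal_sym (sval_cls cu).
exact/cauchy_norm_cvg/cauchy_sval.
Qed.

Lemma cnorm_eq u l : cauchy u -> p (u k) @[k --> \oo] --> l -> cnorm (cls u) = l.
Proof. by move=> cu; apply: cvg_unique => //; exact: cvg_cnorm. Qed.

Lemma clsD u v : cauchy u -> cauchy v -> cls u + cls v = cls (fun k => u k + v k).
Proof. exact: cls_add. Qed.
Lemma clsM u v : cauchy u -> cauchy v -> cls u * cls v = cls (fun k => u k * v k).
Proof. exact: cls_mul. Qed.
Lemma clsZ c u : cauchy u -> c *: cls u = cls (fun k => c *: u k).
Proof. exact: cls_scale. Qed.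
Lemma clsB u v : cauchy u -> cauchy v -> cls u - cls v = cls (fun k => u k - v k).
Proof.
move=> cu cv; rewrite -scaleN1r clsZ // clsD //; last exact: cauchyZ.
by congr cls; apply/funext => k; rewrite scaleN1r.
Qed.

Lemma cnorm_le u c : cauchy u -> (exists K, forall k, (K <= k)%N -> p (u k) <= c) ->
  cnorm (cls u) <= c.
Proof.
move=> cu [K hK]; have cv := cvg_cnorm cu.
rewrite -(cvg_lim (@norm_hausdorff _ _) cv); apply: limr_le; first by apply: cvgP cv.
by exists K.
Qed.

Lemma cauchyB u v : cauchy u -> cauchy v -> cauchy (fun k => u k - v k).
Proof.
move=> cu cv; have -> : (fun k => u k - v k) = (fun k => u k + (-1) *: v k).
  by apply/funext => k; rewrite scaleN1r.
by apply: cauchyD => //; apply: cauchyZ.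
Qed.

Lemma cnorm_seminorm : alg_seminorm cnorm.
Proof.
split.
- move=> x y; have [u cu ->] := cls_ex x; have [v cv ->] := cls_ex y; rewrite clsD //.
  apply: (ler_cvg_to (cvg_cnorm (cauchyD cu cv)) (cvgD (cvg_cnorm cu) (cvg_cnorm cv))).
  by apply: nearW => k; apply: sn_D hp _ _.
- move=> c x; have [u cu ->] := cls_ex x; rewrite clsZ //.
  apply: cnorm_eq; first exact: cauchyZ.
  have -> : (fun k => p (c *: u k)) = (fun k => cabs c * p (u k)).
    by apply/funext => k; rewrite (sn_Z hp).
  by apply: cvgM; [exact: cvg_cst | exact: cvg_cnorm].
- move=> x y; have [u cu ->] := cls_ex x; have [v cv ->] := cls_ex y; rewrite clsM //.
  apply: (ler_cvg_to (cvg_cnorm (cauchyM cu cv)) (cvgM (cvg_cnorm cu) (cvg_cnorm cv))).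
  by apply: nearW => k; apply: sn_M hp _ _.
Qed.

Definition embed (x : L) : completion := cls (fun=> x).

Lemma cnorm_embed x : cnorm (embed x) = p x.
Proof. by apply: cnorm_eq; [exact: cauchy_cst | exact: cvg_cst]. Qed.

Lemma embed_cvg u : cauchy u -> forall e, 0 < e -> exists K, forall k, (K <= k)%N ->
  cnorm (cls u - embed (u k)) <= e.
Proof.
move=> cu e e0; have [K hK] := cu e e0; exists K => k Kk.
rewrite clsB; try cauchy_tac.
apply: cnorm_le; first by apply: cauchyB => //; exact: cauchy_cst.
by exists K => j Kj; apply/ltW/hK.
Qed.

Lemma embed_dense (x : completion) e : 0 < e -> exists y, cnorm (x - embed y) <= e.
Proof.
move=> e0; have [u cu ->] := cls_ex x; have [K hK] := embed_cvg cu e0.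
by exists (u K); apply: hK.
Qed.

(** For completeness, approximate the k-th term of a Cauchy sequence within
1 / (k + 1) by an element of L; these elements form a Cauchy sequence, whose class
is the limit. *)
Lemma completion_banach : banach_norm cnorm.
Proof.
have sN := cnorm_seminorm.
split; try by case: sN.
- move=> x; have [u cu ->] := cls_ex x => e.
  apply: cls_eq => // d d0; have := cvg_cnorm cu; rewrite e => /cvgrPdist_lt /(_ d d0)[K _ hK].
  exists K => k /hK /=; rewrite sub0r normrN subr0; apply: le_lt_trans; exact: ler_norm.
- by rewrite -(us_1 p); exact: cnorm_embed.
move=> U cU.
have inv_small e : 0 < e -> exists K, forall k, (K <= k)%N -> k.+1%:R^-1 < e :> R.
  move=> e0; have ei : 0 < e^-1 by rewrite invr_gt0.
  have := archi_boundP (ltW ei); move: (Num.bound _) => K hK; exists K => k Kk.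
  rewrite invf_plt ?posrE //; apply: lt_le_trans hK _.
  by rewrite ler_nat ltnW // ltnS.
have [f hf] : {f : nat -> L & forall k, cnorm (U k - embed (f k)) <= k.+1%:R^-1}.
  apply: (@choice _ _ (fun k y => cnorm (U k - embed y) <= k.+1%:R^-1)) => k.
  by apply: embed_dense; rewrite invr_gt0.
have cf : cauchy f.
  move=> e e0; have e3 : 0 < e / 3 by lra.
  have [K1 hK1] := inv_small _ e3; have [K2 hK2] := cU _ e3.
  exists (maxn K1 K2) => k l; rewrite !geq_max => /andP[/hK1 a1 a2] /andP[/hK1 b1 b2].
  have h1 := hK2 _ _ a2 b2.
  rewrite -cnorm_embed.
  have -> : embed (f k - f l) = (U k - U l) + ((U l - embed (f l)) - (U k - embed (f k))).
    rewrite /embed -clsB; try cauchy_tac.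
    by ring.
  apply: (sn_lt3 sN) => //.
    by apply: le_trans (hf l) _; apply: ltW.
  by apply: le_trans (hf k) _; apply: ltW.
exists (cls f); apply/cvgrPdist_lt => e e0; have e3 : 0 < e / 3 by lra.
have [K1 hK1] := inv_small _ e3; have [K2 hK2] := embed_cvg cf e3.
exists (maxn K1 K2) => // k /=; rewrite geq_max => /andP[/hK1 a /hK2 b].
rewrite sub0r normrN ger0_norm ?(sn_ge0 sN) //.
have -> : U k - cls f = 0 + ((U k - embed (f k)) - (cls f - embed (f k))) by ring.
apply: (sn_lt3 sN) => //; first by rewrite (sn0 sN).
by apply: le_trans (hf k) _; apply: ltW.
Qed.

Fact embed_linear : linear embed.
Proof.
move=> c x y; rewrite /embed clsZ ?clsD //; try exact: cauchy_cst.
Qed.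
Fact embed_monoid : monoid_morphism embed.
Proof. by split => // x y; rewrite /embed clsM //; exact: cauchy_cst. Qed.
HB.instance Definition _ := GRing.isLinear.Build R[i] L completion _ embed embed_linear.
HB.instance Definition _ := GRing.isMonoidMorphism.Build L completion embed embed_monoid.

End Completion.

(** All that is used of the completion, stated so that its construction can be
forgotten. *)
Theorem completion_ex (R : realType) (L : comAlgType R[i]) (p : unital_seminorm L) :
  exists (A : comAlgType R[i]) (N : A -> R) (iota : {linear L -> A}),
  [/\ banach_norm N, forall f g, iota (f * g) = iota f * iota g, iota 1 = 1,
      forall f, N (iota f) = p f &
      forall x e, 0 < e -> exists f, N (x - iota f) <= e].
Proof.
exists (completion p), (@cnorm R L p), (embed p); split.
- exact: completion_banach.
- exact: rmorphM.
- exact: rmorph1.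
- exact: cnorm_embed.
- exact: embed_dense.
Qed.

(** * Sets defined by Laurent monomial inequalities *)

Definition posn (z : int) : nat := if z is Posz m then m else 0.
Definition negn (z : int) : nat := if z is Negz m then m.+1 else 0.

Lemma exprz_split (F : fieldType) (x : F) z : x ^ z = x ^+ posn z / x ^+ negn z.
Proof. by case: z => m; rewrite /= ?expr0 ?divr1 // NegzE -exprnN div1r. Qed.

Lemma int_split z : z = (posn z)%:Z - (negn z)%:Z.
Proof. by case: z => m /=; rewrite ?subr0 ?sub0r ?NegzE. Qed.

Section MonomialSets.
Variables (R : realType) (n : nat).
Implicit Types (s t : 'rV[R[i]]_n) (i j : 'rV[int]_n) (S : set 'I_n).

(** With 0^-1 = 0, the value at a point with a vanishing coordinate is meaningful
only if the exponent of that coordinate is nonnegative. *)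
Definition laurent (F : fieldType) (x : 'I_n -> F) i := \prod_k x k ^ i 0 k.
Definition laurent_pos (F : fieldType) (x : 'I_n -> F) i := \prod_k x k ^+ posn (i 0 k).
Definition laurent_neg (F : fieldType) (x : 'I_n -> F) i := \prod_k x k ^+ negn (i 0 k).

Lemma laurent_split (F : fieldType) (x : 'I_n -> F) i :
  laurent x i = laurent_pos x i / laurent_neg x i.
Proof.
rewrite /laurent_neg -prodfV -big_split /=.
by apply: eq_bigr => k _; rewrite exprz_split.
Qed.

(** The condition of monomial_le on zero coordinates says exactly that the
denominator of the monomial does not vanish. *)
Lemma laurent_neg_neq0 (F : fieldType) (x : 'I_n -> F) i :
  (forall k, i 0 k < 0 -> x k != 0) -> laurent_neg x i != 0.
Proof.
move=> h; apply/prodf_neq0 => k _; have := h k; case: (i 0 k) => m //= hm.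
  by rewrite oner_neq0.
by rewrite expf_neq0 // hm.
Qed.

Lemma laurent_neg_neq0P (F : fieldType) (x : 'I_n -> F) i k :
  laurent_neg x i != 0 -> i 0 k < 0 -> x k != 0.
Proof.
move=> /prodf_neq0/(_ k isT); case: (i 0 k) => m //=.
by rewrite expf_eq0.
Qed.

Lemma laurent_eps (F : fieldType) (x : 'I_n -> F) k : laurent x (eps k) = x k.
Proof.
rewrite /laurent (bigD1 k) //= mxE !eqxx expr1z big1 ?mulr1 // => j jk.
by rewrite mxE eqxx (negPf jk) expr0z.
Qed.

Lemma laurentN (F : fieldType) (x : 'I_n -> F) i : laurent x (- i) = (laurent x i)^-1.
Proof. by rewrite /laurent -prodfV; apply: eq_bigr => k _; rewrite mxE invr_expz. Qed.

Lemma laurent0 (F : fieldType) (x : 'I_n -> F) : laurent x 0 = 1.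
Proof. by rewrite /laurent big1 // => k _; rewrite mxE expr0z. Qed.

Lemma cabs_laurent s i : cabs (laurent (s 0) i) = laurent (fun k => cabs (s 0 k)) i.
Proof. by rewrite /laurent cabs_prod; apply: eq_bigr => k _; rewrite cabs_exprz. Qed.

Definition mono_set (I : set 'rV[int]_n) (c : 'rV[int]_n -> \bar R) :=
  [set s | forall i, I i -> monomial_le s i (c i)].

(** Exponents of the monomials analytic where the coordinates in S do not vanish;
Mset a is nonneg_off (Sset a). *)
Definition nonneg_off S : set 'rV[int]_n := [set i | forall k, ~ S k -> 0 <= i 0 k].

Lemma nonneg_off_Neps S k : S k -> nonneg_off S (- eps k).
Proof.
move=> Sk l Sl; rewrite !mxE eqxx /=; case: eqVneq => [e|]; last by rewrite oppr0.
by exfalso; apply: Sl; rewrite e.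
Qed.

(** A Laurent monomial is a quotient of two monomials whose denominator has no zeros
on the set; its supremum over the set is at most the constant that defines it. *)
Lemma mono_set_hull I c : rational_hull (mono_set I c) `<=` mono_set I c.
Proof.
move=> s hs i Ii.
pose mon (f : int -> nat) : mpoly.mpoly n R[i] :=
  mpoly.mpolyX R[i] (mpoly.Multinom [tuple f (i 0 k) | k < n]).
have monE f z : peval (mon f) z = \prod_k z 0 k ^+ f (i 0 k).
  rewrite /peval /mon mpoly.mevalX; apply: eq_bigr => k _; congr (_ ^+ _).
  by rewrite /mpoly.fun_of_multinom /= tnth_mktuple.
have q0 z : mono_set I c z -> peval (mon negn) z != 0.
  by move=> /(_ i Ii)[hz _]; rewrite monE; apply: laurent_neg_neq0.
have [qs le_s] := hs (mon posn) (mon negn) q0.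
rewrite monE in qs; split => [k|].
  exact: laurent_neg_neq0P qs.
have divE z : peval (mon posn) z / peval (mon negn) z = laurent (z 0) i.
  by rewrite !monE laurent_split.
rewrite -/(laurent (s 0) i) -divE; apply: le_trans le_s _.
by apply: ge_ereal_sup => _ [z hz <-]; rewrite divE; have [] := hz i Ii.
Qed.

Lemma sub_rational_hull (K : set 'rV[R[i]]_n) : K `<=` rational_hull K.
Proof.
move=> s Ks p q q0; split; first exact: q0.
by apply: ereal_sup_ubound; exists s.
Qed.

Lemma mono_set_circled I c : circled (mono_set I c).
Proof.
move=> a s ha hs i Ii; have [h1 h2] := hs i Ii; split=> [k ik|].
  rewrite mxE mulf_neq0 ?h1 // -cabs_eq0; have /(cabs_norm1 _)-> := ha k.
  exact: oner_neq0.
have -> : cabs (\prod_k (\row_k (a 0 k * s 0 k)) 0 k ^ i 0 k) = cabs (\prod_k s 0 k ^ i 0 k).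
  rewrite !cabs_prod; apply: eq_bigr => k _; rewrite mxE !cabs_exprz cabsM.
  by have /(cabs_norm1 _)-> := ha k; rewrite mul1r.
exact: h2.
Qed.

Section Bounded.
Variables (I : set 'rV[int]_n) (c : 'rV[int]_n -> \bar R) (S : set 'I_n).
Hypothesis IS : I `<=` nonneg_off S.
Hypothesis Ieps : forall k, I (eps k) /\ (c (eps k) < +oo)%E.
Hypothesis INeps : forall k, S k -> I (- eps k) /\ (c (- eps k) < +oo)%E.
Local Notation K := (mono_set I c).

Lemma lt_oo_real (x : \bar R) : (x < +oo)%E -> exists B : R, (x <= B%:E)%E.
Proof.
case: x => [r||] //= _; first by exists r.
by exists 0; apply: leNye.
Qed.

(** The bounds on 1 / s_k make the conditions s_k <> 0 closed; after that, each
inequality can be multiplied by its denominator. *)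
Lemma mono_set_closed : closed K.
Proof.
have [B hB] : {B : 'I_n -> R & forall k, S k -> (c (- eps k) <= (B k)%:E)%E}.
  apply: (@choice _ _ (fun k B => S k -> (c (- eps k) <= B%:E)%E)) => k.
  have [/INeps[_ /lt_oo_real[B hB]]|] := pselect (S k); first by exists B.
  by exists 0.
pose F k := [set s : 'rV[R[i]]_n | cabs (1 : R[i]) <= B k * cabs (s 0 k)].
pose G i (C : R) := [set s : 'rV[R[i]]_n | cabs (laurent_pos (s 0) i) <= C * cabs (laurent_neg (s 0) i)].
have posE s i : (forall k, i 0 k < 0 -> s 0 k != 0) -> forall C : R,
   (cabs (laurent (s 0) i) <= C) = (cabs (laurent_pos (s 0) i) <= C * cabs (laurent_neg (s 0) i)).
  move=> hs C; rewrite laurent_split cabsM cabsV ler_pdivrMr // cabs_gt0.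
  exact: laurent_neg_neq0.
have Sneq0 s k : F k s -> s 0 k != 0.
  by rewrite /F /= cabs1; apply: contraTneq => ->; rewrite cabs0 mulr0 -ltNge.
have -> : K = (\bigcap_(k in S) F k) `&`
   (\bigcap_(iC in [set iC : 'rV[int]_n * R | I iC.1 /\ (c iC.1 <= iC.2%:E)%E]) G iC.1 iC.2).
  apply/seteqP; split => s.
    move=> hs; split => [k Sk|[i C] /= [Ii hC]].
      have [h1 h2] := hs _ (INeps Sk).1; rewrite /F /= cabs1.
      have sk : s 0 k != 0 by apply: h1; rewrite !mxE !eqxx.
      rewrite -ler_pdivrMr ?cabs_gt0 // div1r -cabsV.
      by rewrite -lee_fin; apply: le_trans (hB k Sk); move: h2; rewrite -/(laurent _ _) laurentN laurent_eps.
    have [h1 h2] := hs _ Ii; rewrite /G /= -posE //.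
    by rewrite -lee_fin; apply: le_trans hC.
  move=> [h1 h2] i Ii.
  have sk k : i 0 k < 0 -> s 0 k != 0.
    move=> ik; apply: Sneq0; apply: h1; apply: contrapT => /(IS Ii).
    by rewrite leNgt ik.
  split => //; rewrite -/(laurent _ _).
  (* C = -1 rules out the value -oo of c i. *)
  have hC C : (c i <= C%:E)%E -> cabs (laurent (s 0) i) <= C.
    by move=> hC; rewrite posE //; apply: (h2 (i, C)).
  case: (c i) hC => [r||] hC; first by rewrite lee_fin; apply: hC.
    by rewrite leey.
  have h3 := hC (-1) (leNye _); have h4 := cabs_ge0 (laurent (s 0) i).
  by exfalso; clear hC; lra.
apply: closedI.
  by apply: closed_bigI => k _; apply: rvcont_closed_le; [exact: rvcont_cst|exact: rvcont_coord].
apply: closed_bigI => -[i C] _; apply: rvcont_closed_le;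
  by apply: rvcont_prod => k; apply/rvcontX/rvcont_coord.
Qed.

Lemma mono_set_compact : compact K.
Proof.
have [B hB] : {B : 'I_n -> R & forall k, (c (eps k) <= (B k)%:E)%E}.
  apply: (@choice _ _ (fun k B => (c (eps k) <= B%:E)%E)) => k.
  by have [_ /lt_oo_real[B hB]] := Ieps k; exists B.
apply: (@subclosed_compact _ K [set v : 'rV[R[i]]_n | forall k, [set z : R[i] | cabs z <= B k] (v ord0 k)]).
- exact: mono_set_closed.
- exact: (@rV_compact R[i] n (fun k => [set z | cabs z <= B k]) (fun k => @compact_disc R (B k))).
- move=> s hs k /=; have [_] := hs _ (Ieps k).1.
  rewrite -/(laurent _ _) laurent_eps => h.
  by rewrite -lee_fin; apply: le_trans (hB k).
Qed.

(** Lying in a common connected subset; unlike path connectedness, this needs no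
reparametrization to be transitive. *)
Definition joined (X : set 'rV[R[i]]_n) s t := exists C, [/\ connected C, C `<=` X, C s & C t].

Lemma joined_trans X s t u : joined X s t -> joined X t u -> joined X s u.
Proof.
move=> [C [cC CX Cs Ct]] [D [cD DX Dt Du]]; exists (C `|` D); split; last 2 first.
- by left.
- by right.
- by apply: connectedU => //; exists t.
- by move=> z [/CX|/DX].
Qed.

Lemma joined_sym X s t : joined X s t -> joined X t s.
Proof. by move=> [C [cC CX Cs Ct]]; exists C. Qed.

Lemma joined_connected X : (forall s t, X s -> X t -> joined X s t) -> connected X.
Proof.
move=> h; have [[t Xt]|X0] := pselect (X !=set0); last first.
  have -> : X = set0 by rewrite -subset0 => z Xz; apply: X0; exists z.
  exact: connected0.
have [C hC] : {C : 'rV[R[i]]_n -> set 'rV[R[i]]_n &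
    forall s, X s -> [/\ connected (C s), C s `<=` X, C s s & C s t]}.
  apply: (@choice _ _ (fun s C => X s -> [/\ connected C, C `<=` X, C s & C t])) => s.
  have [Xs|] := pselect (X s); last by exists set0.
  by have [C hC] := h s t Xs Xt; exists C.
have -> : X = \bigcup_(s in X) C s.
  apply/seteqP; split => [s Xs|z [s Xs]]; first by exists s => //; have [] := hC s Xs.
  by have [_ + _ _] := hC s Xs; apply.
apply: bigcup_connected; first by exists t => s Xs; have [] := hC s Xs.
by move=> s Xs; have [] := hC s Xs.
Qed.

Lemma joined_path X (f g : 'I_n -> R -> R) :
  (forall k, continuous (f k)) -> (forall k, continuous (g k)) ->
  let path x : 'rV[R[i]]_n := \row_k (f k x +i* g k x)%C in
  (forall x, 0 <= x <= 1 -> X (path x)) -> joined X (path 0) (path 1).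
Proof.
move=> cf cg path hX; exists (path @` `[0, 1]); split.
- apply: connected_continuous_connected; first exact: segment_connected.
  apply: continuous_subspaceT => x; apply/cvg_ballP => e e0.
  have /near_rV[d d0 hd] : \forall w \near path x, ball (path x) e w by exact: nbhsx_ballx.
  have d2 : 0 < d / 2 by lra.
  near=> y; apply: hd => k; rewrite !mxE.
  have -> : ((f k x +i* g k x) - (f k y +i* g k y) =
     (f k x - f k y)%:C + (0 +i* 1) * (g k x - g k y)%:C)%C.
    by apply/eqP; rewrite eq_complex /=; apply/andP; split; apply/eqP; ring.
  apply: le_lt_trans (cabsD _ _) _; rewrite cabsM !cabs_real.
  have -> : cabs (0 +i* 1 : R[i])%C = 1.
    by rewrite /cabs normc_def /= expr0n add0r expr1n sqrtr1.
  rewrite mul1r [ltRHS]splitr; apply: ltrD; move: k; near: y; apply: filter_forall => k.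
    by have /cvgrPdist_lt := cf k x; apply.
  by have /cvgrPdist_lt := cg k x; apply.
- by move=> _ [x /= + <-]; rewrite in_itv /=; exact: hX.
- by exists 0 => //=; rewrite in_itv /= lexx ler01.
- by exists 1 => //=; rewrite in_itv /= lexx ler01.
Unshelve. all: by end_near. Qed.

(** Only the logarithm of the modulus and some argument are needed, so the argument
is taken from acos, up to sign. *)
Lemma polar (z : R[i]) : z != 0 -> exists u b,
  z = (expR u * cos b +i* (expR u * sin b))%C.
Proof.
move=> z0; have a0 : 0 < cabs z by rewrite cabs_gt0.
pose x := complex.Re z / cabs z; pose y := complex.Im z / cabs z.
have xy : x ^+ 2 + y ^+ 2 = 1.
  rewrite /x /y !expr_div_n -mulrDl.
  have -> : complex.Re z ^+ 2 + complex.Im z ^+ 2 = cabs z ^+ 2.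
    apply: complexI; rewrite add_Re2_Im2 -cabsE.
    by rewrite rmorphXn.
  by rewrite divff // expf_neq0 // lt0r_neq0.
have x1 : -1 <= x <= 1.
  have := sqr_ge0 y => h; have h1 : x ^+ 2 <= 1 by lra.
  by rewrite -ler_norml -(expr_le1 (n := 2)) // real_normK ?num_real.
have sE : sin (acos x) = `|y|.
  by rewrite sin_acos // -xy addrAC subrr add0r sqrtr_sqr.
exists (ln (cabs z)); rewrite lnK ?posrE //.
have zE : z = (cabs z * x +i* (cabs z * y))%C.
  case: z @x @y a0 {z0 x1 xy sE} => p q x y a0; rewrite /x /y /=.
  by congr (_ +i* _)%C; rewrite mulrC divfK // lt0r_neq0.
have cE : cos (acos x) = x by apply: acosK; rewrite in_itv.
case: (leP 0 y) => y0.
  by exists (acos x); rewrite cE sE ger0_norm.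
by exists (- acos x); rewrite cosN sinN cE sE ltr0_norm // opprK.
Qed.

Lemma cabs_polar (u b : R) : cabs (expR u * cos b +i* (expR u * sin b))%C = expR u.
Proof.
rewrite /cabs normc_def /= !exprMn -mulrDr cos2Dsin2 mulr1 sqrtr_sqr.
by rewrite ger0_norm // expR_ge0.
Qed.

Lemma expR_exprz (x : R) (z : int) : expR x ^ z = expR (x * z%:~R).
Proof.
case: z => m; first by rewrite -exprnP -expRM_natr.
by rewrite NegzE -exprnN mulrNz mulrN expRN expRM_natr.
Qed.

Lemma le_mono_set s s' : K s -> (forall i, I i -> (forall k, i 0 k < 0 -> s' 0 k != 0)) ->
  (forall i, I i -> cabs (laurent (s' 0) i) <= cabs (laurent (s 0) i)) -> K s'.
Proof.
move=> Ks h1 h2 i Ii; split; first exact: h1.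
have [_] := Ks i Ii; apply: le_trans; rewrite lee_fin; exact: h2.
Qed.

Lemma mono_set_neq0 s k : K s -> S k -> s 0 k != 0.
Proof. by move=> Ks Sk; have [h _] := Ks _ (INeps Sk).1; apply: h; rewrite !mxE !eqxx. Qed.

Definition zero_outside s : 'rV[R[i]]_n := \row_k (if `[< S k >] then s 0 k else 0).

(** Scaling the coordinates outside S by x in [0, 1] decreases every monomial, as
their exponents there are nonnegative. *)
Lemma mono_set_zero_outside s : K s -> joined K s (zero_outside s).
Proof.
move=> Ks; apply: joined_sym.
pose f k x := (if `[< S k >] then 1 else x) * complex.Re (s 0 k).
pose g k x := (if `[< S k >] then 1 else x) * complex.Im (s 0 k).
pose path x : 'rV[R[i]]_n := \row_k (f k x +i* g k x)%C.
have cont (z : R) (b : bool) : continuous (fun x : R => (if b then 1 else x) * z).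
  by case: b => x; apply: cvgM; try apply: cvg_cst; exact: cvg_id.
have pE x : path x = \row_k ((if `[< S k >] then 1 else x%:C)%C * s 0 k).
  apply/rowP => k; rewrite !mxE /f /g; case: (s 0 k) => p q /=.
  by case: asboolP => _; apply/eqP; rewrite eq_complex /=; apply/andP; split; apply/eqP; ring.
have p0 : path 0 = zero_outside s.
  by rewrite pE; apply/rowP => k; rewrite !mxE; case: asboolP; rewrite ?mul1r ?mul0r.
have p1 : path 1 = s.
  by rewrite pE; apply/rowP => k; rewrite !mxE; case: asboolP; rewrite ?mul1r.
rewrite -p0 -[X in joined _ _ X]p1; apply: joined_path => [k|k|x /andP[x0 x1]]; [exact: cont|exact: cont|].
rewrite -/(path x).
rewrite pE; apply: (le_mono_set Ks) => i Ii.
  move=> k ik; rewrite mxE; case: asboolP => Sk; last by move: (IS Ii Sk); rewrite leNgt ik.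
  by rewrite mul1r (mono_set_neq0 Ks Sk).
rewrite /laurent !cabs_prod; apply: ler_prod => k _; rewrite cabs_ge0 /= mxE.
case: asboolP => Sk; first by rewrite mul1r.
have : 0 <= i 0 k := IS Ii Sk.
case: (i 0 k) => [m _|m /negP[]//]; rewrite -!exprnP !cabsX cabsM cabs_real ger0_norm; last exact: x0.
by apply: lerXn2r; rewrite ?nnegrE ?mulr_ge0 ?cabs_ge0 ?x0 // ler_piMl ?cabs_ge0.
Qed.

(** Interpolate the logarithms of the moduli and the arguments linearly.  The
logarithm of each monomial is then affine along the path, so it is at most the
larger of its values at the ends. *)
Lemma mono_set_log_path s t : K s -> K t -> (forall k, ~ S k -> s 0 k = 0) ->
  (forall k, ~ S k -> t 0 k = 0) -> joined K s t.
Proof.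
move=> Ks Kt s0 t0.
have pol z : K z -> {ub : 'I_n -> R * R & forall k, S k ->
    z 0 k = (expR (ub k).1 * cos (ub k).2 +i* (expR (ub k).1 * sin (ub k).2))%C}.
  move=> Kz; apply: (@choice _ _ (fun k ub => S k ->
    z 0 k = (expR ub.1 * cos ub.2 +i* (expR ub.1 * sin ub.2))%C)) => k.
  have [Sk|] := pselect (S k); last by exists (0, 0).
  by have [u [b zE]] := polar (mono_set_neq0 Kz Sk); exists (u, b).
have [ub hs] := pol s Ks; have [vd ht] := pol t Kt.
pose U k (x : R) := (1 - x) * (ub k).1 + x * (vd k).1.
pose D k (x : R) := (1 - x) * (ub k).2 + x * (vd k).2.
have contUD (p q : R) : continuous (fun x : R => (1 - x) * p + x * q).
  move=> x; apply: cvgD; apply: cvgM; try apply: cvg_cst; try exact: cvg_id.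
  by apply: cvgB; [exact: cvg_cst|exact: cvg_id].
pose f k x := (if `[< S k >] then 1 else 0) * (expR (U k x) * cos (D k x)).
pose g k x := (if `[< S k >] then 1 else 0) * (expR (U k x) * sin (D k x)).
pose path x : 'rV[R[i]]_n := \row_k (f k x +i* g k x)%C.
have pS k x : S k -> path x 0 k = (expR (U k x) * cos (D k x) +i* (expR (U k x) * sin (D k x)))%C.
  by move=> Sk; rewrite mxE /f /g asboolT // !mul1r.
have pN k x : ~ S k -> path x 0 k = 0.
  by move=> Sk; rewrite mxE /f /g asboolF // !mul0r.
have p0 : path 0 = s.
  apply/rowP => k; have [Sk|Sk] := pselect (S k); last by rewrite pN // s0.
  by rewrite pS // hs // /U /D !subr0 !mul1r !mul0r !addr0.
have p1 : path 1 = t.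
  apply/rowP => k; have [Sk|Sk] := pselect (S k); last by rewrite pN // t0.
  by rewrite pS // ht // /U /D !subrr !mul1r !mul0r !add0r.
rewrite -p0 -p1; apply: joined_path => [k|k|x /andP[x0 x1] i Ii]; last rewrite -/(path x).
- move=> x; apply: cvgM; first exact: cvg_cst.
  apply: cvgM; apply: continuous_comp; try exact: contUD; [exact: continuous_expR|exact: continuous_cos].
- move=> x; apply: cvgM; first exact: cvg_cst.
  apply: cvgM; apply: continuous_comp; try exact: contUD; [exact: continuous_expR|exact: continuous_sin].
split=> [k ik|].
  have Sk : S k by apply: contrapT => /(IS Ii); rewrite leNgt ik.
  by rewrite pS // -cabs_gt0 cabs_polar expR_gt0.
(* The coordinates outside S contribute the same factor 0 or 1 all along. *)
pose Z := \prod_(k | ~~ `[< S k >]) cabs (0 : R[i]) ^ i 0 k.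
pose E y := \sum_(k | `[< S k >]) U k y * (i 0 k)%:~R.
have pE y : cabs (laurent (path y 0) i) = expR (E y) * Z.
  rewrite /laurent cabs_prod (bigID (fun k => `[< S k >])) /=; congr (_ * _).
    rewrite /E expR_sum; apply: eq_bigr => k /asboolP Sk.
    by rewrite cabs_exprz pS // cabs_polar expR_exprz.
  by apply: eq_bigr => k /asboolPn Sk; rewrite cabs_exprz pN.
have Z0 : 0 <= Z.
  apply: prodr_ge0 => k _; apply: exprz_ge0; exact: cabs_ge0.
have EE : E x = (1 - x) * E 0 + x * E 1.
  rewrite /E !mulr_sumr -big_split; apply: eq_bigr => k _ /=.
  by rewrite /U; ring.
rewrite -/(laurent _ _) pE.
have [E01|E01] := leP (E 0) (E 1).
  have [_] := Kt i Ii; rewrite -p1 -/(laurent _ _) pE; apply: le_trans.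
  rewrite lee_fin ler_wpM2r // ler_expR EE.
  have : (1 - x) * E 0 <= (1 - x) * E 1 by rewrite ler_wpM2l // subr_ge0.
  lra.
have [_] := Ks i Ii; rewrite -p0 -/(laurent _ _) pE; apply: le_trans.
rewrite lee_fin ler_wpM2r // ler_expR EE.
have : x * E 1 <= x * E 0 by rewrite ler_wpM2l // ltW.
lra.
Qed.

Lemma mono_set_connected : connected K.
Proof.
apply: joined_connected => s t Ks Kt.
have js := mono_set_zero_outside Ks; have jt := mono_set_zero_outside Kt.
have inK z : joined K z (zero_outside z) -> K (zero_outside z) by move=> [C [_ + _]]; apply.
apply: joined_trans (js) _; apply: joined_trans (joined_sym (jt)).
apply: mono_set_log_path; [exact: inK js | exact: inK jt | |].
  by move=> k Sk; rewrite mxE asboolF.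
by move=> k Sk; rewrite mxE asboolF.
Qed.

Lemma mono_set_rcc : rat_convex_connected_circled K.
Proof.
split; [split; first exact: mono_set_compact|exact: mono_set_connected|exact: mono_set_circled].
by apply/seteqP; split; [exact: sub_rational_hull|exact: mono_set_hull].
Qed.

End Bounded.
End MonomialSets.

(** * Weighted norms of Laurent polynomials *)

Lemma big_supp (V : nmodType) (T : eqType) (J1 J2 : seq T) (F : T -> V) :
  uniq J1 -> uniq J2 -> (forall x, F x != 0 -> x \in J1) -> (forall x, F x != 0 -> x \in J2) ->
  \sum_(x <- J1) F x = \sum_(x <- J2) F x.
Proof.
move=> u1 u2 h1 h2.
have red J : \sum_(x <- J) F x = \sum_(x <- [seq y <- J | F y != 0]) F x.
  rewrite big_filter [LHS](bigID (fun x => F x != 0)) /= [X in _ + X]big1 ?addr0 //.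
  by move=> x /negPn/eqP.
rewrite red [RHS]red; apply: perm_big; apply: uniq_perm; rewrite ?filter_uniq //.
move=> x; rewrite !mem_filter; case: eqVneq => //= Fx.
by rewrite h1 ?h2.
Qed.

Section LaurentNorm.
Variables (R : realType) (n : nat).
Local Notation C := R[i].
Local Notation P := (mpoly.mpoly (n + n) R[i]).
Local Notation mon := (mpoly.multinom (n + n)).
Local Notation mexp := mpoly.fun_of_multinom.
Implicit Types (f g : P) (m : mon) (i j : 'rV[int]_n) (S : set 'I_n).

(** The Laurent exponent of a monomial in the 2 n variables x_k, y_k, of which y_k
stands for the inverse of x_k. *)
Definition deg m : 'rV[int]_n := \row_k ((mexp m (lshift n k))%:Z - (mexp m (rshift n k))%:Z).

Lemma degD m1 m2 : deg (mpoly.mnm_add m1 m2) = deg m1 + deg m2.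
Proof.
by apply/rowP => k; rewrite !mxE !mpoly.mnmDE !PoszD; ring.
Qed.

(** The linear functional with prescribed values on monomials.  Laurent
coefficients, evaluations and, by duality, the weighted norm are all of this
form. *)
Definition pairing (h : mon -> C) f : C := \sum_(m <- mpoly.msupp f) mpoly.mcoeff m f * h m.

Lemma pairing_supp h f (J : seq mon) : uniq J -> (forall m, mpoly.mcoeff m f != 0 -> m \in J) ->
  pairing h f = \sum_(m <- J) mpoly.mcoeff m f * h m.
Proof.
move=> uJ hJ; apply: big_supp => //.
  by move=> m; rewrite mulf_eq0 negb_or => /andP[+ _]; rewrite mpoly.mcoeff_msupp.
by move=> m; rewrite mulf_eq0 negb_or => /andP[+ _]; apply: hJ.
Qed.

Fact pairing_linear h : linear (pairing h : P -> C^o).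
Proof.
move=> c f g; pose J := undup (mpoly.msupp f ++ mpoly.msupp g).
have uJ : uniq J by exact: undup_uniq.
have hf m : mpoly.mcoeff m f != 0 -> m \in J.
  by rewrite -mpoly.mcoeff_msupp mem_undup mem_cat => ->.
have hg m : mpoly.mcoeff m g != 0 -> m \in J.
  by rewrite -mpoly.mcoeff_msupp mem_undup mem_cat => ->; rewrite orbT.
rewrite (pairing_supp h uJ hf) (pairing_supp h uJ hg) (@pairing_supp h _ J) //.
  rewrite scaler_sumr -big_split /=; apply: eq_bigr => m _.
  by rewrite mpoly.mcoeffD mpoly.mcoeffZ mulrDl -mulrA.
move=> m; rewrite mpoly.mcoeffD mpoly.mcoeffZ; apply: contraR => mJ.
have -> : mpoly.mcoeff m f = 0 by apply/eqP; apply: contraNT mJ; apply: hf.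
have -> : mpoly.mcoeff m g = 0 by apply/eqP; apply: contraNT mJ; apply: hg.
by rewrite mulr0 addr0.
Qed.
HB.instance Definition _ h := GRing.isLinear.Build C P C^o _ (pairing h) (pairing_linear h).

Lemma pairingX h m : pairing h (mpoly.mpolyX C m) = h m.
Proof. by rewrite /pairing mpoly.msuppX big_seq1 mpoly.mcoeffX eqxx mul1r. Qed.

Lemma linear_ext (V : lmodType C) (F G : {linear P -> V}) :
  (forall m, F (mpoly.mpolyX C m) = G (mpoly.mpolyX C m)) -> forall f, F f = G f.
Proof.
move=> h f; rewrite (mpoly.mpolyE f) !linear_sum; apply: eq_bigr => m _.
by rewrite !linearZ h.
Qed.

Lemma pairingM h f g : pairing h (f * g) =
  \sum_(m1 <- mpoly.msupp f) \sum_(m2 <- mpoly.msupp g)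
    mpoly.mcoeff m1 f * mpoly.mcoeff m2 g * h (mpoly.mnm_add m1 m2).
Proof.
rewrite {1}(mpoly.mpolyE f) {1}(mpoly.mpolyE g) mulr_suml linear_sum /=.
apply: eq_bigr => m1 _; rewrite mulr_sumr linear_sum /=; apply: eq_bigr => m2 _.
rewrite -scalerAl -scalerAr scalerA linearZ /= -mpoly.mpolyXD.
by rewrite [pairing h _]pairingX.
Qed.

Definition lcoef f j : C := pairing (fun m => (deg m == j)%:R) f.

Definition degs f := undup [seq deg m | m <- mpoly.msupp f].

Lemma lcoef_degs f j : lcoef f j != 0 -> j \in degs f.
Proof.
apply: contraR => hj; rewrite /lcoef /pairing big1_seq // => m /andP[_ mf].
case: eqVneq => [e|]; rewrite ?mulr0 //.
by move: hj; rewrite mem_undup -e map_f.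
Qed.

Lemma pairing_deg (phi : 'rV[int]_n -> C) f (J : seq 'rV[int]_n) : uniq J ->
  (forall m, mpoly.mcoeff m f != 0 -> deg m \in J) ->
  pairing (phi \o deg) f = \sum_(j <- J) lcoef f j * phi j.
Proof.
move=> uJ hJ; rewrite /lcoef /pairing.
under [RHS]eq_bigr do rewrite mulr_suml.
rewrite exchange_big /=; apply: eq_big_seq => m mf.
rewrite mpoly.mcoeff_msupp in mf.
rewrite (bigD1_seq (deg m)) ?hJ //= eqxx mulr1 big1 ?addr0 // => j jm.
by rewrite eq_sym (negPf jm) mulr0 mul0r.
Qed.

Lemma pairing_degs (phi : 'rV[int]_n -> C) f :
  pairing (phi \o deg) f = \sum_(j <- degs f) lcoef f j * phi j.
Proof.
apply: pairing_deg; first exact: undup_uniq.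
by move=> m; rewrite -mpoly.mcoeff_msupp mem_undup => mf; rewrite map_f.
Qed.

Section Norm.
Variable w : 'rV[int]_n -> R.
Hypothesis w0 : forall j, 0 <= w j.

(** The l^1 norm, with weight w, of the image of f in the Laurent polynomials. *)
Definition lnorm f : R := \sum_(j <- degs f) cabs (lcoef f j) * w j.

Lemma lnormE f (J : seq 'rV[int]_n) : uniq J -> (forall j, lcoef f j != 0 -> j \in J) ->
  lnorm f = \sum_(j <- J) cabs (lcoef f j) * w j.
Proof.
move=> uJ hJ; apply: big_supp => //; first exact: undup_uniq.
  by move=> j h; apply: lcoef_degs; apply: contra_neq h => ->; rewrite cabs0 mul0r.
by move=> j h; apply: hJ; apply: contra_neq h => ->; rewrite cabs0 mul0r.
Qed.

Lemma lcoef_le f j : cabs (lcoef f j) * w j <= lnorm f.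
Proof.
have [|jf] := boolP (j \in degs f); last first.
  have -> : lcoef f j = 0 by apply/eqP; apply: contraNT jf; exact: lcoef_degs.
  rewrite cabs0 mul0r; apply: sumr_ge0 => i _; rewrite mulr_ge0 ?cabs_ge0 //.
move=> jf; rewrite /lnorm (bigD1_seq j) ?undup_uniq //= lerDl.
by apply: sumr_ge0 => i _; rewrite mulr_ge0 ?cabs_ge0.
Qed.

Lemma pairing_le (phi : 'rV[int]_n -> C) f :
  (forall j, lcoef f j != 0 -> cabs (phi j) <= w j) -> cabs (pairing (phi \o deg) f) <= lnorm f.
Proof.
move=> h; rewrite pairing_degs; apply: le_trans (cabs_sum _ _ _) _.
apply: ler_sum => j _; rewrite cabsM.
have [->|c0] := eqVneq (lcoef f j) 0; first by rewrite cabs0 !mul0r.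
by rewrite ler_wpM2l ?cabs_ge0 // h.
Qed.

Definition csign (z : C) : C := (cabs z)%:C%C / z.

Lemma csignM z : z * csign z = (cabs z)%:C%C.
Proof.
rewrite /csign; have [->|z0] := eqVneq z 0; first by rewrite mul0r cabs0.
by rewrite mulrC divfK.
Qed.

Lemma cabs_csign z : cabs (csign z) <= 1.
Proof.
rewrite /csign cabsM cabsV cabs_real ger0_norm ?cabs_ge0 //.
have [->|z0] := eqVneq z 0; first by rewrite cabs0 mul0r.
by rewrite divff // cabs_eq0.
Qed.

(** The extremal functional: it has modulus at most w and attains the norm of f. *)
Definition dual f j : C := (w j)%:C%C * csign (lcoef f j).

Lemma dual_le f j : cabs (dual f j) <= w j.
Proof. by rewrite cabsM cabs_real ger0_norm // ler_piMr // cabs_csign. Qed.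

Lemma lnorm_dual f : (lnorm f)%:C%C = pairing (dual f \o deg) f.
Proof.
rewrite pairing_degs /lnorm rmorph_sum /=; apply: eq_bigr => j _.
by rewrite /dual mulrCA csignM rmorphM mulrC.
Qed.

Lemma lnorm_ge0 f : 0 <= lnorm f.
Proof. by apply: sumr_ge0 => j _; rewrite mulr_ge0 ?cabs_ge0. Qed.

Lemma lnormEd f : lnorm f = cabs (pairing (dual f \o deg) f).
Proof. by rewrite -lnorm_dual cabs_real ger0_norm ?lnorm_ge0. Qed.

Lemma lnormD f g : lnorm (f + g) <= lnorm f + lnorm g.
Proof.
rewrite lnormEd linearD /=; apply: le_trans (cabsD _ _) _.
by apply: lerD; apply: pairing_le => j _; apply: dual_le.
Qed.

Lemma lcoefZ c f j : lcoef (c *: f) j = c * lcoef f j.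
Proof. by rewrite /lcoef linearZ. Qed.

Lemma lcoefB f g j : lcoef (f - g) j = lcoef f j - lcoef g j.
Proof. by rewrite /lcoef linearB. Qed.

Lemma lnormZ c f : lnorm (c *: f) = cabs c * lnorm f.
Proof.
rewrite (@lnormE _ (degs f)) ?undup_uniq //.
  by rewrite mulr_sumr; apply: eq_bigr => j _; rewrite lcoefZ cabsM mulrA.
by move=> j; rewrite lcoefZ mulf_eq0 negb_or => /andP[_]; exact: lcoef_degs.
Qed.

Lemma lnorm_eq0 f : (forall j, lcoef f j = 0) -> lnorm f = 0.
Proof. by move=> h; rewrite /lnorm big1 // => j _; rewrite h cabs0 mul0r. Qed.

Lemma lcoefX m j : lcoef (mpoly.mpolyX C m) j = (deg m == j)%:R.
Proof. exact: pairingX. Qed.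

Lemma lnormX m : lnorm (mpoly.mpolyX C m) = w (deg m).
Proof.
rewrite (@lnormE _ [:: deg m]) ?big_seq1 ?lcoefX ?eqxx ?cabs1 ?mul1r //.
by move=> j; rewrite lcoefX inE [j == _]eq_sym; case: (deg m == j); rewrite ?eqxx.
Qed.

Definition supported f (D : set 'rV[int]_n) := forall m, mpoly.mcoeff m f != 0 -> D (deg m).

(** Apply the extremal functional of f g and expand the product; submultiplicativity
of w bounds the functional at i + j by w i * w j.  The
weights in use are submultiplicative only on some D containing the degrees. *)
Lemma lnormM (D : set 'rV[int]_n) f g :
  (forall i j, D i -> D j -> w (i + j) <= w i * w j) ->
  supported f D -> supported g D ->
  lnorm (f * g) <= lnorm f * lnorm g.
Proof.
move=> wM sf sg; set h := dual (f * g).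
have e : pairing (h \o deg) (f * g) = \sum_(i <- degs f) \sum_(j <- degs g)
    lcoef f i * lcoef g j * h (i + j).
  rewrite pairingM.
  have e1 m1 : \sum_(m2 <- mpoly.msupp g) mpoly.mcoeff m1 f * mpoly.mcoeff m2 g *
       (h \o deg) (mpoly.mnm_add m1 m2) =
      mpoly.mcoeff m1 f * \sum_(j <- degs g) lcoef g j * h (deg m1 + j).
    rewrite -(pairing_degs (fun j => h (deg m1 + j))) mulr_sumr; apply: eq_bigr => m2 _.
    by rewrite /= degD -[LHS]mulrA.
  under eq_bigr do rewrite e1.
  rewrite [LHS](_ : _ = pairing ((fun i => \sum_(j <- degs g) lcoef g j * h (i + j)) \o deg) f) //.
  rewrite pairing_degs; apply: eq_bigr => i _; rewrite mulr_sumr; apply: eq_bigr => j _.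
  by rewrite mulrA.
rewrite lnormEd e; apply: le_trans (cabs_sum _ _ _) _.
rewrite /lnorm mulr_suml big_seq [leRHS]big_seq; apply: ler_sum => i Hi.
apply: le_trans (cabs_sum _ _ _) _.
rewrite mulr_sumr big_seq [leRHS]big_seq; apply: ler_sum => j Hj.
rewrite cabsM (cabsM (lcoef f i)) mulrACA ler_wpM2l ?mulr_ge0 ?cabs_ge0 //.
have inD p k : supported p D -> k \in degs p -> D k.
  move=> sp; rewrite mem_undup => /mapP[m]; rewrite mpoly.mcoeff_msupp => h1 ->.
  exact: sp.
apply: le_trans (dual_le _ _) _; apply: wM; [exact: inD sf Hi|exact: inD sg Hj].
Qed.

End Norm.

End LaurentNorm.
Arguments deg {n} m.
Arguments pairing {R n} h f.
Arguments lcoef {R n} f j.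
Arguments degs {R n} f.
Arguments lnorm {R n} w f.
Arguments supported {R n} f D.

(** * Weighted algebras of Laurent series *)

Section WeightedAlgebra.
Variables (R : realType) (n : nat).
Local Notation C := R[i].
Local Notation P := (mpoly.mpoly (n + n) R[i]).
Local Notation mon := (mpoly.multinom (n + n)).
Local Notation mexp := mpoly.fun_of_multinom.
Implicit Types (f g : P) (m : mon) (i j : 'rV[int]_n) (S : set 'I_n).

Lemma split_l (k : 'I_n) : fintype.split (lshift n k) = inl k.
Proof. exact: (unsplitK (inl k)). Qed.

Lemma split_r (k : 'I_n) : fintype.split (rshift n k) = inr k.
Proof. exact: (unsplitK (inr k)). Qed.

Definition mk_mon (a b : 'I_n -> nat) : mon :=
  mpoly.Multinom [tuple (match fintype.split v with inl k => a k | inr k => b k end) | v < n + n].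

Lemma mk_monl a b k : mexp (mk_mon a b) (lshift n k) = a k.
Proof. by rewrite /mexp /= tnth_mktuple split_l. Qed.

Lemma mk_monr a b k : mexp (mk_mon a b) (rshift n k) = b k.
Proof. by rewrite /mexp /= tnth_mktuple split_r. Qed.

Definition xvar k : P := mpoly.mpolyX C (mpoly.mnm1 (lshift n k)).
Definition yvar k : P := mpoly.mpolyX C (mpoly.mnm1 (rshift n k)).

Definition restr_var S (v : 'I_(n + n)) : P :=
  match fintype.split v with inl k => xvar k | inr k => if `[< S k >] then yvar k else 1 end.

(** The homomorphism that makes y_k the formal inverse of x_k for k in S and
replaces it by 1 otherwise.  Composed with it, a weight on nonneg_off S gives a
seminorm on the whole polynomial ring. *)
Definition restr S f : P := mpoly.comp_mpoly [tuple restr_var S v | v < n + n] f.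

Fact restr_linear S : linear (restr S).
Proof. by move=> c f g; rewrite /restr mpoly.comp_mpolyD mpoly.comp_mpolyZ. Qed.
HB.instance Definition _ S := GRing.isLinear.Build C P P _ (restr S) (restr_linear S).

Lemma restrM S f g : restr S (f * g) = restr S f * restr S g.
Proof. by rewrite /restr rmorphM. Qed.

Lemma restr1 S : restr S 1 = 1.
Proof. by rewrite /restr rmorph1. Qed.

Definition restr_mon S m := mk_mon (fun k => mexp m (lshift n k))
  (fun k => if `[< S k >] then mexp m (rshift n k) else 0%N).

Lemma mpolyX_split m : mpoly.mpolyX C m =
  (\prod_(k < n) xvar k ^+ mexp m (lshift n k)) * \prod_(k < n) yvar k ^+ mexp m (rshift n k).
Proof. by rewrite mpoly.mpolyXE_id big_split_ord. Qed.

Lemma restrX S m : restr S (mpoly.mpolyX C m) = mpoly.mpolyX C (restr_mon S m).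
Proof.
rewrite /restr mpoly.comp_mpolyX big_split_ord /= mpolyX_split; congr (_ * _).
  apply: eq_bigr => k _; rewrite mk_monl tnth_mktuple.
  by rewrite /restr_var split_l.
apply: eq_bigr => k _; rewrite mk_monr tnth_mktuple /restr_var split_r.
by case: asboolP; rewrite ?expr1n ?expr0.
Qed.

Lemma restr_supp S f m : mpoly.mcoeff m (restr S f) != 0 -> exists m', m = restr_mon S m'.
Proof.
move=> h; apply: contrapT => nex; move/negP: h; apply; apply/eqP.
have -> : restr S f = \sum_(m' <- mpoly.msupp f) mpoly.mcoeff m' f *: mpoly.mpolyX C (restr_mon S m').
  rewrite {1}(mpoly.mpolyE f) (linear_sum (restr S)); apply: eq_bigr => m' _.
  by rewrite -restrX; exact: (linearZ_LR (restr S)).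
rewrite (raddf_sum (mpoly.mcoeff m)) big1 // => m' _.
rewrite /= mpoly.mcoeffZ mpoly.mcoeffX.
case: eqVneq => [e|]; last by rewrite mulr0.
by exfalso; apply: nex; exists m'.
Qed.

Lemma restr_mon_yfree S m k : ~ S k -> mexp (restr_mon S m) (rshift n k) = 0%N.
Proof. by move=> Sk; rewrite mk_monr asboolF. Qed.

Lemma restr_supported S f : supported (restr S f) (nonneg_off S).
Proof.
by move=> m /restr_supp[m' ->] k Sk; rewrite mxE restr_mon_yfree // subr0.
Qed.

(** The reduced monomial of a given Laurent degree. *)
Definition laurent_mon j : mon := mk_mon (fun k => posn (j 0 k)) (fun k => negn (j 0 k)).

Lemma deg_laurent_mon j : deg (laurent_mon j) = j.
Proof. by apply/rowP => k; rewrite !mxE mk_monl mk_monr -int_split. Qed.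

Lemma multinom_ext m1 m2 : (forall k, mexp m1 (lshift n k) = mexp m2 (lshift n k)) ->
  (forall k, mexp m1 (rshift n k) = mexp m2 (rshift n k)) -> m1 = m2.
Proof.
move=> h1 h2; apply/mpoly.mnmP => v; rewrite -(splitK v).
by case: (fintype.split v) => k /=.
Qed.

Lemma restr_mon_laurent_mon S j : nonneg_off S j -> restr_mon S (laurent_mon j) = laurent_mon j.
Proof.
move=> hj; apply: multinom_ext => k; rewrite ?mk_monl // !mk_monr.
case: asboolP => // /hj; by case: (j 0 k).
Qed.

Lemma restr_laurent_mon S j : nonneg_off S j -> restr S (mpoly.mpolyX C (laurent_mon j)) = mpoly.mpolyX C (laurent_mon j).
Proof. by move=> hj; rewrite restrX restr_mon_laurent_mon. Qed.

Definition mon_eval (u v : 'I_n -> C) m : C :=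
  (\prod_(k < n) u k ^+ mexp m (lshift n k)) * \prod_(k < n) v k ^+ mexp m (rshift n k).

(** Evaluation at x_k = u k and y_k = v k, written as a pairing to compare it with
the Laurent coefficients. *)
Definition leval u v f : C := pairing (mon_eval u v) f.

Lemma levalE u v f : leval u v f =
  mpoly.meval (fun a => match fintype.split a with inl k => u k | inr k => v k end) f.
Proof.
rewrite mpoly.mevalE /leval /pairing; apply: eq_bigr => m _; congr (_ * _).
rewrite big_split_ord /=; congr (_ * _); apply: eq_bigr => k _.
  by rewrite split_l.
by rewrite split_r.
Qed.

Lemma levalM u v f g : leval u v (f * g) = leval u v f * leval u v g.
Proof. by rewrite !levalE mpoly.mevalM. Qed.

Lemma leval1 u v : leval u v 1 = 1.
Proof. by rewrite levalE mpoly.meval1. Qed.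

Lemma levalX u v m : leval u v (mpoly.mpolyX C m) = mon_eval u v m.
Proof. exact: pairingX. Qed.

Lemma mon_eval_laurent_mon u v j : mon_eval u v (laurent_mon j) = laurent_pos u j * laurent_neg v j.
Proof.
by congr (_ * _); apply: eq_bigr => k _; rewrite ?mk_monl ?mk_monr.
Qed.

Lemma mon_eval_laurent (u : 'I_n -> C) m :
  (forall k, u k = 0 -> mexp m (rshift n k) = 0%N) ->
  mon_eval u (fun k => (u k)^-1) m = laurent u (deg m).
Proof.
move=> h; rewrite /mon_eval -big_split; apply: eq_bigr => k _ /=; rewrite mxE.
have [u0|u0] := eqVneq (u k) 0; first by rewrite h // expr0 mulr1 subr0.
by rewrite expfzDr // exprVn -exprnP -exprnN.
Qed.

Lemma leval_restr S (u : 'I_n -> C) f : (forall k, S k -> u k != 0) ->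
  leval u (fun k => (u k)^-1) (restr S f) = pairing (laurent u \o deg) (restr S f).
Proof.
move=> hS; apply: eq_big_seq => m; rewrite mpoly.mcoeff_msupp => /restr_supp[m' ->] /=.
rewrite mon_eval_laurent // => k uk; apply: restr_mon_yfree => /hS.
by rewrite uk eqxx.
Qed.

Lemma multiplicative_functional_eval (Phi : {linear P -> C^o}) : (forall f g, Phi (f * g) = Phi f * Phi g) ->
  Phi 1 = 1 -> forall f, Phi f = leval (Phi \o xvar) (Phi \o yvar) f.
Proof.
move=> PM P1 f.
have PX (h : P) k : Phi (h ^+ k) = Phi h ^+ k.
  by elim: k => [|k IH]; rewrite ?expr0 // !exprS PM IH.
have Pprod (I : Type) (r : seq I) (F : I -> P) : Phi (\prod_(i <- r) F i) = \prod_(i <- r) Phi (F i).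
  by apply: (big_morph Phi) => //.
apply: (@linear_ext _ _ _ Phi (pairing (mon_eval (Phi \o xvar) (Phi \o yvar)))) => m.
rewrite [RHS]levalX /mon_eval mpolyX_split PM !Pprod; congr (_ * _);
by apply: eq_bigr => k _; rewrite PX.
Qed.

Definition xpoly (q : mpoly.mpoly n C) : P := mpoly.comp_mpoly [tuple xvar k | k < n] q.

Lemma leval_xpoly u v q : leval u v (xpoly q) = mpoly.meval u q.
Proof.
rewrite /xpoly mpoly.comp_mpolyE mpoly.mevalE /leval linear_sum; apply: eq_bigr => m _.
rewrite linearZ /= -/(leval u v _); congr (_ * _).
rewrite levalE rmorph_prod; apply: eq_bigr => k _.
by rewrite rmorphXn /= tnth_mktuple mpoly.mevalXU split_l.
Qed.

Section Algebra.
Variables (S : set 'I_n) (w : 'rV[int]_n -> R).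
Hypothesis w0 : forall j, 0 <= w j.
Hypothesis w1 : w 0 = 1.
Hypothesis wM : forall i j, nonneg_off S i -> nonneg_off S j -> w (i + j) <= w i * w j.

Definition wnorm f := lnorm w (restr S f).

Lemma wnorm_seminorm : alg_seminorm wnorm.
Proof.
split=> [f g|c f|f g]; rewrite /wnorm.
- by rewrite linearD; exact: lnormD.
- by rewrite linearZ; exact: lnormZ.
- rewrite restrM; apply: lnormM wM _ _ => //; exact: restr_supported.
Qed.

Lemma wnormX m : wnorm (mpoly.mpolyX C m) = w (deg (restr_mon S m)).
Proof. by rewrite /wnorm restrX lnormX. Qed.

Lemma wnorm_laurent_mon j : nonneg_off S j -> wnorm (mpoly.mpolyX C (laurent_mon j)) = w j.
Proof. by move=> hj; rewrite wnormX restr_mon_laurent_mon // deg_laurent_mon. Qed.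

Lemma wnorm1 : wnorm 1 = 1.
Proof.
rewrite -mpoly.mpolyX0 wnormX -w1; congr w; apply/rowP => k; rewrite !mxE mk_monl mk_monr.
by rewrite !mpoly.mnm0E if_same.
Qed.

Definition wseminorm := UnitalSeminorm wnorm_seminorm wnorm1.

Section Extension.
Variables (A : comAlgType C) (N : A -> R) (iota : {linear P -> A}).
Hypothesis hN : banach_norm N.
Hypothesis iotaM : forall f g, iota (f * g) = iota f * iota g.
Hypothesis iota1 : iota 1 = 1.
Hypothesis iota_norm : forall f, N (iota f) = wnorm f.

(** As x_k y_k - 1 has seminorm 0 for k in S, a character is the evaluation at a
point t with t_k <> 0 for k in S, and its values on the monomials are bounded by
their norms w j. *)
Lemma weighted_algebra_character (phi : {linear A -> C^o}) : character phi ->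
  let t : 'rV[C]_n := \row_k phi (iota (xvar k)) in
  mono_set (nonneg_off S) (fun j => (w j)%:E) t /\
  forall q, phi (iota (xpoly q)) = peval q t.
Proof.
move=> hphi t.
pose Phi : {linear P -> C^o} := phi \o iota.
have PhiE f : Phi f = phi (iota f) by [].
have PM f g : Phi (f * g) = Phi f * Phi g by rewrite !PhiE iotaM hphi.1.
have P1 : Phi 1 = 1 by rewrite PhiE iota1 (character1 hphi).
have PE := multiplicative_functional_eval PM P1.
have tE k : t 0 k = Phi (xvar k) by rewrite mxE.
have Ple f : cabs (Phi f) <= wnorm f.
  by apply: le_trans (character_le hN _ hphi) _; rewrite iota_norm.
have inv k : S k -> t 0 k * Phi (yvar k) = 1.
  move=> Sk; rewrite tE -PM -P1; apply/eqP; rewrite -subr_eq0 -linearB -cabs_eq0 eq_le cabs_ge0 andbT.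
  apply: le_trans (Ple _) _; rewrite /wnorm lnorm_eq0 // => j.
  rewrite linearB /= restr1 -mpoly.mpolyX0 /xvar /yvar -mpoly.mpolyXD restrX lcoefB !lcoefX.
  suff -> : deg (restr_mon S (mpoly.mnm_add (mpoly.mnm1 (lshift n k)) (mpoly.mnm1 (rshift n k)))) =
     deg (@mpoly.mnm0 (n + n)) by rewrite subrr.
  apply/rowP => l; rewrite !mxE mk_monl mk_monr !mpoly.mnmDE !mpoly.mnm0E !mpoly.mnm1E.
  rewrite !eq_shift addn0 add0n.
  by case: eqVneq => [<-|]; [rewrite asboolT // subrr|rewrite if_same].
have t0 k : S k -> t 0 k != 0.
  by move=> /inv e; apply: contra_eq_neq e => ->; rewrite mul0r eq_sym oner_neq0.
have Pl j : nonneg_off S j -> Phi (mpoly.mpolyX C (laurent_mon j)) = laurent (t 0) j.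
  move=> hj; rewrite PE levalX mon_eval_laurent_mon laurent_split; congr (_ * _).
    by apply: eq_bigr => k _; rewrite tE.
  rewrite /laurent_neg -prodfV; apply: eq_bigr => k _ /=.
  have [Sk|Sk] := pselect (S k); last first.
    by have := hj k Sk; case: (j 0 k) => // l _; rewrite !expr0 invr1.
  by rewrite -exprVn; congr (_ ^+ _); apply: (mulfI (t0 k Sk)); rewrite inv // divff // t0.
split.
  move=> j hj; split=> [k jk|].
    apply: t0; apply: contrapT => /hj; by rewrite leNgt jk.
  by rewrite -/(laurent _ _) lee_fin -Pl // -(wnorm_laurent_mon hj).
move=> q; rewrite -[LHS]/(Phi _) PE leval_xpoly /peval.
by apply: mpoly.meval_eq => k; rewrite tE.
Qed.

End Extension.

(** In the completion q is invertible, as no character vanishes on it; approximate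
the inverse by a polynomial. *)
Lemma approx_inverse (q : mpoly.mpoly n C) :
  (forall t, mono_set (nonneg_off S) (fun j => (w j)%:E) t -> peval q t != 0) ->
  forall e, 0 < e -> exists f, wnorm (xpoly q * f - 1) <= e.
Proof.
move=> hq e e0; have [A [N [iota [hN iM i1 iN iD]]]] := completion_ex wseminorm.
have sN := banach_seminorm hN.
have [phi hphi|b hb] := invertible_char hN (y := iota (xpoly q)).
  by have [ht ->] := weighted_algebra_character hN iM i1 iN hphi; apply: hq.
pose d := wnorm (xpoly q) + 1.
have d0 : 0 < d by have := sn_ge0 wnorm_seminorm (xpoly q); rewrite /d; lra.
have [f hf] := iD b _ (divr_gt0 e0 d0).
exists f; rewrite -[wnorm _]/(us_fun wseminorm _) -iN.
have -> : iota (xpoly q * f - 1) = - (iota (xpoly q) * (b - iota f)).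
  by rewrite linearB /= iM i1 -hb; ring.
rewrite (snN sN); apply: le_trans (sn_M sN _ _) _; rewrite iN.
move: hf; rewrite ler_pdivlMr // mulrC; apply: le_trans.
by rewrite ler_wpM2r ?(sn_ge0 sN) // /d lerDl.
Qed.

End Algebra.
End WeightedAlgebra.

(** * Submultiplicative families and maximality *)

Section Submultiplicative.
Variables (R : realType) (n : nat) (a : 'rV[int]_n -> R).
Hypothesis a_ge0 : forall i, S0 i -> 0 <= a i.
Hypothesis a_0 : a 0 = 1.
Hypothesis a_M : forall i j, S0 i -> S0 j -> a (i + j) <= a i * a j.
Implicit Types (i j m : 'rV[int]_n).
Local Notation S := (Sset a).

Lemma S00 : S0 (0 : 'rV[int]_n). Proof. by move=> k; rewrite mxE. Qed.

Lemma S0D i j : S0 i -> S0 j -> S0 (i + j).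
Proof. by move=> hi hj k; rewrite mxE addr_ge0. Qed.

Lemma S0_eps k : S0 (eps k : 'rV[int]_n).
Proof. by move=> l; rewrite mxE; case: (_ && _). Qed.

Lemma S0_nonneg_off (T : set 'I_n) i : S0 i -> nonneg_off T i.
Proof. by move=> h k _; apply: h. Qed.

Lemma Csup_ge0 i : (0 <= Csup a i)%E.
Proof.
rewrite /Csup; case: asboolP => [[m Am]|_]; last exact: leey.
apply: le_trans (ereal_sup_ubound _); last by exists m.
case: Am => h1 h2 _; rewrite /equot; case: eqP => _; first exact: leey.
by rewrite lee_fin divr_ge0 ?a_ge0.
Qed.

Lemma Csup_le i c :
  (forall m, S0 m -> S0 (m + i) -> a (m + i) <= c * a m) -> Aset a i !=set0 -> (Csup a i <= c%:E)%E.
Proof.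
move=> h A0; rewrite /Csup asboolT //; apply: ge_ereal_sup => _ [m [h1 h2 h3] <-].
have := h m h1 h2; rewrite /equot; case: eqP => am.
  rewrite am mulr0 => h4; exfalso; apply: h3; split => //.
  by apply/eqP; rewrite eq_le h4 a_ge0.
by move=> h4; rewrite lee_fin ler_pdivrMr // lt_def a_ge0 // andbT; apply/eqP.
Qed.

(** The case a m = a (m + i) = 0, excluded from the supremum, is harmless here. *)
Lemma Csup_bound i c m : (Csup a i <= c%:E)%E -> S0 m -> S0 (m + i) -> a (m + i) <= c * a m.
Proof.
move=> hc h1 h2; have [[e1 e2]|nz] := pselect (a m = 0 /\ a (m + i) = 0).
  by rewrite e1 e2 mulr0.
have Am : Aset a i m by [].
have : (equot (a (m + i)) (a m) <= c%:E)%E.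
  apply: le_trans hc; rewrite /Csup asboolT; last by exists m.
  by apply: ereal_sup_ubound; exists m.
rewrite /equot; case: eqP => am; first by rewrite leye_eq.
by rewrite lee_fin ler_pdivrMr // lt_def a_ge0 // andbT; apply/eqP.
Qed.

Lemma Csup_S0 i : S0 i -> (Csup a i <= (a i)%:E)%E.
Proof.
move=> hi; have A0 : Aset a i 0.
  by split; [exact: S00|rewrite add0r|rewrite a_0 => -[/eqP]; rewrite oner_eq0].
apply: Csup_le; last by exists 0.
by move=> m hm _; rewrite mulrC; apply: a_M.
Qed.

Lemma Kset_rcc : rat_convex_connected_circled (Kset a).
Proof.
apply: (@mono_set_rcc R n (Mset a) (Csup a) S).
- by [].
- move=> k; split; first exact/S0_nonneg_off/S0_eps.
  by apply: le_lt_trans (Csup_S0 (S0_eps k)) _; rewrite ltry.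
- move=> k Sk; split; last by move: Sk => /fin_numPlt/andP[].
  exact: nonneg_off_Neps.
Qed.

Section Weight.
Variables (i0 : 'rV[int]_n) (c : R) (b : 'I_n -> R).
Hypothesis c0 : 0 <= c.
Hypothesis b0 : forall k, 0 <= b k.
Hypothesis hc : (Csup a i0 <= c%:E)%E.
Hypothesis hb : forall k, S k -> (Csup a (- eps k) <= (b k)%:E)%E.

Definition shift (q : 'I_n -> nat) : 'rV[int]_n := \sum_k eps k *+ q k.

Lemma shiftE q k : shift q 0 k = (q k)%:Z.
Proof.
rewrite /shift summxE (bigD1 k) //= mulmxnE mxE !eqxx /= big1 ?addr0.
  by rewrite -natr1 ?natz; case: (q k).
by move=> l lk; rewrite mulmxnE mxE eqxx eq_sym (negPf lk) mul0rn.
Qed.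

(** The ways to reach the exponent j from an exponent m in S0 by p steps along i0
and, for k in S, q k steps along - eps k. *)
Definition presentation j (x : 'rV[int]_n * nat * ('I_n -> nat)) :=
  let: (m, p, q) := x in
  [/\ S0 m, forall k, ~ S k -> q k = 0%N & m + i0 *+ p - shift q = j].

(** The norm that the triangle inequality allows for the product of x^m with p
factors x^i0 of norm c and q k inverses of x_k of norm b k. *)
Definition cost (x : 'rV[int]_n * nat * ('I_n -> nat)) : R :=
  let: (m, p, q) := x in a m * c ^+ p * \prod_k b k ^+ q k.

Definition weight j := inf [set cost x | x in presentation j].

Lemma prod_b_ge0 (q : 'I_n -> nat) : 0 <= \prod_k b k ^+ q k.
Proof. by apply: prodr_ge0 => k _; rewrite exprn_ge0. Qed.

Lemma cost_ge0 j x : presentation j x -> 0 <= cost x.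
Proof.
by case: x => [[m p] q] [h _ _] /=; rewrite !mulr_ge0 ?a_ge0 ?exprn_ge0 ?prod_b_ge0.
Qed.

Lemma weight_le j x : presentation j x -> weight j <= cost x.
Proof.
move=> hx; apply: ge_inf; last by exists x.
by exists 0 => _ [y hy <-]; apply: cost_ge0 hy.
Qed.

Lemma weight_ge0 j : 0 <= weight j.
Proof.
have [[x hx]|h] := pselect ([set cost x | x in presentation j] !=set0).
  by apply: lb_le_inf => [|_ [y hy <-]]; [exists x|apply: cost_ge0 hy].
rewrite /weight; have -> : [set cost x | x in presentation j] = set0.
  by rewrite -subset0 => x hx; apply: h; exists x.
by rewrite inf0.
Qed.

Lemma presentation_ex j : nonneg_off S j -> exists x, presentation j x.
Proof.
move=> hj; exists (\row_k (posn (j 0 k))%:Z, 0%N, fun k => negn (j 0 k)); split.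
- by move=> k; rewrite mxE.
- by move=> k /hj; case: (j 0 k).
- by apply/rowP => k; rewrite mulr0n addr0 !mxE shiftE -int_split.
Qed.

Lemma weight_geM j x d : nonneg_off S j -> 0 <= d ->
  (forall y, presentation j y -> x <= cost y * d) -> x <= weight j * d.
Proof.
move=> hj d0 h; have [y0 hy0] := presentation_ex hj.
have [d00|dn] := eqVneq d 0; first by have := h _ hy0; rewrite d00 !mulr0.
have dp : 0 < d by rewrite lt_def dn.
rewrite -ler_pdivrMr //; apply: lb_le_inf; first by exists (cost y0), y0.
by move=> _ [y hy <-]; rewrite ler_pdivrMr // h.
Qed.

Lemma weightM i j : nonneg_off S i -> nonneg_off S j ->
  weight (i + j) <= weight i * weight j.
Proof.
move=> hi hj; apply: weight_geM => //; first exact: weight_ge0.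
move=> x hx; rewrite mulrC; apply: weight_geM => //; first exact: cost_ge0 hx.
move=> y hy.
case: x hx => [[m p] q] [h1 h2 h3]; case: y hy => [[m' p'] q'] [h1' h2' h3'].
apply: le_trans (weight_le (x := (m + m', (p + p')%N, fun k => (q k + q' k)%N)) _) _.
  split; first exact: S0D.
    by move=> k Sk; rewrite h2 // h2'.
  rewrite -h3 -h3' mulrnDr /shift.
  under eq_bigr do rewrite mulrnDr.
  rewrite big_split opprD /= [m + m' + _]addrACA. exact: addrACA.
rewrite /=; under eq_bigr do rewrite exprD.
rewrite big_split exprD /=.
have := a_M h1 h1'.
have := mulr_ge0 (mulr_ge0 (exprn_ge0 p c0) (exprn_ge0 p' c0)) (mulr_ge0 (prod_b_ge0 q) (prod_b_ge0 q')).
move: (\prod_k _) (\prod_k _) (c ^+ p) (c ^+ p') => B B' D D' pos le_a.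
have := ler_wpM2r pos le_a.
lra.
Qed.

(** All exponents on the way from m, first along i0 and then along the - eps k, lie
in S0: along i0 every coordinate moves monotonically from m to j + shift q, and
afterwards it only decreases, down to j.  So each step costs at least the factor
by which a grows. *)
Lemma le_cost j x : S0 j -> presentation j x -> a j <= cost x.
Proof.
case: x => [[m p] q] hj [hm hq e].
have e' : m + i0 *+ p = j + shift q by rewrite -e subrK.
have hS : S0 (j + shift q) by move=> k; rewrite mxE shiftE addr_ge0 // hj.
have step1 t : (t <= p)%N -> S0 (m + i0 *+ t) /\ a (m + i0 *+ t) <= a m * c ^+ t.
  elim: t => [|t IH] tp; first by rewrite mulr0n addr0 expr0 mulr1.
  have [h1 h2] := IH (ltnW tp).
  have h3 : S0 (m + i0 *+ t.+1).
    have E u k : (m + i0 *+ u) 0 k = m 0 k + i0 0 k * u%:Z.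
      by rewrite mxE mulmxnE -mulr_natr natz.
    move=> k; have := hS k; rewrite -e' !E; have := hm k.
    case: (leP 0 (i0 0 k)) => ik mk hp; first by rewrite addr_ge0 // mulr_ge0.
    by apply: le_trans hp _; rewrite lerD2l ler_nM2l.
  split => //; rewrite mulrSr addrA.
  apply: le_trans (Csup_bound hc h1 _) _; first by move: h3; rewrite mulrSr addrA.
  rewrite exprSr mulrA [leRHS]mulrC; exact: ler_wpM2l.
have step2 k t j' : S k -> S0 j' -> a j' <= b k ^+ t * a (j' + eps k *+ t).
  move=> Sk; elim: t j' => [|t IH] j' hj'; first by rewrite mulr0n addr0 expr0 mul1r.
  have hj1 : S0 (j' + eps k) by apply: S0D => //; exact: S0_eps.
  apply: le_trans (_ : b k * a (j' + eps k) <= _).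
    have := Csup_bound (hb Sk) hj1; rewrite addrK; exact.
  rewrite exprS mulrS addrA -mulrA; apply: ler_wpM2l => //; exact: IH.
have step3 (r : seq 'I_n) j' : S0 j' ->
    a j' <= \prod_(k <- r) b k ^+ q k * a (j' + \sum_(k <- r) eps k *+ q k).
  elim: r j' => [|k r IH] j' hj'; first by rewrite !big_nil mul1r addr0.
  rewrite !big_cons; have hk : a j' <= b k ^+ q k * a (j' + eps k *+ q k).
    have [Sk|Sk] := pselect (S k); first exact: step2.
    by rewrite hq // mulr0n addr0 expr0 mul1r.
  apply: le_trans hk _; rewrite addrA -mulrA; apply: ler_wpM2l; first exact: exprn_ge0.
  apply: IH => l; rewrite mxE addr_ge0 ?hj' // mulmxnE mulrn_wge0 //; exact: S0_eps.
apply: le_trans (step3 (index_enum 'I_n) j hj) _.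
rewrite -/(shift q) -e' mulrC /=; apply: ler_wpM2r; first exact: prod_b_ge0.
by have [] := step1 p (leqnn p).
Qed.

Lemma weight_S0 j : S0 j -> weight j = a j.
Proof.
move=> hj; apply/eqP; rewrite eq_le; apply/andP; split.
  apply: le_trans (weight_le (x := (j, 0%N, fun=> 0%N)) _) _.
    split => //; rewrite mulr0n addr0 /shift big1 ?subr0 // => k _; exact: mulr0n.
  by rewrite /= expr0 mulr1 big1 ?mulr1 // => k _; rewrite expr0.
rewrite -[leRHS]mulr1; apply: weight_geM; [exact: S0_nonneg_off | exact: ler01 |].
by move=> y hy; rewrite mulr1; apply: le_cost hy.
Qed.

Lemma weight_i0 : weight i0 <= c.
Proof.
apply: le_trans (weight_le (x := (0, 1%N, fun=> 0%N)) _) _.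
  split => //; first exact: S00.
  by rewrite mulr1n add0r /shift big1 ?subr0 // => k _; exact: mulr0n.
by rewrite /= a_0 mul1r expr1 big1 ?mulr1 // => k _; rewrite expr0.
Qed.

(** The algebra with the norms weight j has norms a on S0, and the spectrum of its
generators lies in the set on the right, which is rationally convex, connected
and circled. *)
Lemma contained_in_weight (K' : set 'rV[R[i]]_n) : contained_in_hulls a K' ->
  K' `<=` mono_set (nonneg_off S) (fun j => (weight j)%:E).
Proof.
move=> hK'; have w1 : weight 0 = 1 by rewrite weight_S0 ?a_0 //; exact: S00.
have wM := weightM.
have [A [N [iota [hN iM i1 iN _]]]] := completion_ex (wseminorm weight_ge0 w1 wM).
have iX (f : mpoly.mpoly (n + n) R[i]) k : iota (f ^+ k) = iota f ^+ k.
  by elim: k => [|k IH]; rewrite ?expr0 // !exprS iM IH.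
have [] := hK' A N (fun k => iota (xvar R k)) hN.
  move=> i hi.
  have <- : N (iota (mpoly.mpolyX R[i] (laurent_mon i))) = a i.
    by rewrite iN -(weight_S0 hi); exact: (@wnorm_laurent_mon R n S weight i (S0_nonneg_off hi)).
  congr N.
  rewrite mpolyX_split [X in _ * X]big1; last first.
    by move=> k _; rewrite mk_monr; have := hi k; case: (i 0 k).
  rewrite mulr1 (big_morph iota iM i1); apply: eq_bigr => k _.
  by rewrite mk_monl iX; have := hi k; case: (i 0 k).
move=> H [_ _ Hmin] K'H; apply: subset_trans K'H _; apply: Hmin.
  apply: (@mono_set_rcc R n _ _ S) => //.
    by move=> k; split; [exact/S0_nonneg_off/S0_eps|rewrite ltry].
  by move=> k Sk; split; [exact: nonneg_off_Neps|rewrite ltry].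
move=> t [phi [phiM phi0 ->]].
by have [] := weighted_algebra_character hN iM i1 iN (conj phiM phi0).
Qed.

End Weight.

(** If Csup a i is infinite, only the condition on zero coordinates is at stake; the
exponent 0 with constant 1 then serves in place of i. *)
Lemma contained_in_Kset (K' : set 'rV[R[i]]_n) : contained_in_hulls a K' -> K' `<=` Kset a.
Proof.
move=> hK' s K's i hi.
have [b hb] : {b : 'I_n -> R & forall k, 0 <= b k /\ (S k -> (Csup a (- eps k) <= (b k)%:E)%E)}.
  apply: (@choice _ _ (fun k b => 0 <= b /\ (S k -> (Csup a (- eps k) <= b%:E)%E))) => k.
  have [Sk|Sk] := pselect (S k); last by exists 0.
  exists (fine (Csup a (- eps k))); split; first by rewrite fine_ge0 // Csup_ge0.
  by rewrite fineK.
have b0 k : 0 <= b k by have [] := hb k.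
have hb' k : S k -> (Csup a (- eps k) <= (b k)%:E)%E by have [] := hb k.
have := Csup_ge0 i; case E : (Csup a i) => [c||] // c0.
  have c0' : 0 <= c by rewrite lee_fin in c0.
  have hc : (Csup a i <= c%:E)%E by rewrite E.
  have [h1 h2] := contained_in_weight c0' b0 hc hb' hK' K's hi.
  split => //; apply: le_trans h2 _; rewrite lee_fin; exact: weight_i0.
have h0 : (Csup a 0 <= 1%:E)%E by rewrite -a_0; apply: Csup_S0; exact: S00.
have [h1 h2] := contained_in_weight ler01 b0 h0 hb' hK' K's hi.
by split => //; rewrite leey.
Qed.

End Submultiplicative.

(** * Monomial hulls of rationally convex sets *)

Definition eventually (P : nat -> Prop) := exists K, forall m, (K <= m)%N -> P m.

Lemma eventually_and P Q : eventually P -> eventually Q -> eventually (fun m => P m /\ Q m).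
Proof.
move=> [K1 h1] [K2 h2]; exists (maxn K1 K2) => m; rewrite geq_max => /andP[a b].
by split; [apply: h1|apply: h2].
Qed.

Lemma eventually_all (T : eqType) (r : seq T) (P : T -> nat -> Prop) :
  (forall x, x \in r -> eventually (P x)) -> eventually (fun m => forall x, x \in r -> P x m).
Proof.
elim: r => [|x r IH] h; first by exists 0%N.
have [|K hK] := eventually_and (h x (mem_head _ _)) (IH _).
  by move=> y yr; apply: h; rewrite inE yr orbT.
by exists K => m /hK[h1 h2] y; rewrite inE => /orP[/eqP ->|/h2].
Qed.

Lemma eventually_sub (P Q : nat -> Prop) : (forall m, P m -> Q m) -> eventually P -> eventually Q.
Proof. by move=> h [K hK]; exists K => m /hK/h. Qed.

(** For a fixed K with p (q b_K - 1) <= 1/2, b_m differs from b_K (q b_m) by at most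
p (b_m) / 2. *)
Lemma approx_inverse_bounded (R : realType) (A : comAlgType R[i]) (p : A -> R)
    (q : A) (b : nat -> A) : alg_seminorm p ->
  (forall e, 0 < e -> eventually (fun m => p (q * b m - 1) <= e)) ->
  exists2 B, 0 < B & eventually (fun m => p (b m) <= B).
Proof.
move=> hp hb; have h2 : 0 < 1 / 2 :> R by lra.
have [K hK] := hb _ h2.
exists (4 * p (b K) + 1); first by have := sn_ge0 hp (b K); lra.
exists K => m /hK hm; have h0 := hK K (leqnn K).
have e : b m = b K * (q * b m - 1) + (b K - b m * (q * b K - 1)) by ring.
have h3 := sn_D hp (b K * (q * b m - 1)) (b K - b m * (q * b K - 1)); rewrite -e in h3.
have h4 := snB hp (b K) (b m * (q * b K - 1)).
have h5 := sn_M hp (b K) (q * b m - 1).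
have h6 := sn_M hp (b m) (q * b K - 1).
have h7 : p (b K) * p (q * b m - 1) <= p (b K) * (1 / 2) by rewrite ler_wpM2l ?(sn_ge0 hp).
have h8 : p (b m) * p (q * b K - 1) <= p (b m) * (1 / 2) by rewrite ler_wpM2l ?(sn_ge0 hp).
have := sn_ge0 hp (b K); clear e; lra.
Qed.

(** b - b' = b' (q b - 1) - b (q b' - 1).  With b = b' this shows that approximate
inverses form a Cauchy sequence. *)
Lemma approx_inverse_unique (R : realType) (A : comAlgType R[i]) (p : A -> R) (q : A) (b b' : nat -> A) :
  alg_seminorm p ->
  (forall e, 0 < e -> eventually (fun m => p (q * b m - 1) <= e)) ->
  (forall e, 0 < e -> eventually (fun m => p (q * b' m - 1) <= e)) ->
  forall e, 0 < e -> exists K, forall m m', (K <= m)%N -> (K <= m')%N -> p (b m - b' m') <= e.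
Proof.
move=> hp hb hb' e e0.
have [B B0 [K1 hK1]] := approx_inverse_bounded hp hb.
have [B' B0' [K2 hK2]] := approx_inverse_bounded hp hb'.
have e1 : 0 < e / 2 / B by rewrite !divr_gt0.
have e1' : 0 < e / 2 / B' by rewrite !divr_gt0.
have [K3 hK3] := hb' _ e1; have [K4 hK4] := hb _ e1'.
exists (maxn (maxn K1 K2) (maxn K3 K4)) => m m'; rewrite !geq_max.
move=> /andP[/andP[/hK1 a1 _] /andP[_ /hK4 a4]] /andP[/andP[_ /hK2 b2] /andP[/hK3 b3 _]].
have -> : b m - b' m' = b' m' * (q * b m - 1) - b m * (q * b' m' - 1) by ring.
apply: le_trans (snB hp _ _) _; rewrite [leRHS]splitr; apply: lerD.
  apply: le_trans (sn_M hp _ _) _; move: a4; rewrite ler_pdivlMr // mulrC; apply: le_trans.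
  by rewrite ler_wpM2r ?(sn_ge0 hp).
apply: le_trans (sn_M hp _ _) _; move: b3; rewrite ler_pdivlMr // mulrC; apply: le_trans.
by rewrite ler_wpM2r ?(sn_ge0 hp).
Qed.

Section BoxWeights.
Variables (R : realType) (n : nat).
Implicit Types (l u r : 'I_n -> R) (i j : 'rV[int]_n).

(** The supremum of r^j over the box of all r with l k <= r k <= u k. *)
Definition box_weight l u j := \prod_k Num.max (u k ^ j 0 k) (l k ^ j 0 k).

Lemma exprz_le_max (l r u : R) (z : int) : 0 < l -> l <= r <= u -> r ^ z <= Num.max (u ^ z) (l ^ z).
Proof.
move=> l0 /andP[lr ru]; have r0 : 0 < r by exact: lt_le_trans lr.
have u0 : 0 < u by exact: lt_le_trans ru.
rewrite le_max; case: z => m.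
  by rewrite -!exprnP; apply/orP; left; apply: lerXn2r; rewrite ?nnegrE //; exact: ltW.
rewrite NegzE -!exprnN; apply/orP; right; rewrite lef_pV2 ?posrE ?exprn_gt0 //.
by apply: lerXn2r; rewrite ?nnegrE //; exact: ltW.
Qed.

Section Positive.
Variables (l u : 'I_n -> R).
Hypothesis l0 : forall k, 0 < l k.
Hypothesis u0 : forall k, 0 < u k.

Lemma box_weight_gt0 j : 0 < box_weight l u j.
Proof. by apply: prodr_gt0 => k _; rewrite lt_max !exprz_gt0. Qed.

Lemma box_weight0 : box_weight l u 0 = 1.
Proof. by rewrite /box_weight big1 // => k _; rewrite mxE !expr0z maxxx. Qed.

Lemma box_weightM i j : box_weight l u (i + j) <= box_weight l u i * box_weight l u j.
Proof.
rewrite /box_weight -big_split; apply: ler_prod => k _ /=.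
have ux x := exprz_ge0 x (ltW (u0 k)); have lx x := exprz_ge0 x (ltW (l0 k)).
apply/andP; split.
  by rewrite le_max exprz_ge0 // ltW.
rewrite mxE !expfzDr ?lt0r_neq0 // ge_max; apply/andP; split;
by apply: ler_pM; rewrite ?ux ?lx // le_max lexx ?orbT.
Qed.

Lemma box_weight_eps k : box_weight l u (eps k) = Num.max (u k) (l k).
Proof.
rewrite /box_weight (bigD1 k) //= mxE !eqxx !expr1z big1 ?mulr1 // => j jk.
by rewrite mxE eqxx (negPf jk) !expr0z maxxx.
Qed.

Lemma box_weightN_eps k : box_weight l u (- eps k) = Num.max (u k)^-1 (l k)^-1.
Proof.
rewrite /box_weight (bigD1 k) //= !mxE !eqxx /= !exprN1 big1 ?mulr1 // => j jk.
by rewrite !mxE eqxx (negPf jk) oppr0 !expr0z maxxx.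
Qed.

Lemma laurent_le_box r j : (forall k, l k <= r k <= u k) -> laurent r j <= box_weight l u j.
Proof.
move=> h; apply: ler_prod => k _; rewrite exprz_le_max // andbT exprz_ge0 //.
by have /andP[+ _] := h k; apply: le_trans; rewrite ltW.
Qed.

End Positive.

Lemma lnorm_seminorm (w : 'rV[int]_n -> R) : (forall j, 0 <= w j) ->
  (forall i j, w (i + j) <= w i * w j) -> alg_seminorm (@lnorm R n w).
Proof.
move=> w0 wM; split=> [f g|c f|f g]; [exact: lnormD|exact: lnormZ|].
by apply: (@lnormM R n w w0 setT).
Qed.

Lemma lnorm_mono (w w' : 'rV[int]_n -> R) f : (forall j, w j <= w' j) -> @lnorm R n w f <= lnorm w' f.
Proof. by move=> h; apply: ler_sum => j _; rewrite ler_wpM2l ?cabs_ge0. Qed.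

Lemma lnorm_sub_le (w : 'rV[int]_n -> R) (f : mpoly.mpoly (n + n) R[i]) (F : seq 'rV[int]_n) :
  (forall j, 0 <= w j) -> uniq F -> \sum_(j <- F) cabs (lcoef f j) * w j <= lnorm w f.
Proof.
move=> w0 uF; rewrite /lnorm; have uG : uniq (degs f) by exact: undup_uniq.
have hG := @lcoef_degs R n f; move: (degs f) uG hG => G uG hG.
rewrite (bigID (mem G)) /= [X in _ + X]big1 ?addr0; last first.
  move=> j jG; have -> : lcoef f j = 0 by apply/eqP; apply: contraNT jG; exact: hG.
  by rewrite cabs0 mul0r.
rewrite -big_filter (perm_big [seq j <- G | j \in F]) /=; last first.
  apply: uniq_perm; rewrite ?filter_uniq // => j.
  by rewrite !mem_filter andbC.
rewrite big_filter big_mkcond /=; apply: ler_sum => j _.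
by case: ifP => // _; rewrite mulr_ge0 ?cabs_ge0.
Qed.

Lemma restrB (S : set 'I_n) (f g : mpoly.mpoly (n + n) R[i]) : restr S (f - g) = restr S f - restr S g.
Proof. exact: linearB. Qed.

Lemma restr_xpoly (S : set 'I_n) (q : mpoly.mpoly n R[i]) : restr S (xpoly q) = xpoly q.
Proof.
rewrite /xpoly mpoly.comp_mpolyE (linear_sum (restr S)); apply: eq_bigr => m _.
rewrite (linearZ_LR (restr S)); congr (_ *: _).
etransitivity; first exact: (big_morph (restr S) (restrM S) (restr1 R S)).
apply: eq_bigr => k _.
rewrite tnth_mktuple; elim: (mpoly.fun_of_multinom m k) => [|d IH].
  by rewrite !expr0; exact: restr1.
rewrite !exprS restrM IH; congr (_ * _).
rewrite restrX; congr mpoly.mpolyX; apply: multinom_ext => l0; rewrite ?mk_monl ?mk_monr //.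
by case: asboolP => // _; rewrite mpoly.mnm1E eq_lrshift.
Qed.

End BoxWeights.

Section MonomialHull.
Variables (R : realType) (n : nat).
Implicit Types (X L : set 'rV[R[i]]_n) (s t z : 'rV[R[i]]_n) (j : 'rV[int]_n).

(** The coordinates whose inverse is analytic on X. *)
Definition nonvanishing X : set 'I_n := [set k | forall z, X z -> z 0 k != 0].

Definition monomial_sup X j : \bar R := ereal_sup [set (cabs (laurent (z 0) j))%:E | z in X].

(** The analogue of the rational hull for Laurent monomials analytic on X. *)
Definition monomial_hull X := mono_set (nonneg_off (nonvanishing X)) (monomial_sup X).

Section Gluing.
Variables (L : set 'rV[R[i]]_n) (q : mpoly.mpoly n R[i]).
Hypotheses (Lcompact : compact L) (Lconn : connected L) (Lcirc : circled L).
Hypothesis q0 : forall z, L z -> peval q z != 0.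

Lemma uniform_nonvanishing : exists2 d : R, 0 < d & forall z t, L z ->
  (forall k, cabs (z 0 k - t 0 k) <= d) -> peval q t != 0.
Proof.
have /compact_near_coveringP cL := Lcompact.
have : \forall M \near +oo, L `<=` [set z | 0 < M /\ forall t, (forall k, cabs (z 0 k - t 0 k) <= M^-1) -> peval q t != 0].
  apply: cL => z Lz.
  have qz : 0 < cabs (peval q z) by rewrite cabs_gt0; exact: q0.
  have /near_rV[d d0 hd] := peval_rvcont q z qz.
  exists ([set w : 'rV[R[i]]_n | forall k, cabs (z 0 k - w 0 k) < d / 2], [set x | 2 / d < x]) => /=.
    split; first by apply/near_rV; exists (d / 2); rewrite ?divr_gt0.
    by exists (2 / d); split => //; exact: num_real.
  move=> [w M] /= [hw hM]; have d2 : 0 < 2 / d by rewrite divr_gt0.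
  have M0 : 0 < M by exact: lt_trans hM.
  split => // t ht; rewrite -cabs_gt0.
  have Md : M^-1 < d / 2 by rewrite invf_plt ?posrE ?divr_gt0 // invf_div.
  have := hd t; have := cabsD (peval q t) (peval q z - peval q t).
  rewrite addrC subrK => h1 h2; suff : cabs (peval q z - peval q t) < cabs (peval q z) by lra.
  apply: h2 => k; have := cabs_distD (z 0 k) (w 0 k) (t 0 k).
  by have := hw k; have := ht k; clear -Md; lra.
move=> /filter_ex [M hM].
have [[z Lz]|L0] := pselect (L !=set0); last first.
  by exists 1 => // z t Lz; exfalso; apply: L0; exists z.
have [M0 _] := hM z Lz; exists M^-1; first by rewrite invr_gt0.
by move=> z' t Lz'; have [_] := hM z' Lz'; apply.
Qed.

Variable d : R.
Hypothesis d0 : 0 < d.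
Hypothesis hd : forall z t, L z -> (forall k, cabs (z 0 k - t 0 k) <= d) -> peval q t != 0.

(** Together with hi, the radii of a polyannulus around the torus of z.  At a zero
coordinate both radii are d: only nonnegative exponents occur there, for which the
supremum of r^j over r <= d is d^j. *)
Definition lo z k : R := if z 0 k == 0 then d else Num.max (cabs (z 0 k) - d) (cabs (z 0 k) / 2).
Definition hi z k : R := cabs (z 0 k) + d.
Definition nonzero_coords z : set 'I_n := [set k | z 0 k != 0].
Definition zweight z := box_weight (lo z) (hi z).

Lemma lo_gt0 z k : 0 < lo z k.
Proof.
rewrite /lo; case: eqVneq => // z0; rewrite lt_max; apply/orP; right.
by rewrite divr_gt0 // cabs_gt0.
Qed.

Lemma hi_gt0 z k : 0 < hi z k.
Proof. by rewrite /hi ltr_wpDl ?cabs_ge0. Qed.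

Lemma lo_le z k : lo z k <= cabs (z 0 k) + (if z 0 k == 0 then d else 0).
Proof.
rewrite /lo; case: eqVneq => [->|z0]; first by rewrite cabs0 add0r.
rewrite addr0 ge_max; have h := cabs_ge0 (z 0 k); have h' := d0; apply/andP; split; lra.
Qed.

Lemma lo_le_hi z k : lo z k <= hi z k.
Proof. by apply: le_trans (lo_le z k) _; rewrite /hi lerD2l; case: ifP => // _; exact: ltW. Qed.

Lemma zweight_gt0 z j : 0 < zweight z j.
Proof. by apply: box_weight_gt0 => k; [exact: lo_gt0|exact: hi_gt0]. Qed.

Lemma zweight_ge0 z j : 0 <= zweight z j. Proof. by rewrite ltW // zweight_gt0. Qed.

Lemma zweightM z i j : zweight z (i + j) <= zweight z i * zweight z j.
Proof. by apply: box_weightM => k; [exact: lo_gt0|exact: hi_gt0]. Qed.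

Lemma zweight0 z : zweight z 0 = 1. Proof. exact: box_weight0. Qed.

Definition zweight_seminorm z := lnorm_seminorm (zweight_ge0 z) (zweightM z).

(** Changing the moduli of t to those of z moves t by at most d and, as L is
circled, leads into L. *)
Lemma zweight_polyannulus z t : L z ->
  mono_set (nonneg_off (nonzero_coords z)) (fun j => (zweight z j)%:E) t -> peval q t != 0.
Proof.
move=> Lz ht.
have up k : cabs (t 0 k) <= hi z k.
  have [|_] := ht (eps k); first exact/S0_nonneg_off/S0_eps.
  rewrite -/(laurent _ _) laurent_eps lee_fin /zweight box_weight_eps.
  by rewrite max_l // lo_le_hi.
have dn k : z 0 k != 0 -> t 0 k != 0 /\ lo z k <= cabs (t 0 k).
  move=> zk; have [|h1] := ht (- eps k); first exact: nonneg_off_Neps.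
  have tk : t 0 k != 0 by apply: h1; rewrite !mxE !eqxx.
  rewrite -/(laurent _ _) laurentN laurent_eps lee_fin /zweight box_weightN_eps cabsV.
  rewrite max_r; last by rewrite lef_pV2 ?posrE ?lo_gt0 ?hi_gt0 // lo_le_hi.
  by rewrite lef_pV2 ?posrE ?lo_gt0 ?cabs_gt0.
(* c z has the moduli of z and the arguments of t. *)
pose c : 'rV[R[i]]_n := \row_k (if z 0 k == 0 then 1 else
   (t 0 k / (cabs (t 0 k))%:C%C) / (z 0 k / (cabs (z 0 k))%:C%C)).
have Lt : L (\row_k (c 0 k * z 0 k)).
  apply: Lcirc => // k; apply/cabs_norm1; rewrite mxE; case: eqVneq => [_|zk].
    exact: cabs1.
  have [tk _] := dn k zk; have tk' : cabs (t 0 k) != 0 by rewrite cabs_eq0.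
  have zk' : cabs (z 0 k) != 0 by rewrite cabs_eq0.
  rewrite !cabsM !cabsV !cabsM !cabsV !cabs_real !ger0_norm ?cabs_ge0 //.
  by rewrite !divff // invr1 mulr1.
apply: hd Lt _ => k; rewrite !mxE; case: eqVneq => [e|zk].
  by rewrite mul1r e sub0r cabsN; have := up k; rewrite /hi e cabs0 add0r.
have [tk lk] := dn k zk; have uk := up k.
have tk' : (cabs (t 0 k))%:C%C != 0 :> R[i] by rewrite (inj_eq (@complexI R)) cabs_eq0.
have -> : t 0 k / (cabs (t 0 k))%:C%C / (z 0 k / (cabs (z 0 k))%:C%C) * z 0 k - t 0 k =
   t 0 k / (cabs (t 0 k))%:C%C * (cabs (z 0 k) - cabs (t 0 k))%:C%C.
  rewrite invf_div -[LHS]/(_ * (_ / _) * _ - _) -!mulrA [_^-1 * z 0 k]mulVf // mulr1 rmorphB.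
  by rewrite mulrBr mulrBr mulVf // mulr1.
rewrite cabsM cabsM cabsV !cabs_real [`|cabs _|]ger0_norm ?cabs_ge0 // divff ?cabs_eq0 // mul1r.
have lo1 : cabs (z 0 k) - d <= lo z k by rewrite /lo (negPf zk) le_max lexx.
by rewrite ler_norml; move: uk; rewrite /hi => uk; apply/andP; split; lra.
Qed.

Lemma local_inverse z : L z -> exists b : nat -> mpoly.mpoly (n + n) R[i],
  (forall m, supported (b m) (nonneg_off (nonzero_coords z))) /\
  forall e, 0 < e -> eventually (fun m => lnorm (zweight z) (xpoly q * b m - 1) <= e).
Proof.
move=> Lz.
have h := approx_inverse (zweight_ge0 z) (zweight0 z) (fun i j _ _ => zweightM z i j)
  (fun t => @zweight_polyannulus z t Lz).
have [b hb] : {b : nat -> mpoly.mpoly (n + n) R[i] & forall m,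
    wnorm (nonzero_coords z) (zweight z) (xpoly q * b m - 1) <= m.+1%:R^-1}.
  apply: (@choice _ _ (fun m f => wnorm (nonzero_coords z) (zweight z) (xpoly q * f - 1) <= m.+1%:R^-1)) => m.
  by apply: h; rewrite invr_gt0.
exists (fun m => restr (nonzero_coords z) (b m)); split; first by move=> m; exact: restr_supported.
move=> e e0; have e1 : 0 <= e^-1 by rewrite invr_ge0 ltW.
exists (Num.bound e^-1) => m hm; have := hb m; rewrite /wnorm restrB restrM restr1 restr_xpoly.
move=> h1; apply: le_trans h1 _; rewrite -[leRHS]invrK lef_pV2 ?posrE ?invr_gt0 //.
apply: ltW; apply: lt_le_trans (archi_boundP e1) _; rewrite ler_nat.
by apply: leq_trans hm _.
Qed.

(** Approximate inverses of q near each point of L, as Laurent polynomials. *)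
Definition germ := 'rV[R[i]]_n -> nat -> mpoly.mpoly (n + n) R[i].

Section Germ.
Variable b : germ.
Hypothesis b_supp : forall z m, L z -> supported (b z m) (nonneg_off (nonzero_coords z)).
Hypothesis b_inv : forall z, L z -> forall e, 0 < e ->
  eventually (fun m => lnorm (zweight z) (xpoly q * b z m - 1) <= e).

(** In the limit both approximate inverses have the same Laurent coefficients. *)
Definition same_germ z z' := forall j e, 0 < e ->
  eventually (fun m => cabs (lcoef (b z m) j - lcoef (b z' m) j) <= e).

Lemma same_germ_sym z z' : same_germ z z' -> same_germ z' z.
Proof. by move=> h j e /(h j); apply: eventually_sub => m; rewrite cabsB. Qed.

Lemma same_germ_trans z' z z'' : same_germ z z' -> same_germ z' z'' -> same_germ z z''.
Proof.
move=> h1 h2 j e e0; have e2 : 0 < e / 2 by lra.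
apply: eventually_sub (eventually_and (h1 j _ e2) (h2 j _ e2)) => m [a1 a2].
have := cabs_distD (lcoef (b z m) j) (lcoef (b z' m) j) (lcoef (b z'' m) j); lra.
Qed.

(** A neighbourhood of z whose points have polyannuli sharing a torus with that of z. *)
Definition nearby z : set 'rV[R[i]]_n := [set z' | forall k,
  `|cabs (z' 0 k) - cabs (z 0 k)| < d /\ (z 0 k != 0 -> cabs (z 0 k) / 2 < cabs (z' 0 k))].

Lemma nearby_nbhs z : \forall z' \near z, nearby z z'.
Proof.
near=> z' => k.
have h1 : cabs (z 0 k - z' 0 k) < d.
  by move: k; near: z'; apply/near_rV; exists d.
have h2 : z 0 k != 0 -> cabs (z 0 k - z' 0 k) < cabs (z 0 k) / 2.
  move=> zk; move: k zk {h1}; near: z'; apply: filter_forall => k.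
  have [zk|zk] := eqVneq (z 0 k) 0; first exact: nearW.
  apply/near_rV; exists (cabs (z 0 k) / 2); first by rewrite divr_gt0 // cabs_gt0.
  by move=> w hw _; apply: hw.
split=> [|/h2 h3].
  by apply: le_lt_trans h1; rewrite cabsB; exact: ler_cabs_dist.
have := ler_cabs_dist (z 0 k) (z' 0 k); rewrite ler_norml => /andP[_ h4]; lra.
Unshelve. all: by end_near. Qed.

(** Both approximate inverses are approximate inverses in the norm of the common
torus of radius r. *)
Lemma nearby_same_germ z z' : L z -> L z' -> nearby z z' -> same_germ z z'.
Proof.
move=> Lz Lz' zz' j e e0.
(* Radii of a torus in both polyannuli; where z_k = 0, that of z has radius d. *)
pose r k := if z 0 k == 0 then d else cabs (z' 0 k).
have r0 k : 0 < r k.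
  rewrite /r; case: eqVneq => // zk; have [_ /(_ zk)] := zz' k.
  by apply: le_lt_trans; rewrite divr_ge0 // cabs_ge0.
have rz k : lo z k <= r k <= hi z k.
  rewrite /r /lo /hi; have := zz' k; case: eqVneq => [->|zk] [h1 h2].
    by rewrite cabs0 add0r lexx.
  move: h1; rewrite ltr_norml ge_max => /andP[h1 h1']; have h3 := h2 isT.
  by apply/andP; split; [apply/andP; split|]; lra.
have rz' k : lo z' k <= r k <= hi z' k.
  rewrite /r /lo /hi; have := zz' k; case: (eqVneq (z 0 k) 0) => [->|zk] [h1 h2].
    move: h1; rewrite cabs0 subr0 ltr_norml => /andP[_ h1].
    have := cabs_ge0 (z' 0 k); have := d0; case: eqVneq => _ a1 a2; first by apply/andP; split; lra.
    by rewrite ge_max; apply/andP; split; [apply/andP; split|]; lra.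
  have := h2 isT; have := d0; have := cabs_ge0 (z 0 k).
  case: (eqVneq (z' 0 k) 0) => [->|zk'] a1 a2 a3; first by move: a3; rewrite cabs0; lra.
  by rewrite ge_max; apply/andP; split; [apply/andP; split|]; lra.
pose w := box_weight r r.
have w0 i : 0 < w i by exact: box_weight_gt0.
have wM i i' : w (i + i') <= w i * w i' by exact: box_weightM.
have wsn := lnorm_seminorm (fun i => ltW (w0 i)) wM.
have wE i : w i = laurent r i by apply: eq_bigr => k _; rewrite maxxx.
have wz i : w i <= zweight z i.
  by rewrite wE; apply: laurent_le_box => // k; exact: lo_gt0.
have wz' i : w i <= zweight z' i.
  by rewrite wE; apply: laurent_le_box => // k; exact: lo_gt0.
have inv1 e1 : 0 < e1 -> eventually (fun m => lnorm w (xpoly q * b z m - 1) <= e1).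
  by move=> /(b_inv Lz); apply: eventually_sub => m; apply: le_trans; exact: lnorm_mono.
have inv2 e1 : 0 < e1 -> eventually (fun m => lnorm w (xpoly q * b z' m - 1) <= e1).
  by move=> /(b_inv Lz'); apply: eventually_sub => m; apply: le_trans; exact: lnorm_mono.
have ew : 0 < e * w j by rewrite mulr_gt0.
have [K hK] := approx_inverse_unique wsn inv1 inv2 ew.
exists K => m Km; rewrite -(ler_pM2r (w0 j)); apply: le_trans (hK m m Km Km).
by rewrite -lcoefB; apply: lcoef_le => i; exact: ltW.
Qed.

Lemma all_same_germ z z' : L z -> L z' -> same_germ z z'.
Proof.
move=> Lz Lz'; pose E := [set y | L y /\ same_germ z y].
suff : E = L by move=> e; have [] : E z' by rewrite e.
have self y : (nearby y)^° y by exact: nearby_nbhs.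
have sub y : (nearby y)^° `<=` nearby y by exact: interior_subset.
apply: Lconn.
- exists z; split => // j e e0; exists 0%N => m _; rewrite subrr cabs0; exact: ltW.
- exists (\bigcup_(y in E) (nearby y)^°).
    by apply: bigcup_open => y _; exact: open_interior.
  apply/seteqP; split => y.
    by move=> Ey; split; [case: Ey|exists y].
  move=> [Ly [x [Lx zx] /sub xy]]; split => //.
  by apply: same_germ_trans zx _; exact: nearby_same_germ.
- exists (~` (\bigcup_(y in L `\` E) (nearby y)^°)).
    by apply: open_closedC; apply: bigcup_open => y _; exact: open_interior.
  apply/seteqP; split => y.
    move=> [Ly zy]; split => // -[x [Lx nEx] /sub xy]; apply: nEx; split => //.
    by apply: same_germ_trans zy _; apply: same_germ_sym; exact: nearby_same_germ.
  move=> [Ly ny]; apply: contrapT => nEy; apply: ny; exists y => //.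
Qed.

Lemma nearby_cover : exists r : seq 'rV[R[i]]_n,
  (forall z, z \in r -> L z) /\ forall z', L z' -> exists2 z, z \in r & nearby z z'.
Proof.
have := Lcompact; rewrite compact_cover => /(_ _ L (fun z => (nearby z)^°)) [].
- by move=> z _; exact: open_interior.
- by move=> z Lz; exists z => //; exact: nearby_nbhs.
move=> D DL cD; exists (finmap.enum_fset D); split=> [z zD|z' /cD[z zD hz]].
  by have := DL z zD; rewrite inE.
by exists z => //; exact: interior_subset hz.
Qed.

(** At a coordinate where z vanishes, j is nonnegative and hi z bounds the modulus. *)
Lemma nearby_laurent_le z z' j : L z -> nonneg_off (nonvanishing L) j -> nearby z z' ->
  cabs (laurent (z' 0) j) <= zweight z j.
Proof.
move=> Lz hj zz'; rewrite cabs_laurent; apply: ler_prod => k _.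
rewrite exprz_ge0 ?cabs_ge0 //=; have [h1 h2] := zz' k.
have up : cabs (z' 0 k) <= hi z k.
  by move: h1; rewrite /hi ltr_norml => /andP[_ h1]; lra.
have [zk|zk] := eqVneq (z 0 k) 0.
  have : 0 <= j 0 k by apply: hj => /(_ z Lz); rewrite zk eqxx.
  rewrite le_max; case: (j 0 k) => // m _; apply/orP; left.
  by rewrite -!exprnP; apply: lerXn2r; rewrite ?nnegrE ?cabs_ge0 // ltW // hi_gt0.
apply: exprz_le_max; first exact: lo_gt0.
rewrite up andbT /lo (negPf zk) ge_max; move: h1; rewrite ltr_norml => /andP[h1 _].
by have := h2 zk => h3; apply/andP; split; lra.
Qed.

(** The common coefficients, with those removed that belong to monomials not
analytic on L; by glued_coef these tend to 0. *)
Definition glued z0 m j : R[i] :=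
  if `[< nonneg_off (nonvanishing L) j >] then lcoef (b z0 m) j else 0.

(** If z^j is not analytic on L, some point y of L has a zero coordinate with
negative exponent in j; the approximate inverses at y have no such coefficient. *)
Lemma glued_coef z0 z j e : L z0 -> L z -> 0 < e ->
  eventually (fun m => cabs (glued z0 m j - lcoef (b z m) j) <= e).
Proof.
move=> Lz0 Lz e0; rewrite /glued; case: asboolP => hj; first exact: all_same_germ.
have [y Ly yj] : exists2 y, L y & ~ nonneg_off (nonzero_coords y) j.
  apply: contrapT => nex; apply: hj => k nk; apply: contrapT => jk; apply: nk => y Ly.
  apply/negP => yk; apply: nex; exists y => // hy; apply: jk; apply: hy.
  by rewrite /nonzero_coords /= yk.
apply: eventually_sub (all_same_germ Ly Lz j e0) => m.
have -> // : lcoef (b y m) j = 0.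
apply/eqP; apply: contrapT => /negP /lcoef_degs; rewrite mem_undup => /mapP[mm].
by rewrite mpoly.mcoeff_msupp => /(b_supp Ly) hmm e1; apply: yj; rewrite e1.
Qed.

Definition glue z0 m (F : seq 'rV[int]_n) : mpoly.mpoly (n + n) R[i] :=
  \sum_(j <- F) glued z0 m j *: mpoly.mpolyX R[i] (laurent_mon j).

Lemma lcoef_glue z0 m F j : uniq F -> lcoef (glue z0 m F) j = if j \in F then glued z0 m j else 0.
Proof.
move=> uF; rewrite /glue /lcoef linear_sum /=.
under eq_bigr do rewrite linearZ /= -/(lcoef _ _) lcoefX deg_laurent_mon.
have [jF|jF] := boolP (j \in F).
  rewrite (bigD1_seq j) //= eqxx [_ *: _]mulr1 big1 ?addr0 // => i ij.
  by rewrite (negPf ij) [_ *: _]mulr0.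
rewrite big1_seq // => i /andP[_ iF]; case: eqVneq => [e|_]; last exact: mulr0.
by rewrite -e iF in jF.
Qed.

Lemma restr_glue z0 m F : restr (nonvanishing L) (glue z0 m F) = glue z0 m F.
Proof.
rewrite /glue (linear_sum (restr _)); apply: eq_bigr => j _.
rewrite /glued; case: asboolP => hj; last by rewrite scale0r; exact: linear0.
by rewrite -[in RHS](restr_laurent_mon _ hj); exact: linearZ_LR.
Qed.

(** Truncate to the support F of the K-th approximate inverses at the points of r.
The truncation of the m-th one differs from the K-th one by no more than the
two approximate inverses themselves, and on the finite set F the glued
coefficients are close to those of each of them for large m. *)
Lemma glue_approx z0 (r : seq 'rV[R[i]]_n) e : L z0 -> (forall z, z \in r -> L z) -> 0 < e ->
  exists f, restr (nonvanishing L) f = f /\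
    forall z, z \in r -> lnorm (zweight z) (xpoly q * f - 1) <= e.
Proof.
move=> Lz0 Lr e0.
pose Q z := lnorm (zweight z) (xpoly q) + 1.
have Q0 z : 0 < Q z.
  by have := sn_ge0 (zweight_seminorm z) (xpoly q); rewrite /Q; lra.
pose eta z := e / 3 / Q z.
have eta0 z : 0 < eta z by rewrite !divr_gt0.
have e3 : 0 < e / 3 by rewrite divr_gt0.
have [K hK] : eventually (fun K => forall z, z \in r ->
    lnorm (zweight z) (xpoly q * b z K - 1) <= e / 3 /\
    forall m, (K <= m)%N -> lnorm (zweight z) (b z m - b z K) <= eta z).
  apply: eventually_all => z zr; apply: eventually_and; first exact: b_inv (Lr z zr) _ e3.
  have [K hK] := approx_inverse_unique (zweight_seminorm z) (b_inv (Lr z zr)) (b_inv (Lr z zr)) (eta0 z).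
  exists K => m Km m' mm'; apply: hK => //; exact: leq_trans mm'.
have {}hK := hK K (leqnn K).
pose F := undup (flatten [seq degs (b z K) | z <- r]).
have uF : uniq F by exact: undup_uniq.
have degsF z j : z \in r -> lcoef (b z K) j != 0 -> j \in F.
  move=> zr /lcoef_degs h; rewrite mem_undup; apply/flattenP.
  by exists (degs (b z K)) => //; apply/mapP; exists z.
move: F uF degsF => F uF degsF.
pose N := (size F).+1%:R : R.
have N0 : 0 < N by rewrite ltr0n.
have [M hM] : eventually (fun m => forall z, z \in r -> forall j, j \in F ->
    cabs (glued z0 m j - lcoef (b z m) j) <= eta z / N / zweight z j).
  apply: eventually_all => z zr; apply: eventually_all => j jF.
  by apply: glued_coef => //; [exact: Lr|rewrite !divr_gt0 // zweight_gt0].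
pose m := maxn K M; exists (glue z0 m F); split; first exact: restr_glue.
move=> z zr; have [h1 h2] := hK z zr; have {}h2 := h2 m (leq_maxl _ _).
have {}hM := hM m (leq_maxr _ _) z zr.
have h3 : lnorm (zweight z) (glue z0 m F - b z K) <= 2 * eta z.
  rewrite (@lnormE _ _ _ _ F) //; last first.
    move=> j; rewrite lcoefB lcoef_glue //; case: ifP => // jF; rewrite sub0r oppr_eq0.
    by move=> /(degsF z j zr); rewrite jF.
  apply: le_trans (_ : \sum_(j <- F) (eta z / N + cabs (lcoef (b z m - b z K) j) * zweight z j) <= _).
    rewrite big_seq [leRHS]big_seq; apply: ler_sum => j jF.
    rewrite lcoefB lcoef_glue // jF lcoefB.
    have h := cabs_distD (glued z0 m j) (lcoef (b z m) j) (lcoef (b z K) j).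
    apply: le_trans (ler_wpM2r (zweight_ge0 z j) h) _.
    rewrite mulrDl lerD2r.
    by have := hM j jF; rewrite ler_pdivlMr // zweight_gt0.
  rewrite big_split /=.
  have -> : 2 * eta z = eta z + eta z by ring.
  apply: lerD.
    rewrite big_const_seq count_predT iter_addr addr0 -mulr_natr -mulrA ger_pMr //.
    by rewrite mulrC ler_pdivrMr // mul1r /N ler_nat.
  by apply: le_trans h2; apply: lnorm_sub_le => // i; exact: zweight_ge0.
have e4 : xpoly q * glue z0 m F - 1 = xpoly q * (glue z0 m F - b z K) + (xpoly q * b z K - 1) by ring.
rewrite e4; apply: le_trans (sn_D (zweight_seminorm z) _ _) _.
have h5 := sn_M (zweight_seminorm z) (xpoly q) (glue z0 m F - b z K).
have h6 : lnorm (zweight z) (xpoly q) * lnorm (zweight z) (glue z0 m F - b z K) <= Q z * (2 * eta z).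
  apply: ler_pM => //; try exact: sn_ge0 (zweight_seminorm z) _.
  by rewrite /Q lerDl.
have h7 : Q z * (2 * eta z) = 2 * (e / 3).
  by rewrite /eta; field; rewrite lt0r_neq0.
rewrite h7 in h6; clear -h1 h5 h6; lra.
Qed.

(** If q vanishes at s, then q f - 1 has the value -1 there; but on the monomial hull
the modulus of a Laurent polynomial is at most the sum of its norms over the
polyannuli that cover L. *)
Lemma glued_hull_peval_neq0 s : monomial_hull L s -> peval q s != 0.
Proof.
move=> hs; apply/eqP => qs.
have [[z0 Lz0]|L0] := pselect (L !=set0); last first.
  have [|_] := hs 0; first by move=> k _; rewrite mxE.
  rewrite -/(laurent _ _) laurent0 cabs1 /monomial_sup.
  have -> : L = set0 by rewrite -subset0 => z Lz; apply: L0; exists z.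
  by rewrite image_set0 ereal_sup0 leeNy_eq.
have [r [Lr cr]] := nearby_cover.
pose N := (size r).+1%:R : R; have N0 : 0 < N by rewrite ltr0n.
have [|f [rf hf]] := @glue_approx z0 r (1 / (2 * N)) Lz0 Lr; first by rewrite divr_gt0 // mulr_gt0.
pose h := xpoly q * f - 1.
have rh : restr (nonvanishing L) h = h by rewrite /h restrB restrM restr1 restr_xpoly rf.
have s0 k : nonvanishing L k -> s 0 k != 0.
  move=> Sk; have [|h1 _] := hs (- eps k); last by apply: h1; rewrite !mxE !eqxx.
  exact: nonneg_off_Neps.
have ev : cabs (pairing (laurent (s 0) \o deg) h) = 1.
  rewrite -rh -leval_restr // rh /h.
  have -> : leval (s 0) (fun k => (s 0 k)^-1) (xpoly q * f - 1) =
     leval (s 0) (fun k => (s 0 k)^-1) (xpoly q * f) - leval (s 0) (fun k => (s 0 k)^-1) 1.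
    exact: linearB.
  by rewrite levalM leval1 leval_xpoly -[mpoly.meval _ _]/(peval q s) qs mul0r sub0r cabsN cabs1.
pose W j := \sum_(z <- r) zweight z j.
have W0 j : 0 <= W j by apply: sumr_ge0 => z _; exact: zweight_ge0.
have le1 : 1 <= lnorm W h.
  rewrite -ev; apply: pairing_le => j hj.
  have jS : nonneg_off (nonvanishing L) j.
    move: hj => /lcoef_degs; rewrite mem_undup => /mapP[mm]; rewrite mpoly.mcoeff_msupp -rh.
    by move=> /restr_supported hm ->.
  rewrite -lee_fin; have [_ hsj] := hs j jS; apply: le_trans hsj _.
  apply: ge_ereal_sup => _ [z' Lz' <-]; rewrite lee_fin; have [z zr zz'] := cr z' Lz'.
  apply: le_trans (nearby_laurent_le (Lr z zr) jS zz') _.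
  rewrite /W (big_rem z) //= lerDl; apply: sumr_ge0 => y _; exact: zweight_ge0.
have le2 : lnorm W h = \sum_(z <- r) lnorm (zweight z) h.
  rewrite /lnorm exchange_big; apply: eq_bigr => j _; by rewrite /W mulr_sumr.
have le3 : \sum_(z <- r) lnorm (zweight z) h <= 1 / 2.
  apply: le_trans (_ : \sum_(z <- r) 1 / (2 * N) <= _).
    by rewrite big_seq [leRHS]big_seq; apply: ler_sum => z zr; exact: hf.
  rewrite big_const_seq count_predT iter_addr addr0 -[leLHS]mulr_natr.
  have -> : 1 / 2 = 1 / (2 * N) * N by field; rewrite lt0r_neq0.
  by rewrite ler_wpM2l ?divr_ge0 ?mulr_ge0 ?ltW // /N ltr_nat.
by rewrite le2 in le1; have := le_trans le1 le3; rewrite ler_pdivlMr // mul1r lern1.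
Qed.

End Germ.
End Gluing.

Lemma monomial_hull_peval L (q : mpoly.mpoly n R[i]) s : compact L -> connected L -> circled L ->
  (forall z, L z -> peval q z != 0) -> monomial_hull L s -> peval q s != 0.
Proof.
move=> cL connL circL q0 hs.
have [d d0 hd] := uniform_nonvanishing cL q0.
have [b hb] : {b : 'rV[R[i]]_n -> nat -> mpoly.mpoly (n + n) R[i] & forall z, L z ->
    (forall m, supported (b z m) (nonneg_off (nonzero_coords z))) /\
    forall e, 0 < e -> eventually (fun m => lnorm (zweight d z) (xpoly q * b z m - 1) <= e)}.
  apply: (@choice _ _ (fun z b => L z -> (forall m, supported (b m) (nonneg_off (nonzero_coords z))) /\
    forall e, 0 < e -> eventually (fun m => lnorm (zweight d z) (xpoly q * b m - 1) <= e))) => z.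
  have [Lz|nL] := pselect (L z); last by exists (fun=> 0).
  by have [b hb] := local_inverse circL d0 hd Lz; exists b.
apply: (glued_hull_peval_neq0 cL connL d0 (b := b)) hs.
  by move=> z m /hb[].
by move=> z /hb[].
Qed.

(** If c = p s / q s had modulus larger than the supremum of |p / q| over L, then
p - c q would vanish at s but not on L. *)
Lemma monomial_hull_sub L : rat_convex_connected_circled L -> monomial_hull L `<=` L.
Proof.
move=> [[cL LE] connL circL] s hs; rewrite LE => p q q0; split.
  exact: monomial_hull_peval hs.
rewrite leNgt; apply/negP => h.
pose c := peval p s / peval q s.
have qs : peval q s != 0 by exact: monomial_hull_peval hs.
pose p' := p - c *: q.
have p'E z : peval p' z = peval p z - c * peval q z.
  by rewrite /peval /p' mpoly.mevalB mpoly.mevalZ.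
have : peval p' s != 0.
  apply: (@monomial_hull_peval L) hs => // z Lz; rewrite p'E subr_eq0; apply/eqP => e.
  have e' : peval p z / peval q z = c by rewrite e mulfK // q0.
  move: h; rewrite ltNge => /negP; apply; apply: ereal_sup_ubound; exists z => //.
  by rewrite e'.
by rewrite p'E /c divfK // subrr eqxx.
Qed.

Lemma monomial_hull_mono X L : X `<=` L -> monomial_hull X `<=` monomial_hull L.
Proof.
move=> XL s hs j hj; have [|h1 h2] := hs j.
  by move=> k nk; apply: hj => h; apply: nk => z /XL; apply: h.
split => //; apply: le_trans h2 _; apply: ge_ereal_sup => _ [z Xz <-].
by apply: ereal_sup_ubound; exists z => //; exact: XL.
Qed.

Lemma sub_monomial_hull X : X `<=` monomial_hull X.
Proof.
move=> s Xs j hj; split=> [k jk|].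
  apply: contrapT => /negP/negPn sk; have : 0 <= j 0 k.
    by apply: hj => /(_ s Xs); rewrite sk.
  by rewrite leNgt jk.
by apply: ereal_sup_ubound; exists s.
Qed.

End MonomialHull.

(** * Joint spectra and the main theorem *)

Section SpectrumHull.
Variables (R : realType) (n : nat) (a : 'rV[int]_n -> R).
Hypothesis a_ge0 : forall i, S0 i -> 0 <= a i.
Variables (A : comAlgType R[i]) (N : A -> R) (x : 'I_n -> A).
Hypothesis hN : banach_norm N.
Hypothesis hx : forall i, S0 i -> N (\prod_k x k ^+ absz (i 0 k)) = a i.
Let sN := banach_seminorm hN.
Local Notation X := (joint_spectrum x).
Local Notation T := (nonvanishing X).
Implicit Types (i j m : 'rV[int]_n).

Lemma joint_spectrum_char (phi : {linear A -> R[i]^o}) : character phi -> X (\row_k phi (x k)).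
Proof. by move=> [hM h0]; exists phi. Qed.

Lemma nonvanishing_inv : exists h : 'I_n -> A, forall k, T k -> x k * h k = 1.
Proof.
have [h hh] : {h : 'I_n -> A & forall k, T k -> x k * h k = 1}.
  apply: (@choice _ _ (fun k h => T k -> x k * h = 1)) => k.
  have [Tk|nT] := pselect (T k); last by exists 0.
  have [phi /joint_spectrum_char hphi|h hh] := invertible_char hN (y := x k); last by exists h.
  by have := Tk _ hphi; rewrite mxE.
by exists h.
Qed.

Variable h : 'I_n -> A.
Hypothesis hh : forall k, T k -> x k * h k = 1.

(** The element x^j, with h k for the inverse of x k. *)
Definition laurent_elt j : A := \prod_k (x k ^+ posn (j 0 k) * h k ^+ negn (j 0 k)).

Lemma character_laurent_elt (phi : {linear A -> R[i]^o}) j : character phi -> nonneg_off T j ->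
  phi (laurent_elt j) = laurent (fun k => phi (x k)) j.
Proof.
move=> hphi hj; have [hM _] := hphi; have phi1 := character1 hphi.
have pX y d : phi (y ^+ d) = phi y ^+ d.
  by elim: d => [|d IH]; rewrite ?expr0 // !exprS hM IH.
rewrite /laurent_elt (big_morph phi hM phi1); apply: eq_bigr => k _.
rewrite hM !pX exprz_split; congr (_ * _).
have [Tk|nT] := pselect (T k); last first.
  by have := hj k nT; case: (j 0 k) => // d _; rewrite !expr0 invr1.
have e : phi (x k) * phi (h k) = 1 by rewrite -hM hh.
have p0 : phi (x k) != 0 by apply: contra_eq_neq e => ->; rewrite mul0r eq_sym oner_neq0.
by rewrite -exprVn; congr (_ ^+ _); apply: (mulfI p0); rewrite e divff.
Qed.

Lemma laurent_elt_shift j m t : nonneg_off T j -> S0 m -> S0 (m + j *+ t) ->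
  \prod_k x k ^+ absz ((m + j *+ t) 0 k) = laurent_elt j ^+ t * \prod_k x k ^+ absz (m 0 k).
Proof.
move=> hj hm hmj; rewrite /laurent_elt -prodrXl -big_split; apply: eq_bigr => k _ /=.
have := hm k; have := hmj k; rewrite mxE mulmxnE -mulr_natr natz.
have := hj k; case: (m 0 k) => // c; case: (j 0 k) => d hjk /=.
  by move=> _ _; rewrite expr0 mulr1 -exprM -exprD addnC.
have Tk : T k by apply: contrapT => /hjk.
rewrite expr0 mul1r -exprM NegzE => h1 _.
have h2 : (d.+1 * t <= c)%N.
  by move: h1; rewrite mulNr -PoszM subr_ge0 lez_nat.
rewrite mulNr -PoszM subzn // absz_nat -{2}(subnKC h2) exprD mulrA -exprMn [h k * _]mulrC.
by rewrite hh // expr1n mul1r.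
Qed.

(** The set over which the supremum is taken is not empty: x^m is invertible for the
negative part m of j, so its norm a m is not 0. *)
Lemma Csup_le_laurent_elt j t : nonneg_off T j -> (Csup a (j *+ t) <= (N (laurent_elt j ^+ t))%:E)%E.
Proof.
move=> hj; apply: Csup_le => // [m hm hmj|].
  rewrite -(hx hm) -(hx hmj) laurent_elt_shift //; exact: sn_M sN _ _.
pose m : 'rV[int]_n := \row_k (muln (negn (j 0 k)) t)%:Z.
have hm : S0 m by move=> k; rewrite mxE.
have hmj : S0 (m + j *+ t).
  move=> k; rewrite !mxE mulmxnE -mulr_natr natz; case: (j 0 k) => d //=.
  by rewrite NegzE PoszM mulNr subrr.
exists m; split => // -[am _].
have : \prod_k x k ^+ absz (m 0 k) = 0 by apply: (banach_norm0_eq0 hN); rewrite hx.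
move=> e; have : (\prod_k x k ^+ absz (m 0 k)) * (\prod_k h k ^+ absz (m 0 k)) = 1.
  rewrite -big_split big1 // => k _ /=; rewrite -exprMn mxE /=.
  have [Tk|nT] := pselect (T k); first by rewrite hh // expr1n.
  by have := hj k nT; case: (j 0 k).
by rewrite e mul0r => /eqP; rewrite eq_sym oner_eq0.
Qed.

Lemma nonvanishing_Sset k : T k -> Sset a k.
Proof.
move=> Tk; rewrite /Sset /= ge0_fin_numE; last exact: Csup_ge0.
have := Csup_le_laurent_elt 1 (nonneg_off_Neps Tk); rewrite mulr1n => h1.
by apply: le_lt_trans h1 _; rewrite ltry.
Qed.

Lemma nonneg_off_Mset j : nonneg_off T j -> Mset a j.
Proof. by move=> hj k nS; apply: hj => /nonvanishing_Sset. Qed.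

Lemma laurentX (u : 'I_n -> R[i]) j t : laurent u (j *+ t) = laurent u j ^+ t.
Proof.
rewrite /laurent -prodrXl; apply: eq_bigr => k _.
by rewrite mulmxnE -mulr_natr natz -exprz_exp.
Qed.

(** If |s^j| exceeded the supremum over the spectrum, a number rho in between would
bound the powers of x^j by B rho^t, hence also |s^j|^t <= Csup a (t j). *)
Lemma Kset_sub_hull : Kset a `<=` monomial_hull X.
Proof.
move=> s hs j hj; have Mj := nonneg_off_Mset hj.
have [h1 _] := hs j Mj; split => //; rewrite -/(laurent _ _) leNgt; apply/negP => hlt.
(* A character exists, so the supremum is a nonnegative number. *)
have [phi0 hphi0 _] : exists2 phi, character phi & phi (0 : A) = 0.
  by apply: (character_ex hN) => y; rewrite mul0r eq_sym oner_neq0.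
have sup_le phi : character phi -> ((cabs (phi (laurent_elt j)))%:E <= monomial_sup X j)%E.
  move=> hphi; rewrite character_laurent_elt //; apply: ereal_sup_ubound.
  exists (\row_k phi (x k)); first exact: joint_spectrum_char.
  by congr (cabs _)%:E; apply: eq_bigr => k _; rewrite mxE.
have := sup_le _ hphi0; move: hlt; case E : (monomial_sup X j) => [M||] //.
rewrite lte_fin lee_fin => hM hM0.
set sg := cabs (laurent (s 0) j) in hM.
have M0 : 0 <= M by apply: le_trans hM0; exact: cabs_ge0.
pose rho := (M + sg) / 2.
have r0 : 0 < rho by rewrite /rho; lra.
have [|B hB] := @character_power_bound R A N hN (laurent_elt j) rho r0.
  by move=> phi /sup_le; rewrite E lee_fin => h2; rewrite /rho; lra.
have sg0 : 0 < sg by exact: le_lt_trans hM.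
have q1 : `|rho / sg| < 1.
  rewrite ger0_norm; last by apply: divr_ge0; apply: ltW.
  by rewrite ltr_pdivrMr // mul1r /rho; lra.
have B1 : 0 < `|B| + 1 by have := normr_ge0 B; lra.
have /cvgrPdist_lt hq := cvg_expr q1.
have e0 : 0 < (`|B| + 1)^-1 by rewrite invr_gt0.
have [t _ /(_ t (leqnn t)) /=] := hq _ e0.
rewrite sub0r normrN ger0_norm; last by apply: exprn_ge0; apply: divr_ge0; apply: ltW.
rewrite expr_div_n ltr_pdivrMr ?exprn_gt0 // ltr_pdivlMl // => h2.
have h3 : sg ^+ t <= N (laurent_elt j ^+ t).
  rewrite -lee_fin; apply: le_trans (Csup_le_laurent_elt t hj).
  have [k nS|_] := hs (j *+ t); first by rewrite mulmxnE mulrn_wge0 // Mj.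
  by rewrite -/(laurent _ _) laurentX cabsX.
have h4 : B * rho ^+ t <= (`|B| + 1) * rho ^+ t.
  by rewrite ler_wpM2r ?exprn_ge0 ?(ltW r0) //; have := ler_norm B; lra.
have := hB t; lra.
Qed.

(** The coordinates on the spectrum are bounded by N (x k), their inverses, where
they exist, by N (h k). *)
Lemma joint_spectrum_hull_rcc : rat_convex_connected_circled (monomial_hull X).
Proof.
apply: (@mono_set_rcc R n _ _ T) => // k.
- split; first exact/S0_nonneg_off/S0_eps.
  apply: (@le_lt_trans _ _ (N (x k))%:E); last exact: ltry.
  apply: ge_ereal_sup => _ [_ [phi [pM p0 ->]] <-].
  by rewrite laurent_eps mxE lee_fin; apply: (character_le hN) => //; split.
- move=> Tk; split; first exact: nonneg_off_Neps.
  apply: (@le_lt_trans _ _ (N (h k))%:E); last exact: ltry.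
  apply: ge_ereal_sup => _ [_ [phi [pM p0 ->]] <-].
  have hphi : character phi by split.
  have e : phi (x k) * phi (h k) = 1 by rewrite -pM hh // (character1 hphi).
  have px : phi (x k) != 0 by apply: contra_eq_neq e => ->; rewrite mul0r eq_sym oner_neq0.
  rewrite laurentN laurent_eps mxE lee_fin.
  have -> : (phi (x k))^-1 = phi (h k) by apply: (mulfI px); rewrite e divff.
  exact: (character_le hN).
Qed.

End SpectrumHull.

Theorem theorem5p15 (R : realType) (n : nat) (a : 'rV[int]_n -> R) :
  (1 <= n)%N ->
  (forall i, S0 i -> 0 <= a i) ->
  a 0 = 1 ->
  (forall i j, S0 i -> S0 j -> a (i + j) <= a i * a j) ->
  [/\ rat_convex_connected_circled (Kset a),
      contained_in_hulls a (Kset a) &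
      forall K' : set 'rV[R[i]]_n, contained_in_hulls a K' -> K' `<=` Kset a].
Proof.
move=> _ a_ge0 a_0 a_M; split.
- exact: Kset_rcc.
- move=> A N x hN hx; have [h hh] := nonvanishing_inv x hN.
  exists (monomial_hull (joint_spectrum x)); last exact: (Kset_sub_hull a_ge0 hN hx hh).
  split; [exact: (joint_spectrum_hull_rcc hN hh)|exact: sub_monomial_hull|].
  move=> L hL /monomial_hull_mono; move/subset_trans; apply; exact: monomial_hull_sub.
- move=> K'; exact: contained_in_Kset.
Qed.
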